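(* Let $(u,e,p):[0,T]\to BV((0,L))\times\mathbb R\times\mathcal M([0,L])$ be a limit evolution, as $\varepsilon\searrow0$, of brittle damage evolutions with boundary datum $w\in AC([0,T];H^1(\mathbb R))$ (as defined in the context). Then $(u,e,p)$ is a quasi-static evolution of perfect plasticity (as defined in the context) if and only if $w$ satisfies $$\text{for all }0\le s<t\le T,\qquad \big|[w(t)]_0^L\big|<\big|[w(s)]_0^L\big|\ \Longrightarrow\ \big|[w(t)]_0^L\big|\le\sqrt{2\kappa a_0}\,\frac{L}{a_1}.$$
   Context: Fix constants $L,T,\kappa,a_0,a_1>0$ and $w\in AC([0,T];H^1(\mathbb R))$ (absolutely continuous in time). Dots denote time derivatives and primes denote space derivatives; $w(t)$ is identified with its continuous representative and $[f]_0^L:=f(L)-f(0)$. Set $K=[-\sqrt{2\kappa a_0},\sqrt{2\kappa a_0}]$. $\mathcal M(X)$ is the space of bounded Radon measures on $X$. Brittle damage evolution. For $\varepsilon>0$ with $\varepsilon a_0<a_1$, a quasi-static evolution of the homogenized brittle damage model is a triple of weakly-* measurable maps $u_\varepsilon:[0,T]\to H^1((0,L))$, $\Theta_\varepsilon:[0,T]\to L^\infty((0,L);[0,1])$, $a_\varepsilon=\big(\frac{1-\Theta_\varepsilon}{\varepsilon a_0}+\frac{\Theta_\varepsilon}{a_1}\big)^{-1}:[0,T]\to L^\infty((0,L))$ such that: - $u_\varepsilon(t)\in w(t)+H^1_0((0,L))$ for all $t\in[0,T]$; - (initial minimality) for all $v\in w(0)+H^1_0((0,L))$ and $\theta\in L^\infty((0,L);[0,1])$,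 $\int_0^L\big(\frac12a_\varepsilon(0)|u_\varepsilon'(0)|^2+\frac\kappa\varepsilon(1-\Theta_\varepsilon(0))\big)dx\le\int_0^L\big(\frac12\frac{\varepsilon a_0a_1}{\theta a_1+(1-\theta)\varepsilon a_0}|v'|^2+\frac\kappa\varepsilon\theta\big)dx$; - (monotonicity) for all $0\le s\le t\le T$, $a_\varepsilon(t)\le a_\varepsilon(s)$ and $\Theta_\varepsilon(t)\le\Theta_\varepsilon(s)$ a.e. in $(0,L)$; - (one-sided minimality) for all $t\in[0,T]$, $v\in w(t)+H^1_0((0,L))$, $\theta\in L^\infty((0,L);[0,1])$, $\frac12\int_0^La_\varepsilon(t)|u_\varepsilon'(t)|^2dx\le\frac12\int_0^L\frac{\varepsilon a_0a_\varepsilon(t)}{\theta a_\varepsilon(t)+(1-\theta)\varepsilon a_0}|v'|^2dx+\frac\kappa\varepsilon\int_0^L\theta\,\Theta_\varepsilon(t)\,dx$; - (energy balance) $\mathcal E_\varepsilon(t):=\frac12\int_0^La_\varepsilon(t)|u_\varepsilon'(t)|^2dx+\frac\kappa\varepsilon\int_0^L(1-\Theta_\varepsilon(t))dx$ satisfies $\mathcal E_\varepsilon(t)=\mathcal E_\varepsilon(0)+\int_0^t\int_0^La_\varepsilon(s)u_\varepsilon'(s)\dot w'(s)\,dx\,ds$ for all $t\in[0,T]$. The stress $\sigma_\varepsilon(t)=a_\varepsilon(t)u_\varepsilon'(t)$ is constant in space and is identified with a real number. Limit evolution. For each such $\varepsilon$ let $(u_\varepsilon,\Theta_\varepsilon,a_\varepsilon)$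 be a brittle damage evolution. A limit evolution consists of the absolutely continuous functions $(u,e,p,\sigma,\mu):[0,T]\to BV((0,L))\times\mathbb R\times\mathcal M([0,L])\times K\times\mathcal M([0,L])$ obtained along a sequence $\varepsilon\searrow0$ (independent of $t$) such that, for every $t\in[0,T]$: $u_\varepsilon(t)\rightharpoonup u(t)$ weakly-* in $BV((0,L))$; $\mu_\varepsilon(t):=\frac{1-\Theta_\varepsilon(t)}{\varepsilon}\mathcal L^1\llcorner(0,L)\rightharpoonup\mu(t)$ weakly-* in $\mathcal M([0,L])$; $\sigma_\varepsilon(t)\to\sigma(t)$; $\frac{\sigma_\varepsilon(t)}{a_1}\Theta_\varepsilon(t)\rightharpoonup e(t)$ weakly in $L^2((0,L))$; $\frac{\sigma_\varepsilon(t)}{a_0}\mu_\varepsilon(t)\rightharpoonup p(t)$ weakly-* in $\mathcal M([0,L])$. (Such sequences and limits exist.) Perfect plasticity. A quasi-static evolution of perfect plasticity is a triple $(u,e,p):[0,T]\to BV((0,L))\times L^2((0,L))\times\mathcal M([0,L])$ such that, for all $t\in[0,T]$: $p(t)\llcorner\{0,L\}=(w(t)-u(t))(\delta_L-\delta_0)$, i.e. $=(w(t)(L)-u(t)(L))\delta_L-(w(t)(0)-u(t)(0))\delta_0$ with inner traces of $u(t)$; $Du(t)=e(t)\mathcal L^1\llcorner(0,L)+p(t)\llcorner(0,L)$; $\sigma(t):=a_1e(t)$ satisfies $\sigma(t)'=0$ in $H^{-1}((0,L))$ and $\sigma(t)\in K$ $\mathcal L^1$-a.e. in $(0,L)$;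 the map $p:[0,T]\to\mathcal M([0,L])$ has bounded variation; and the energy balance $$\frac12\int_0^La_1e(t)^2dx+\mathrm{Diss}_K(p;0,t)=\frac12\int_0^La_1e(0)^2dx+\int_0^t\int_0^L\sigma(s)\dot w'(s,x)\,dx\,ds$$ holds, where $\mathrm{Diss}_K(p;0,t)=\sqrt{2\kappa a_0}\,\sup\big\{\sum_{i=1}^n|p(s_i)-p(s_{i-1})|([0,L]):n\in\mathbb N,\ 0=s_0\le s_1\le\dots\le s_n=t\big\}$. *)

(* Defs.v *)
From mathcomp Require Import all_boot all_order all_algebra.
From mathcomp Require Import all_classical all_reals all_analysis.

Set Implicit Arguments.
Unset Strict Implicit.
Unset Printing Implicit Defensive.

Import Order.TTheory GRing.Theory Num.Theory.
Import numFieldNormedType.Exports.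

Local Open Scope ring_scope.
Local Open Scope classical_set_scope.

(* Elements of Lebesgue, Sobolev and BV spaces are represented by functions
   R -> R; only their restriction to the relevant interval matters, and, except
   for the boundary datum (continuous representative), only up to a.e. equality.
   Time-dependent objects are functions of t : R of which only the values at
   t \in [0, T] matter. *)

Section function_spaces.
Context {R : realType}.
Local Notation leb := (@lebesgue_measure R).
Implicit Types (I : set R) (u v g phi : R -> R).

(* phi \in C^1_c(I); on an open interval C^1_c and C^oo_c test functions give the
   same weak derivatives, the same H^1_0 and the same distributional measures *)
Definition test_fun I phi :=
  [/\ forall x, derivable phi x 1,
      continuous (derive1 phi) &
      exists K : set R,
        [/\ compact K, K `<=` I & forall x, ~ K x -> phi x = 0] ].

Definition L1 I u := leb.-integrable I (EFin \o u).

Definition L1_dist I u v : R := \int[leb]_(x in I) `|u x - v x|.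

Definition L2 I u :=
  measurable_fun I u /\ leb.-integrable I (EFin \o (fun x => u x ^+ 2)).

Definition weak_derivative I u g :=
  L2 I g /\ forall phi, test_fun I phi ->
    \int[leb]_(x in I) (u x * derive1 phi x) =
    - \int[leb]_(x in I) (g x * phi x).

Definition H1 I u := L2 I u /\ exists g, weak_derivative I u g.

Definition wderiv I u : R -> R := xget (cst 0) [set g | weak_derivative I u g].

Definition H1_inner I u v : R :=
  \int[leb]_(x in I) (u x * v x) +
  \int[leb]_(x in I) (wderiv I u x * wderiv I v x).

Definition H1_norm I u : R := Num.sqrt (H1_inner I u u).

(* closure of the test functions in H^1 *)
Definition H10 I u :=
  H1 I u /\ forall eta : R, 0 < eta ->
    exists2 phi, test_fun I phi & H1_norm I (u \- phi) < eta.

(* v \in g + H^1_0((0, L)) *)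
Definition admissible (L : R) g v :=
  H1 `]0, L[ v /\ H10 `]0, L[ (v \- g).

Definition Linf01 I (theta : R -> R) :=
  measurable_fun I theta /\
  {ae leb, forall x, I x -> 0 <= theta x <= 1}.

Definition Linf I (a : R -> R) :=
  measurable_fun I a /\
  exists M : R, {ae leb, forall x, I x -> `|a x| <= M}.

(* \int_0^t \int_0^L S(s, x) wdot'(s, x) dx ds *)
Definition external_work (L : R) (wdot S : R -> R -> R) (t : R) : R :=
  \int[leb]_(s in `[0, t]) \int[leb]_(x in `]0, L[)
    (S s x * wderiv setT (wdot s) x).

Definition boundary_jump (L : R) u : R := u L - u 0.

End function_spaces.

(* A bounded Radon measure on a Borel set X of the line is a (finite, signed)
   charge on the Borel sets of R that is concentrated on X. *)
Section radon_measures.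
Context {R : realType}.
Local Notation leb := (@lebesgue_measure R).
Local Notation charges := (charge (measurableTypeR R) R).
Implicit Types (nu : charges) (X : set R).

Definition bounded_radon X nu :=
  forall A : set (measurableTypeR R), measurable A -> nu A = nu (A `&` X).

Lemma hahn_exists nu :
  exists PN : set (measurableTypeR R) * set (measurableTypeR R),
    hahn_decomposition nu PN.1 PN.2.
Proof. by have [P [N PN]] := Hahn_decomposition nu; exists (P, N). Qed.

Definition hahn nu := svalP (cid (hahn_exists nu)).

(* |nu|(A) *)
Definition total_var nu (A : set R) : \bar R := charge_variation (hahn nu) A.

(* |nu1 - nu2|(X) *)
Definition var_dist X nu1 nu2 : \bar R :=
  total_var (cadd nu1 (copp nu2)) X.

Definition charge_int nu X (f : R -> R) : R :=
  \int[jordan_pos (hahn nu)]_(x in X) f x -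
  \int[jordan_neg (hahn nu)]_(x in X) f x.

(* weak-* convergence in M([0, L]) of the measures (f n) L^1 |_ (0, L) *)
Definition density_wstar_cvg (L : R) (f : nat -> R -> R) nu :=
  forall phi : R -> R, {within `[0, L], continuous phi} ->
    (fun n => \int[leb]_(x in `]0, L[) (phi x * f n x)) @ \oo -->
    charge_int nu `[0, L] phi.

End radon_measures.

Section BV.
Context {R : realType}.
Local Notation leb := (@lebesgue_measure R).
Local Notation charges := (charge (measurableTypeR R) R).
Implicit Types (L : R) (u v : R -> R) (nu : charges).

Definition measure_derivative L u nu :=
  bounded_radon `]0, L[ nu /\ forall phi, test_fun `]0, L[ phi ->
    \int[leb]_(x in `]0, L[) (u x * derive1 phi x) =
    - charge_int nu `]0, L[ phi.

Definition BV L u := L1 `]0, L[ u /\ exists nu, measure_derivative L u nu.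

Definition Du L u : charges :=
  if pselect (exists nu, measure_derivative L u nu) is left h
  then sval (cid h) else czero.

Definition BV_dist L u v : \bar R :=
  ((L1_dist `]0%R, L[ u v)%:E + total_var (Du L (u \- v)%R) `]0%R, L[)%E.

(* strong L^1 convergence and weak-* convergence of the derivatives in
   M((0, L)), the dual of C_0((0, L)) *)
Definition BV_wstar_cvg L (un : nat -> R -> R) u :=
  ((fun n => L1_dist `]0, L[ (un n) u) @ \oo --> (0 : R)) /\
  forall phi : R -> R, {within `[0, L], continuous phi} ->
    phi 0 = 0 -> phi L = 0 ->
    (fun n => charge_int (Du L (un n)) `]0, L[ phi) @ \oo -->
    charge_int (Du L u) `]0, L[ phi.

(* inner traces at the endpoints of (0, L) *)
Definition trace0 u : R := xget 0 [set c |
  (fun r => r^-1 * \int[leb]_(x in `]0, r[) `|u x - c|) @ 0^'+ --> (0 : R)].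

Definition traceL L u : R := xget 0 [set c |
  (fun r => r^-1 * \int[leb]_(x in `](L - r), L[) `|u x - c|) @ 0^'+
    --> (0 : R)].

End BV.

Section time.
Context {R : realType}.
Local Notation leb := (@lebesgue_measure R).

(* absolute continuity on [0, T] of a map f into a metric space (X, d) *)
Definition abs_continuous (T : R) (X : Type) (d : X -> X -> \bar R)
    (f : R -> X) :=
  forall eta : R, 0 < eta -> exists2 delta : R, 0 < delta &
    forall (n : nat) (a b : nat -> R),
      (forall i, (i < n)%N -> [/\ 0 <= a i, a i <= b i & b i <= T]) ->
      (forall i j, (i < n)%N -> (j < n)%N -> i != j ->
        b i <= a j \/ b j <= a i) ->
      \sum_(i < n) (b i - a i) < delta ->
      (\sum_(i < n) d (f (a i)) (f (b i)) < eta%:E)%E.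

Definition real_dist (x y : R) : \bar R := `|x - y|%:E.

Definition H1_dist I (u v : R -> R) : \bar R := (H1_norm I (u \- v))%:E.

(* pointwise variation on [0, t] of a map f into a metric space (X, d) *)
Definition variation_upto (X : Type) (d : X -> X -> \bar R) (f : R -> X)
    (t : R) : \bar R :=
  ereal_sup [set V | exists n (s : nat -> R),
    [/\ s 0%N = 0, s n = t,
        forall i, (i < n)%N -> s i <= s i.+1 &
        V = (\sum_(i < n) d (f (s i.+1)) (f (s i)))%E] ].

Definition H1_wstar_measurable (T : R) I (f : R -> R -> R) :=
  forall v, H1 I v -> measurable_fun `[0, T] (fun t => H1_inner I (f t) v).

Definition Linf_wstar_measurable (T : R) I (f : R -> R -> R) :=
  forall g, L1 I g ->
    measurable_fun `[0, T] (fun t => \int[leb]_(x in I) (f t x * g x)).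

(* w \in AC([0, T]; H^1(R)), every w t being the continuous representative *)
Definition AC_H1 (T : R) (w : R -> R -> R) :=
  (forall t, 0 <= t <= T -> H1 setT (w t) /\ continuous (w t)) /\
  abs_continuous T (H1_dist setT) w.

(* wdot is a representative of the time derivative of w: the limit in H^1(R) of
   the difference quotients at almost every time *)
Definition H1_time_derivative (T : R) (w wdot : R -> R -> R) :=
  [/\ forall t, 0 <= t <= T -> H1 setT (wdot t),
      H1_wstar_measurable T setT wdot &
      {ae leb, forall t, 0 < t < T ->
        (fun h => H1_norm setT
          (fun x => h^-1 * (w (t + h) x - w t x) - wdot t x)) @ 0^'
          --> (0 : R)} ].

End time.

Section brittle_damage.
Context {R : realType}.
Local Notation leb := (@lebesgue_measure R).
Variables (L T kappa a0 a1 : R) (w wdot : R -> R -> R).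
Local Notation dx := (wderiv `]0, L[).

Definition damage_energy (eps : R) (a u Theta : R -> R) : R :=
  2^-1 * \int[leb]_(x in `]0, L[) (a x * (dx u x) ^+ 2) +
  kappa / eps * \int[leb]_(x in `]0, L[) (1 - Theta x).

Definition brittle_damage_evolution (eps : R) (u Theta a : R -> R -> R) :=
  [/\ [/\ H1_wstar_measurable T `]0, L[ u,
          Linf_wstar_measurable T `]0, L[ Theta &
          Linf_wstar_measurable T `]0, L[ a],
      forall t, 0 <= t <= T ->
        [/\ admissible L (w t) (u t),
            Linf01 `]0, L[ (Theta t),
            Linf `]0, L[ (a t) &
            {ae leb, forall x, `]0, L[ x ->
              a t x = ((1 - Theta t x) / (eps * a0) + Theta t x / a1)^-1}],
      forall v theta, admissible L (w 0) v -> Linf01 `]0, L[ theta ->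
        \int[leb]_(x in `]0, L[)
          (2^-1 * a 0 x * (dx (u 0) x) ^+ 2 + kappa / eps * (1 - Theta 0 x)) <=
        \int[leb]_(x in `]0, L[)
          (2^-1 * (eps * a0 * a1 /
                   (theta x * a1 + (1 - theta x) * (eps * a0))) *
             (dx v x) ^+ 2 + kappa / eps * theta x),
      forall s t, 0 <= s -> s <= t -> t <= T ->
        {ae leb, forall x, `]0, L[ x ->
          a t x <= a s x /\ Theta t x <= Theta s x} &
      (forall t v theta, 0 <= t <= T ->
        admissible L (w t) v -> Linf01 `]0, L[ theta ->
        2^-1 * \int[leb]_(x in `]0, L[) (a t x * (dx (u t) x) ^+ 2) <=
        2^-1 * \int[leb]_(x in `]0, L[)
          (eps * a0 * a t x /
             (theta x * a t x + (1 - theta x) * (eps * a0)) *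
           (dx v x) ^+ 2) +
        kappa / eps * \int[leb]_(x in `]0, L[) (theta x * Theta t x))
      /\
      (forall t, 0 <= t <= T ->
        damage_energy eps (a t) (u t) (Theta t) =
        damage_energy eps (a 0) (u 0) (Theta 0) +
        external_work L wdot (fun s x => a s x * dx (u s) x) t) ].

(* the real number a.e. equal to the stress a u' *)
Definition stress (a u : R -> R) : R := xget 0 [set c |
  {ae leb, forall x, `]0, L[ x -> a x * dx u x = c}].

End brittle_damage.

Section evolutions.
Context {R : realType}.
Local Notation leb := (@lebesgue_measure R).
Local Notation charges := (charge (measurableTypeR R) R).
Variables (L T kappa a0 a1 : R).

Definition yield_set : set R :=
  `[- Num.sqrt (2 * kappa * a0), Num.sqrt (2 * kappa * a0)].

(* ue, Thetae, ae are indexed by the damage parameter eps, then by time *)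
Definition limit_evolution (ue Thetae ae : R -> R -> R -> R)
    (u : R -> R -> R) (e : R -> R) (p : R -> charges) (sigma : R -> R)
    (mu : R -> charges) :=
  [/\ forall t, 0 <= t <= T ->
        [/\ BV L (u t), bounded_radon `[0, L] (p t), yield_set (sigma t) &
            bounded_radon `[0, L] (mu t)],
      [/\ abs_continuous T (BV_dist L) u,
          abs_continuous T real_dist e,
          abs_continuous T (var_dist `[0, L]) p,
          abs_continuous T real_dist sigma &
          abs_continuous T (var_dist `[0, L]) mu] &
      exists eps : nat -> R,
        let sigman t n := stress L (ae (eps n) t) (ue (eps n) t) in
        let mun t n x := (1 - Thetae (eps n) t x) / eps n in
        [/\ forall n, 0 < eps n /\ eps n * a0 < a1,
            eps @ \oo --> (0 : R) &
            forall t, 0 <= t <= T ->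
              [/\ BV_wstar_cvg L (fun n => ue (eps n) t) (u t),
                  density_wstar_cvg L (mun t) (mu t),
                  sigman t @ \oo --> sigma t,
                  forall g, L2 `]0, L[ g ->
                    (fun n => \int[leb]_(x in `]0, L[)
                      (sigman t n / a1 * Thetae (eps n) t x * g x)) @ \oo -->
                    \int[leb]_(x in `]0, L[) (e t * g x) &
                  density_wstar_cvg L
                    (fun n x => sigman t n / a0 * mun t n x) (p t)] ] ].

Definition elastic_energy (e : R -> R) : R :=
  2^-1 * \int[leb]_(x in `]0, L[) (a1 * (e x) ^+ 2).

Definition dissipation (p : R -> charges) (t : R) : \bar R :=
  ((Num.sqrt (2 * kappa * a0))%:E *
   variation_upto (var_dist `[0%R, L]) p t)%E.

Definition perfect_plasticity_evolution (w wdot : R -> R -> R)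
    (u e : R -> R -> R) (p : R -> charges) :=
  let sigma t x := a1 * e t x in
  [/\ forall t, 0 <= t <= T ->
        [/\ BV L (u t), L2 `]0, L[ (e t) & bounded_radon `[0, L] (p t)],
      forall t, 0 <= t <= T ->
        (forall A : set (measurableTypeR R), measurable A ->
          p t (A `&` [set 0; L]) =
          ((w t L - traceL L (u t))%:E * dirac L A -
           (w t 0%R - trace0 (u t))%:E * dirac (0%R : R) A)%E) /\
        (forall A : set (measurableTypeR R), measurable A -> A `<=` `]0, L[ ->
          Du L (u t) A = (\int[leb]_(x in A) (e t x)%:E + p t A)%E),
      forall t, 0 <= t <= T ->
        (forall phi, H10 `]0, L[ phi ->
          \int[leb]_(x in `]0, L[) (sigma t x * wderiv `]0, L[ phi x) = 0) /\
        {ae leb, forall x, `]0, L[ x -> yield_set (sigma t x)},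
      (variation_upto (var_dist `[0%R, L]) p T < +oo)%E &
      forall t, 0 <= t <= T ->
        (((elastic_energy (e t))%:E + dissipation p t)%E =
         (elastic_energy (e 0) + external_work L wdot sigma t)%:E) ].

End evolutions.

(* Main.v *)
Require Import Defs.
From HB Require Import structures.
From mathcomp Require Import all_boot all_order all_algebra.
From mathcomp Require Import all_classical all_reals all_analysis.
From mathcomp Require Import measurable_realfun lra ring.

(** In one space dimension everything is decided by three functions of time:
    the jump [l t = w t L - w t 0] of the boundary datum, the stress [sigma t],
    and [P t = mu t (`[0, L]) / a0], the accumulated plastic deformation.
    Put [k = Num.sqrt (2 * kappa * a0)] and [b = L / a1].

    For fixed [eps], comparing with competitors that do no further damage shows that
    the stress [a u'] is constant in space ([stress_constant]), so that integrating
    [u' = sigma / a] turns the boundary condition into a relation between the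
    stress, the damaged mass and the jump ([sig_compliance]), and the energy
    becomes a function of these scalars ([energy_eps]).  In the limit
    ([limit_stress_compliance], [limit_energy_balance], [limit_initial_yield])
    [sigma (P + b) = l] with [P] nondecreasing and [`|sigma| <= k];
    [sigma l / 2 + k ^+ 2 P / 2] grows by the integral of [sigma l']; and
    [`|sigma 0| = k] if [P 0 > 0].

    The energy balance of perfect plasticity has the same power on the right.
    Subtracting the two balances, it holds if and only if
    [k Var (p; 0, t) = [(sigma ^+ 2 + k ^+ 2) P / 2]_0^t] for all [t]
    ([energy_balance_iff]), where [p t] is [sigma t / a0] times the positive
    measure [mu t], and so has mass [sigma t * P t].

    The other tool is that [P] cannot move while the stress stays strictly below
    the yield value ([no_flow_below_yield]): the scalar balance bounds a positive
    multiple of the increase of [P] by the oscillation of [sigma] times the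
    variation of [l], and by uniform continuity of [sigma] the oscillation is
    arbitrarily small on a fine subdivision.

    If the plastic balance holds and [P s > 0], [`|sigma|] cannot drop after [s]:
    below a level less than [k ^+ 2] there is no flow, so [p] varies by
    [P `|sigma t - sigma s|] while the right-hand side decreases.  Therefore
    [`|l|] can only decrease from times at which [P = 0], where [`|l| <= k b].
    Conversely, if the stress were strictly below yield at a time with [P > 0],
    it would have fallen there from a higher level with [P] frozen, and between
    two levels close to [k ^+ 2] the jump [`|l|] would decrease while larger than
    [k b], against the hypothesis ([yield_of_plastic_strain]).  So the stress is
    frozen at [k] or [- k] once [P > 0], the increments of [p] have a sign, their
    variation is [k] times the increment of [P], and the plastic balance follows.

    The remaining requirements of perfect plasticity hold for every limit
    evolution.  The Green formula passes to the limit ([green_limit]); tested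
    with functions vanishing at the endpoints it identifies the derivative of [u]
    ([DuE]), and by Fubini it gives [u x = w 0 + e x + p `[0, x]] almost
    everywhere ([displacement_formula]), from which the inner traces are read off
    ([trace0_eq], [traceL_eq]). *)

Set Implicit Arguments.
Unset Strict Implicit.
Unset Printing Implicit Defensive.

Import Order.TTheory GRing.Theory Num.Theory.
Import numFieldNormedType.Exports.

Local Open Scope ring_scope.
Local Open Scope classical_set_scope.

(** * Limits of real sequences *)

Section real_sequences.
Context {R : realType}.
Implicit Types (u v : nat -> R).

Lemma cvgn_ge u (l c : R) : u @ \oo --> l -> (forall n, c <= u n) -> c <= l.
Proof.
move=> ul uc; apply: (@ler_cvg_to nat \oo _ R (cst c) u) ul _.
  exact: cvg_cst.
exact: nearW.
Qed.

Lemma cvgn_le u (l c : R) : u @ \oo --> l -> (forall n, u n <= c) -> l <= c.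
Proof.
move=> ul uc; apply: (@ler_cvg_to nat \oo _ R u (cst c)) ul _ _.
  exact: cvg_cst.
exact: nearW.
Qed.

Lemma cvgn_unique u (l l' : R) : u @ \oo --> l -> u @ \oo --> l' -> l = l'.
Proof. by move=> ul ul'; exact: (cvg_unique _ ul ul'). Qed.

End real_sequences.

(** * Integrals of functions known only almost everywhere *)

Section integration_tools.
Context d (T : measurableType d) (R : realType).
Variable mu : {measure set T -> \bar R}.
Implicit Types (D N : set T).

Import HBNNSimple.

(** The integral of a nonnegative function, measurable or not, is a supremum over
    simple functions below it, and a simple function can be set to zero on a null
    set without changing its integral. *)
Lemma ge0_integral_off_null_le (f g : T -> \bar R) N :
  (forall x, (0 <= f x)%E) -> (forall x, (0 <= g x)%E) ->
  measurable N -> mu N = 0%E -> (forall x, ~ N x -> f x = g x) ->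
  (\int[mu]_x f x <= \int[mu]_x g x)%E.
Proof.
move=> f0 g0 mN N0 fg; rewrite !ge0_integralTE//.
apply: ge_ereal_sup => _ [h /= hf <-].
pose h' := proj_nnsfun h (measurableC mN).
have -> : sintegral mu h = sintegral mu h'.
  rewrite -!integralT_nnsfun; apply: ge0_ae_eq_integral => //.
  - by apply/measurable_EFinP; exact: measurable_funPT h.
  - by apply/measurable_EFinP; exact: measurable_funPT h'.
  - by move=> x _; rewrite lee_fin.
  - by move=> x _; rewrite lee_fin mulr_ge0.
  - exists N; split => // x /=; apply: contra_notP => Nx _.
    by rewrite /= mindicE mem_set// mulr1.
apply: ereal_sup_ubound; exists h' => //= x.
have [Nx|Nx] := pselect (N x).
  by rewrite /= mindicE memNset ?mulr0//; apply.
by rewrite /= mindicE mem_set// mulr1 -fg.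
Qed.

Lemma integral_ae_congr (f g : T -> \bar R) D :
  {ae mu, forall x, D x -> f x = g x} ->
  (\int[mu]_(x in D) f x = \int[mu]_(x in D) g x)%E.
Proof.
move=> [N [mN N0 Nfg]].
have fg x : ~ N x -> (f \_ D) x = (g \_ D) x.
  move=> Nx; rewrite !patchE; case: ifPn => //; rewrite inE => Dx.
  by apply: contrapT => nfg; apply: Nx; apply: Nfg => /= /(_ Dx).
have le (f' g' : T -> \bar R) : (forall x, ~ N x -> (f' \_ D) x = (g' \_ D) x) ->
   (\int[mu]_x (f' \_ D)^\+ x <= \int[mu]_x (g' \_ D)^\+ x)%E /\
   (\int[mu]_x (f' \_ D)^\- x <= \int[mu]_x (g' \_ D)^\- x)%E.
  move=> fg'; split; apply: (@ge0_integral_off_null_le _ _ N) => // x Nx.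
  - by rewrite !funeposE fg'.
  - by rewrite !funenegE fg'.
rewrite integral_mkcond [RHS]integral_mkcond integralE [RHS]integralE.
have [a b] := le _ _ fg.
have [c e] := le _ _ (fun x Nx => esym (fg x Nx)).
by congr (_ - _)%E; apply/eqP; rewrite eq_le; apply/andP.
Qed.

(** Weak derivatives, stresses and damage fields are only determined almost
    everywhere, and the expressions built from them need not be measurable;
    equality almost everywhere alone lets them be rewritten under the integral. *)
Lemma Rintegral_ae_congr (f g : T -> R) D :
  {ae mu, forall x, D x -> f x = g x} ->
  \int[mu]_(x in D) f x = \int[mu]_(x in D) g x.
Proof.
move=> fg; congr fine; apply: integral_ae_congr.
by apply: filterS fg => x + Dx => ->.
Qed.

Lemma Rintegral_dominated_cvg (f_ : nat -> T -> R) (f g : T -> R) D :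
  measurable D -> (forall n, measurable_fun D (f_ n)) ->
  measurable_fun D f ->
  {ae mu, forall x, D x -> f_ ^~ x @ \oo --> f x} ->
  mu.-integrable D (EFin \o g) ->
  (forall n x, D x -> `|f_ n x| <= g x) ->
  mu.-integrable D (EFin \o f) /\
  (fun n => \int[mu]_(x in D) f_ n x) @ \oo --> \int[mu]_(x in D) f x.
Proof.
move=> mD mf_ mf f_f ig f_g.
have [] := @dominated_convergence _ _ _ mu D mD (fun n => EFin \o f_ n)
  (EFin \o f) (EFin \o g).
- by move=> n; exact/measurable_EFinP.
- exact/measurable_EFinP.
- apply: filterS f_f => x f_f Dx; apply: cvg_EFin; last exact: f_f.
  by near=> n.
- exact: ig.
- by apply: aeW => x n Dx; rewrite /= lee_fin f_g.
move=> intf _ cv; split => //.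
have fin : (\int[mu]_(x in D) (f x)%:E)%E \is a fin_num.
  exact: integrable_fin_num.
by apply: fine_cvg; rewrite fineK.
Unshelve. all: by end_near. Qed.

Lemma Rintegral_bound (f g : T -> R) D :
  measurable D -> mu.-integrable D (EFin \o f) ->
  mu.-integrable D (EFin \o g) ->
  (forall x, D x -> `|f x| <= g x) ->
  `|\int[mu]_(x in D) f x| <= \int[mu]_(x in D) g x.
Proof.
move=> mD intf intg fg; apply: le_trans (le_normr_Rintegral mD intf) _.
by apply: le_Rintegral => //; exact: integrable_norm.
Qed.

Lemma integrable_mul_bounded (f g : T -> R) (M : R) D :
  measurable D -> mu.-integrable D (EFin \o f) -> measurable_fun D g ->
  (forall x, D x -> `|g x| <= M) ->
  mu.-integrable D (EFin \o (fun x => f x * g x)).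
Proof.
move=> mD intf mg gM.
apply: (@le_integrable _ _ _ _ _ mD _ (EFin \o (fun x => M * f x))).
- apply/measurable_EFinP/measurable_funM => //.
  by apply/measurable_EFinP; exact: measurable_int intf.
- move=> x Dx; rewrite /= lee_fin !normrM mulrC ler_wpM2r//.
  by rewrite (le_trans (gM x Dx))// ler_norm.
- have := integrableZl mD M intf.
  by congr (_.-integrable _ _); apply/funext => x.
Qed.

Lemma le_integrableR (f g : T -> R) D :
  measurable D -> measurable_fun D f -> (forall x, D x -> `|f x| <= g x) ->
  mu.-integrable D (EFin \o g) -> mu.-integrable D (EFin \o f).
Proof.
move=> mD mf fg; apply: le_integrable => //; first exact/measurable_EFinP.
by move=> x Dx; rewrite /= lee_fin (le_trans (fg x Dx))// ler_norm.
Qed.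

Lemma integrableD_EFin (f g : T -> R) D :
  measurable D -> mu.-integrable D (EFin \o f) ->
  mu.-integrable D (EFin \o g) ->
  mu.-integrable D (EFin \o (fun x => f x + g x)).
Proof. by move=> mD f1 f2; exact: (integrableD mD f1 f2). Qed.

Lemma integrableB_EFin (f g : T -> R) D :
  measurable D -> mu.-integrable D (EFin \o f) ->
  mu.-integrable D (EFin \o g) ->
  mu.-integrable D (EFin \o (fun x => f x - g x)).
Proof. by move=> mD f1 f2; exact: (integrableB mD f1 f2). Qed.

Lemma integrableZ_EFin (c : R) (f : T -> R) D :
  measurable D -> mu.-integrable D (EFin \o f) ->
  mu.-integrable D (EFin \o (fun x => c * f x)).
Proof. by move=> mD f1; exact: (integrableZl mD c f1). Qed.

Lemma ae_imp (P Q : T -> Prop) : (forall x, P x -> Q x) ->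
  {ae mu, forall x, P x} -> {ae mu, forall x, Q x}.
Proof. by move=> PQ; apply: filterS. Qed.

Lemma ae_imp2 (P P' Q : T -> Prop) : (forall x, P x -> P' x -> Q x) ->
  {ae mu, forall x, P x} -> {ae mu, forall x, P' x} -> {ae mu, forall x, Q x}.
Proof. by move=> PQ; apply: filterS2. Qed.

Lemma ae_imp3 (P P' P'' Q : T -> Prop) :
  (forall x, P x -> P' x -> P'' x -> Q x) ->
  {ae mu, forall x, P x} -> {ae mu, forall x, P' x} ->
  {ae mu, forall x, P'' x} -> {ae mu, forall x, Q x}.
Proof. by move=> PQ; apply: filterS3. Qed.

Lemma RintegralN (f : T -> R) D :
  measurable D -> mu.-integrable D (EFin \o f) ->
  \int[mu]_(x in D) (- f x) = - \int[mu]_(x in D) f x.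
Proof.
move=> mD intf; rewrite -mulN1r -RintegralZl//.
by apply: eq_Rintegral => x _; rewrite mulN1r.
Qed.

Lemma ae_integrable (f g : T -> R) D :
  measurable D -> measurable_fun D g ->
  {ae mu, forall x, D x -> f x = g x} ->
  mu.-integrable D (EFin \o f) -> mu.-integrable D (EFin \o g).
Proof.
move=> mD mg fg /integrableP[_ fi]; apply/integrableP; split.
  exact/measurable_EFinP.
rewrite -(@integral_ae_congr (abse \o (EFin \o f)))//.
by apply: filterS fg => x + Dx => /(_ Dx) /= ->.
Qed.

Lemma integrable_patch (f : T -> R) D :
  measurable D -> mu.-integrable D (EFin \o f) ->
  mu.-integrable setT (EFin \o (f \_ D)).
Proof. by move=> mD /(integrable_mkcond _ mD); rewrite restrict_EFin. Qed.

Lemma ge0_subset_Rintegral (f : T -> R) A D :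
  measurable A -> measurable D -> A `<=` D -> (forall x, D x -> 0 <= f x) ->
  mu.-integrable D (EFin \o f) ->
  \int[mu]_(x in A) f x <= \int[mu]_(x in D) f x.
Proof.
move=> mA mD AD f0 fi; have fA := integrableS mD mA AD fi.
rewrite /Rintegral fine_le//; try exact: integrable_fin_num.
apply: (@ge0_subset_integral _ _ _ mu A D mA mD (EFin \o f)) => //.
exact: measurable_int fi.
Qed.

End integration_tools.

(** * Smooth steps *)

Section smooth_steps.
Context {R : realType}.
Local Notation leb := (@lebesgue_measure R).

Lemma integrable_compact_support (r : R -> R) (a b : R) (D : set R) :
  continuous r -> (forall x, ~ (a <= x <= b) -> r x = 0) -> measurable D ->
  leb.-integrable D (EFin \o r).
Proof.
move=> cr r0 mD; apply: (@integrableS _ _ _ leb setT) => //.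
have -> : EFin \o r = (EFin \o r) \_ `[a, b].
  apply/funext => x; rewrite patchE; case: ifPn => //.
  by rewrite notin_setE/= in_itv/= => /r0 ->.
apply/(@integrable_mkcond _ _ _ leb `[a, b]) => //.
apply: continuous_compact_integrable; first exact: segment_compact.
exact: continuous_subspaceT.
Qed.

(** The way in which test functions are produced: a continuous function of
    compact support and zero mean is the derivative of one. *)
Lemma primitive_C1 (r : R -> R) (a b : R) :
  continuous r -> (forall x, ~ (a <= x <= b) -> r x = 0) -> a <= b ->
  let F x := \int[leb]_(y in `]-oo, x]) r y in
  [/\ forall x, derivable F x 1, derive1 F = r,
      forall x, x <= a -> F x = 0 &
      forall x, b <= x -> F x = \int[leb]_(y in `[a, b]) r y].
Proof.
move=> cr r0 ab F.
have dF x : derivable F x 1 /\ F^`() x = r x.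
  apply: (@continuous_FTC1 _ r -oo%O x (x + 1)).
  - by rewrite ltrDl.
  - exact: (integrable_compact_support cr r0).
  - exact: ltNyr.
  - exact: cr.
split.
- by move=> x; have [] := dF x.
- by apply/funext => x; have [] := dF x.
- move=> x xa; rewrite /F -(@Rintegral_itv_bndo_bndc _ -oo%O x); last first.
    exact: (integrable_compact_support cr r0).
  rewrite (@eq_Rintegral _ _ _ _ _ (cst 0)) ?Rintegral_cst ?mul0r//.
  move=> y; rewrite inE/= in_itv/= => yx; rewrite r0//; apply/negP.
  by rewrite negb_and -ltNge (lt_le_trans yx).
- move=> x bx; rewrite /F Rintegral_mkcond [RHS]Rintegral_mkcond.
  apply: eq_Rintegral => y _; rewrite !patchE.
  case: ifPn => [_|]; case: ifPn => //.
    by rewrite notin_setE/= in_itv/= => /r0.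
  rewrite inE/= in_itv/= notin_setE/= in_itv/= => /andP[_ yb] yx; exfalso.
  by apply: yx; exact: le_trans bx.
Qed.

(** The normalized primitive of a continuous bump supported in [`[a, a + d]]. *)
Lemma smooth_step_exists (a d : R) : 0 < d -> exists H : R -> R,
  [/\ (forall x, derivable H x 1), continuous (derive1 H) /\ continuous H,
      (forall x, 0 <= derive1 H x) /\ (forall x, 0 <= H x <= 1),
      (forall x, x <= a -> H x = 0 /\ derive1 H x = 0) &
      (forall x, a + d <= x -> H x = 1 /\ derive1 H x = 0)].
Proof.
move=> d0.
pose q (x : R) := (x - a) * (a + d - x).
(* Twice the positive part of a parabola vanishing at a and a + d. *)
pose r0 (x : R) : R := `|q x| + q x.
have r0_ge0 x : 0 <= r0 x by have := ler_norm (- q x); rewrite normrN /r0; lra.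
have cq : continuous q.
  move=> x; apply: cvgM; first by apply: cvgB; [exact: cvg_id|exact: cvg_cst].
  by apply: cvgB; [exact: cvg_cst|exact: cvg_id].
have cr0 : continuous r0.
  by move=> x; apply: cvgD; [apply: cvg_norm; exact: cq|exact: cq].
have r0_supp x : ~ (a < x < a + d) -> r0 x = 0.
  move=> /negP; rewrite negb_and -!leNgt => xad.
  have : q x <= 0 by rewrite /q; case/orP : xad => h; nra.
  by move=> /ler0_norm; rewrite /r0 => ->; rewrite addNr.
have r0_supp' x : ~ (a <= x <= a + d) -> r0 x = 0.
  by move=> h; apply: r0_supp => /andP[ax xd]; apply: h; rewrite !ltW.
have ad : a <= a + d by rewrite lerDl ltW.
have intr0 D : measurable D -> leb.-integrable D (EFin \o r0).
  exact: (integrable_compact_support cr0 r0_supp').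
have [dF F' Fa Fd] := primitive_C1 cr0 r0_supp' ad.
set F := (fun x => \int[leb]_(y in `]-oo, x]) r0 y) in dF F' Fa Fd.
pose I := \int[leb]_(y in `[a, a + d]) r0 y.
have mono x y : x <= y -> F x <= F y.
  move=> xy; apply: ge0_subset_Rintegral => //; last exact: intr0.
  by move=> z /=; rewrite !in_itv/= => zx; exact: le_trans xy.
have I0 : 0 < I.
  have : \int[leb]_(y in `[(a + d / 4), (a + 3 * d / 4)]) (d ^+ 2 / 16) <= I.
    apply: (@le_trans _ _ (\int[leb]_(y in `[(a + d / 4), (a + 3 * d / 4)]) r0 y)).
      apply: le_Rintegral => //.
      - have := (@continuous_compact_integrable _ (cst (d ^+ 2 / 16))
          `[(a + d / 4), (a + 3 * d / 4)]); apply; first exact: segment_compact.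
        by apply: continuous_subspaceT => x; exact: cvg_cst.
      - exact: intr0.
      - move=> x /=; rewrite in_itv/= => /andP[x1 x2].
        have : d ^+ 2 / 16 <= q x by rewrite /q; nra.
        by move=> /le_trans; apply; rewrite /r0 lerDr.
    apply: ge0_subset_Rintegral => //; last exact: intr0.
    by move=> z /=; rewrite !in_itv/= => /andP[? ?]; apply/andP; split; lra.
  rewrite Rintegral_cst//= lebesgue_measure_itv/= lte_fin ifT; last by lra.
  rewrite -EFinB/=; apply: lt_le_trans; rewrite mulr_gt0//; last by lra.
  by rewrite divr_gt0// exprn_gt0.
have dH (x : R) : is_derive x (1 : R) (fun x => F x / I) (r0 x / I).
  have dFx : is_derive x (1 : R) F (r0 x).
    by rewrite -F'; apply: DeriveDef; [exact: dF|rewrite derive1E].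
  have h := @is_deriveM _ _ F (cst I^-1) x 1 _ _ dFx (is_derive_cst _ _ _).
  apply: (is_derive_eq h).
  by rewrite scaler0 add0r /GRing.scale/= mulrC.
have H' : derive1 (fun x => F x / I) = (fun x => r0 x / I).
  by apply/funext => x; rewrite derive1E; apply: derive_val.
have FaI x : a + d <= x -> F x = I by exact: Fd.
have Fa0 x : x <= a -> F x = 0 by exact: Fa.
exists (fun x => F x / I); rewrite H'; split.
- by move=> x; apply: ex_derive.
- split; first by move=> x; apply: cvgM; [exact: cr0|exact: cvg_cst].
  move=> x; apply: cvgM; last exact: cvg_cst.
  by apply/differentiable_continuous/derivable1_diffP; exact: dF.
- split => x; first by rewrite divr_ge0// ltW.
  apply/andP; split.
    rewrite divr_ge0//; last exact: ltW.
    by apply: Rintegral_ge0.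
  rewrite ler_pdivrMr// mul1r.
  have [xa|xa] := leP (a + d) x; first by rewrite FaI.
  by rewrite -(FaI (a + d))// mono// ltW.
- move=> x xa; rewrite Fa0// mul0r r0_supp ?mul0r//.
  by case/andP => ax _; move: ax; rewrite ltNge xa.
- move=> x xa; rewrite FaI// divff ?gt_eqF// r0_supp ?mul0r//.
  by case/andP => _; rewrite ltNge xa.
Qed.

End smooth_steps.

(** * Charges on the line *)

Section charges_on_the_line.
Context {R : realType}.
Local Notation leb := (@lebesgue_measure R).
Local Notation charges := (charge (measurableTypeR R) R).
Local Notation fmeasure := {finite_measure set (measurableTypeR R) -> \bar R}.
Implicit Types (nu : charges) (m : fmeasure) (X A : set (measurableTypeR R)).

Lemma ocitv_cover : \bigcup_k (`](- k%:R)%R, k%:R] : set R) = setT.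
Proof.
apply/seteqP; split => // x _ /=.
exists (Num.bound `|x|) => //=; rewrite in_itv/=.
have := archi_boundP (normr_ge0 x).
by rewrite ltr_norml => /andP[-> /ltW].
Qed.

(** The half-open intervals are stable under intersection and generate the Borel
    sets. *)
Lemma measure_eq_of_ocitv (m1 : fmeasure)
    (m2 : {measure set (measurableTypeR R) -> \bar R}) :
  (forall a b : R, m1 `]a, b] = m2 `]a, b]) ->
  forall A, measurable A -> m1 A = m2 A.
Proof.
move=> m12 A mA.
apply: (@measure_unique _ R (measurableTypeR R) (@ocitv R)
  (fun k => `](- k%:R)%R, k%:R]%classic) _ _ _ _ m1 m2) => //.
- exact: ocitvI.
- by move=> i; exact: is_ocitv.
- exact: ocitv_cover.
- by move=> _ [[a b] _ <-]; exact: m12.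
- by move=> k; rewrite -ge0_fin_numE// fin_num_measure.
Qed.

Lemma finite_measure_cdf_rc m :
  right_continuous (fun x : R => fine (m `]-oo, x]) : R).
Proof.
move=> a; set G := fun x => _.
have mono x y : x <= y -> G x <= G y.
  move=> xy; rewrite /G fine_le ?fin_num_measure// le_measure ?inE//.
  by move=> z /=; rewrite !in_itv/= => /le_trans; apply.
have cv : G (a + n.+1%:R^-1) @[n --> \oo] --> G a.
  rewrite /G; apply/fine_cvg; rewrite fineK ?fin_num_measure//.
  rewrite (itvNycEbigcap false a); apply: nonincreasing_cvg_mu.
  - by rewrite -ge0_fin_numE// fin_num_measure.
  - by move=> i; exact: measurable_itv.
  - by apply: bigcap_measurable => // i _; exact: measurable_itv.
  - move=> k n kn; apply/subsetPset; apply: subset_itvl.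
    by rewrite bnd_simp lerD2l lef_pV2 ?posrE// ler_nat.
apply/cvgrPdist_lt => e e0.
have [N _ /(_ N (leqnn N))/= aN] := (@cvgrPdist_lt _ _ _ _ _ _ _).1 cv e e0.
have N0 : a < a + N.+1%:R^-1 by rewrite ltrDl.
near=> y; apply: le_lt_trans aN.
have ay : a <= y by apply/ltW; near: y; exact: nbhs_right_gt.
have yN : y <= a + N.+1%:R^-1 by near: y; exact: nbhs_right_le.
have h1 := mono _ _ ay; have h2 := mono _ _ yN.
by rewrite 2?ler0_norm ?subr_le0// ?lerN2 ?lerD2l ?lerN2//; exact: le_trans h2.
Unshelve. all: by end_near. Qed.

Lemma charge_jordanE nu A : measurable A ->
  nu A = (jordan_pos (hahn nu) A - jordan_neg (hahn nu) A)%E.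
Proof.
move=> mA; rewrite (jordan_decomp (hahn nu) mA) /cadd/= cscaleN1.
by [].
Qed.

(** If the charge is nonnegative on half-open intervals, the difference of the
    distribution functions of its Jordan parts is nondecreasing and right
    continuous, so it defines a Stieltjes measure; adding that measure to the
    negative part gives the positive part. *)
Lemma charge_ge0_of_ocitv nu :
  (forall a b : R, (0 <= nu `]a, b])%E) -> forall A, measurable A -> (0 <= nu A)%E.
Proof.
move=> nu0 A mA.
pose P : fmeasure := jordan_pos (hahn nu).
pose N : fmeasure := jordan_neg (hahn nu).
pose F (x : R) : R := fine (P `]-oo, x]) - fine (N `]-oo, x]).
have cut (m : fmeasure) (a b : R) : a <= b ->
    m `]a, b] = (fine (m `]-oo, b]%classic) - fine (m `]-oo, a]%classic))%:E.
  move=> ab; rewrite (@itv_bndbnd_setU _ _ -oo%O (BRight a) (BRight b))//.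
  rewrite measureU//; last first.
    apply/seteqP; split => // x [/=]; rewrite !in_itv/= => xa /andP[ax _].
    by move: xa; rewrite leNgt ax.
  by rewrite fineD ?fin_num_measure// addrC addKr fineK ?fin_num_measure.
have FE (a b : R) : a <= b -> (F b - F a)%:E = nu `]a, b].
  move=> ab; rewrite charge_jordanE// (cut P)// (cut N)// -EFinB; congr EFin.
  by rewrite /F; ring.
have Fnd : {homo F : x y / x <= y}.
  by move=> x y xy; rewrite -subr_ge0 -lee_fin FE.
have Frc : right_continuous F.
  by move=> x; apply: cvgB; exact: finite_measure_cdf_rc.
pose Fc := isCumulative.Build R _ R F Fnd Frc.
(* F is the distribution function of the charge. *)
pose cF : cumulative R R := HB.pack F Fc.
have PE : forall A, measurable A ->
    P A = measure_add N (lebesgue_stieltjes_measure cF) A.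
  apply: measure_eq_of_ocitv => a b.
  have [ab|ab] := leP a b; last first.
    by rewrite set_itv_ge ?measure0// -leNgt bnd_simp ltW.
  have LSE : lebesgue_stieltjes_measure cF `]a, b]%classic = (F b - F a)%:E.
    apply: etrans (measurable_mu_extE (wlength cF) _) _.
      exact: is_ocitv.
    exact: wlength_itv_bnd.
  have h : P `]a, b]%classic =
      (N `]a, b]%classic + lebesgue_stieltjes_measure cF `]a, b]%classic)%E.
    rewrite LSE (cut N)// (cut P)// -EFinD; congr EFin; rewrite /F.
    by ring.
  exact: etrans h (esym (measure_addE _ _ _)).
rewrite charge_jordanE// -/P -/N.
by rewrite sube_ge0 ?fin_num_measure// PE// measure_addE leeDl.
Qed.

(** The integral against a charge does not depend on how the charge is written as
    a difference of finite measures. *)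
Lemma charge_intE nu (m1 m2 : fmeasure) X (f : R -> R) :
  (forall A, measurable A -> A `<=` X -> nu A = (m1 A - m2 A)%E) -> measurable X ->
  measurable_fun X f -> (exists M, forall x, X x -> `|f x| <= M) ->
  charge_int nu X f = \int[m1]_(x in X) f x - \int[m2]_(x in X) f x.
Proof.
move=> nuE mX mf [M fM].
pose P : fmeasure := jordan_pos (hahn nu).
pose N : fmeasure := jordan_neg (hahn nu).
have intf m : m.-integrable X (EFin \o f).
  apply: (@le_integrableR _ _ _ _ _ (cst M)) => //.
  exact: finite_measure_integrable_cst.
have e : (\int[measure_add P m2]_(x in X) (f x)%:E =
          \int[measure_add N m1]_(x in X) (f x)%:E)%E.
  apply: eq_measure_integral => A mA AX.
  apply: etrans (measure_addE _ _ _) _; apply: etrans _ (esym (measure_addE _ _ _)).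
  have swap (x y z t : \bar R) : x \is a fin_num -> y \is a fin_num ->
      z \is a fin_num -> t \is a fin_num -> (x - y = z - t -> x + t = y + z)%E.
    case: x y z t => [x||] [y||] [z||] [t||]//= _ _ _ _.
    by rewrite -!EFinB -!EFinD => -[h]; congr EFin; move: h; lra.
  apply: swap; try exact: fin_num_measure.
  by rewrite -charge_jordanE// nuE.
rewrite !integral_measure_add// in e.
have key (x y z t : \bar R) : x \is a fin_num -> y \is a fin_num ->
    z \is a fin_num -> t \is a fin_num -> (x + t = y + z)%E ->
    fine x - fine y = fine z - fine t.
  case: x y z t => [x||] [y||] [z||] [t||]//= _ _ _ _.
  by rewrite -!EFinD => -[h]; move: h; lra.
by apply: key e; apply: integrable_fin_num => //; exact: intf.
all: exact: intf.
Qed.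

End charges_on_the_line.

(** * Test functions *)

Section test_functions.
Context {R : realType}.
Local Notation leb := (@lebesgue_measure R).
Local Notation charges := (charge (measurableTypeR R) R).
Local Notation fmeasure := {finite_measure set (measurableTypeR R) -> \bar R}.
Implicit Types (nu : charges) (m : fmeasure) (X A : set (measurableTypeR R)).

Lemma test_funS (I J : set R) (phi : R -> R) :
  I `<=` J -> test_fun I phi -> test_fun J phi.
Proof.
move=> IJ [d c [K [cK KI K0]]]; split => //; exists K; split => //.
exact: subset_trans IJ.
Qed.

Lemma test_fun_continuous (I : set R) (phi : R -> R) :
  test_fun I phi -> continuous phi.
Proof. by move=> [d _ _] x; apply/differentiable_continuous/derivable1_diffP. Qed.

Lemma test_fun_eq0 (I : set R) (phi : R -> R) (x : R) : test_fun I phi ->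
  ~ I x -> phi x = 0 /\ derive1 phi x = 0.
Proof.
move=> [d c [K [cK KI K0]]] Ix.
have Kx : ~ K x by move=> /KI.
split; first exact: K0.
have oK : open (~` K).
  by apply: closed_openC; apply: compact_closed => //; exact: norm_hausdorff.
rewrite derive1E (@near_eq_derive _ _ _ phi (cst 0) x 1) ?derive_cst//.
by near=> y; apply: K0; near: y; exact: open_nbhs_nbhs.
Unshelve. all: by end_near. Qed.

Lemma test_fun_bounded (I : set R) (phi : R -> R) : test_fun I phi ->
  exists M, forall x, `|phi x| <= M /\ `|derive1 phi x| <= M.
Proof.
move=> tphi; have cphi := test_fun_continuous tphi.
have [d c [K [cK KI K0]]] := tphi.
have tK : test_fun K phi by split => //; exists K; split.
have bd (f : R -> R) : continuous f -> (forall x, ~ K x -> f x = 0) ->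
    exists2 M, 0 <= M & forall x, `|f x| <= M.
  move=> cf f0.
  have /compact_bounded[M [_ h]] : compact (f @` K).
    by apply: continuous_compact => //; exact: continuous_subspaceT.
  exists (`|M| + 1) => [|x]; first by rewrite addr_ge0.
  have [Kx|Kx] := pselect (K x); last by rewrite f0// normr0 addr_ge0.
  by apply: h; [rewrite ltr_pwDr// ler_norm|exists x].
have [M1 M10 h1] := bd _ cphi K0.
have [M2 M20 h2] := bd _ c (fun x Kx => (test_fun_eq0 tK Kx).2).
exists (M1 + M2) => x; split.
- by rewrite (le_trans (h1 x))// lerDl.
- by rewrite (le_trans (h2 x))// lerDr.
Qed.

(** The difference of two smooth steps of width tending to zero, one starting
    just after [a] and the other ending just before [b]. *)
Lemma bump_seq (a b : R) : a < b -> exists phi : nat -> R -> R,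
  [/\ forall n, test_fun `]a, b[ (phi n),
      forall n, exists c d, [/\ a < c, c <= d, d < b &
        forall x, ~ (c <= x <= d) -> phi n x = 0],
      forall n x, 0 <= phi n x <= 1 &
      forall x, phi ^~ x @ \oo --> (\1_(`]a, b[ : set R) x : R)].
Proof.
(* Two margins and two ramps, each of width d n, fit into the interval. *)
move=> ab; pose d (n : nat) : R := (b - a) / 5 * n.+1%:R^-1.
have d0 n : 0 < d n by rewrite /d mulr_gt0 ?invr_gt0// divr_gt0 ?subr_gt0.
have dab n : d n <= (b - a) / 5.
  rewrite /d; apply: ler_piMr; first by rewrite divr_ge0 ?subr_ge0// ltW.
  by rewrite invf_le1 ?ltr0n// ler1n.
have stepL n := cid (smooth_step_exists (a + d n) (d0 n)).
have stepR n := cid (smooth_step_exists (b - 2 * d n) (d0 n)).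
pose f n := sval (stepL n); pose g n := sval (stepR n).
have fP n := svalP (stepL n); have gP n := svalP (stepR n).
pose phi n (x : R) : R := f n x - g n x.
have dphi n (x : R) : is_derive x (1 : R) (phi n) (derive1 (f n) x - derive1 (g n) x).
  have [df _ _ _ _] := fP n; have [dg _ _ _ _] := gP n.
  have h1 : is_derive x (1 : R) (f n) (derive1 (f n) x).
    by apply: DeriveDef; [exact: df|rewrite derive1E].
  have h2 : is_derive x (1 : R) (g n) (derive1 (g n) x).
    by apply: DeriveDef; [exact: dg|rewrite derive1E].
  exact: (is_deriveB h1 h2).
have phi0 n x : ~ (a + d n <= x <= b - d n) -> phi n x = 0.
  have [_ _ _ fl fr] := fP n; have [_ _ _ gl gr] := gP n.
  have := dab n; have := d0 n => dn0 dnab.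
  move=> /negP; rewrite negb_and -!ltNge => /orP[xa|xb].
    rewrite /phi /f (fl x (ltW xa)).1 /g (gl x _).1 ?subr0//; lra.
  rewrite /phi /f (fr x _).1; last by lra.
  by rewrite /g (gr x _).1 ?subrr//; lra.
exists phi; split.
- move=> n; split.
  + by move=> x; exact: ex_derive.
  + have -> : derive1 (phi n) = (fun x => derive1 (f n) x - derive1 (g n) x).
      by apply/funext => x; rewrite derive1E; exact: derive_val.
    move=> x; apply: cvgB.
      by have [_ [cf _] _ _ _] := fP n; exact: cf.
    by have [_ [cf _] _ _ _] := gP n; exact: cf.
  + exists `[a + d n, b - d n]; split; first exact: segment_compact.
      move=> x /=; rewrite !in_itv/= => /andP[h1 h2]; have := d0 n; lra.
    by move=> x /=; rewrite in_itv/=; exact: phi0.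
- move=> n; exists (a + d n), (b - d n); split; [| | |exact: phi0].
  + by have := d0 n; lra.
  + by have := d0 n; have := dab n; lra.
  + by have := d0 n; lra.
- move=> n x.
  have [_ _ [_ f01] fl fr] := fP n; have [_ _ [_ g01] gl gr] := gP n.
  have := dab n; have := d0 n => dn0 dnab.
  have [xl|xl] := leP x (b - 2 * d n).
    by rewrite /phi /g (gl x xl).1 subr0; exact: f01.
  have f1 : sval (stepL n) x = 1 by apply: (fr x _).1; lra.
  by rewrite /phi /f f1; have := g01 x; rewrite -/(g n x) => /andP[? ?]; lra.
- move=> x; rewrite indicE; have [/=|/=] := boolP (x \in _).
    rewrite inE/= in_itv/= => /andP[ax xb]; apply: cvg_near_cst.
    have e0 : 0 < Num.min (x - a) (b - x) / (b - a).
      by rewrite divr_gt0 ?subr_gt0// lt_min !subr_gt0 ax.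
    near=> n.
    have : n.+1%:R^-1 < Num.min (x - a) (b - x) / (b - a).
      by near: n; exact: (near_infty_natSinv_lt (PosNum e0)).
    have dE : n.+1%:R^-1 * (b - a) = 5 * d n by rewrite /d; field; rewrite addrC.
    rewrite ltr_pdivlMr ?subr_gt0// lt_min dE => /andP[h1 h2].
    have [_ _ _ fl fr] := fP n; have [_ _ _ gl gr] := gP n.
    have dn0 := d0 n.
    rewrite /phi /f (fr x _).1; last by lra.
    by rewrite /g (gl x _).1 ?subr0//; lra.
  rewrite notin_setE/= in_itv/= => nx; apply: cvg_near_cst; near=> n.
  apply: phi0 => /andP[h1 h2]; apply: nx; have := d0 n; lra.
Unshelve. all: by end_near. Qed.

End test_functions.

(** * Charges tested against functions *)

Section charges_and_test_functions.
Context {R : realType}.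
Local Notation leb := (@lebesgue_measure R).
Local Notation charges := (charge (measurableTypeR R) R).
Local Notation fmeasure := {finite_measure set (measurableTypeR R) -> \bar R}.
Implicit Types (nu : charges) (m : fmeasure) (X A : set (measurableTypeR R)).

Lemma charge_int_cvg nu X (f_ : nat -> R -> R) (f : R -> R) (M : R) :
  measurable X -> (forall n, measurable_fun X (f_ n)) -> measurable_fun X f ->
  (forall x, X x -> f_ ^~ x @ \oo --> f x) ->
  (forall n x, X x -> `|f_ n x| <= M) ->
  (fun n => charge_int nu X (f_ n)) @ \oo --> charge_int nu X f.
Proof.
move=> mX mf_ mf f_f f_M.
have key m : (fun n => \int[m]_(x in X) f_ n x) @ \oo --> \int[m]_(x in X) f x.
  have [] := @Rintegral_dominated_cvg _ _ _ m f_ f (cst M) X mX mf_ mf => //.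
  - exact: aeW.
  - exact: finite_measure_integrable_cst.
by apply: cvgB; exact: key.
Qed.

Lemma charge_int_indic nu X A : measurable X -> measurable A ->
  charge_int nu X (\1_A : R -> R) = fine (nu (A `&` X)).
Proof.
move=> mX mA; rewrite /charge_int /Rintegral !integral_indic//.
rewrite charge_jordanE; last exact: measurableI.
by rewrite fineB ?fin_num_measure//; exact: measurableI.
Qed.

Lemma charge_int_ext nu X (f g : R -> R) :
  (forall x, X x -> f x = g x) -> charge_int nu X f = charge_int nu X g.
Proof.
by move=> fg; rewrite /charge_int; congr (_ - _);
  apply: eq_Rintegral => x; rewrite inE => /fg.
Qed.

(** A half-open interval is the decreasing limit of open ones. *)
Lemma charge_ge0_of_open nu X : measurable X ->
  (forall a b : R, a < b -> 0 <= fine (nu (`]a, b[ `&` X))) ->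
  forall A, measurable A -> A `<=` X -> (0 <= nu A)%E.
Proof.
move=> mX nu0 A mA AX.
have crE B : measurable B -> (crestr0 nu mX : charges) B = nu (B `&` X).
  by move=> mB; rewrite /= /crestr0 mem_set.
suff : forall B, measurable B -> (0 <= (crestr0 nu mX : charges) B)%E.
  by move=> /(_ A mA); rewrite crE// (setIidl AX).
apply: charge_ge0_of_ocitv => a b.
have mi (i : interval R) : measurable ([set` i] : set (measurableTypeR R)).
  exact: measurable_itv.
rewrite crE//; have mab : measurable (`]a, b] `&` X) by exact: measurableI.
have [ab|ba] := ltP a b; last first.
  by rewrite set_itv_ge ?set0I ?charge0// -leNgt bnd_simp.
rewrite -(fineK (fin_num_measure nu _ mab)) lee_fin -charge_int_indic//.
have cv : (fun n => charge_int nu X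
    (\1_(`]a, (b + n.+1%:R^-1)[ : set (measurableTypeR R)) : R -> R)) @ \oo -->
    charge_int nu X (\1_(`]a, b] : set (measurableTypeR R)) : R -> R).
  apply: (@charge_int_cvg _ _ _ _ 1) => //.
  - move=> x Xx; apply: cvg_near_cst; rewrite indicE.
    have [xab|xab] := boolP (x \in (`]a, b] : set R)).
      move: (xab); rewrite inE/= in_itv/= => /andP[ax xb].
      near=> n; rewrite indicE mem_set//= in_itv/= ax/=.
      by rewrite (le_lt_trans xb)// ltrDl.
    have [ax|ax] := leP x a.
      near=> n; rewrite indicE memNset//= in_itv/=.
      by rewrite ltNge ax.
    have xb : 0 < x - b.
      rewrite subr_gt0 ltNge; apply: contra xab => xb.
      by rewrite inE/= in_itv/= ax.
    near=> n; rewrite indicE memNset//= in_itv/= ax/=; apply/negP.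
    rewrite -leNgt -lerBrDl; apply/ltW; near: n.
    exact: (near_infty_natSinv_lt (PosNum xb)).
  - by move=> n x Xx; rewrite indicE; case: (_ \in _); rewrite ?normr0 ?normr1.
apply: (cvgn_ge cv) => n; rewrite charge_int_indic//.
by apply: nu0; rewrite (lt_trans ab)// ltrDl.
Unshelve. all: by end_near. Qed.

(** A charge on a segment is determined by its action on continuous functions;
    the bumps approximating an interval see the endpoints of the segment as well,
    where the plastic strain may concentrate. *)
Lemma charge_ge0_of_continuous nu (a b : R) :
  (forall phi : R -> R, continuous phi -> (forall x, 0 <= phi x) ->
    0 <= charge_int nu `[a, b] phi) ->
  forall A, measurable A -> A `<=` `[a, b] -> (0 <= nu A)%E.
Proof.
move=> nu0; apply: charge_ge0_of_open; first exact: measurable_itv.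
move=> c d cd.
have mi (i : interval R) : measurable ([set` i] : set (measurableTypeR R)).
  exact: measurable_itv.
have [phi [tphi _ phi01 phic]] := bump_seq cd.
have cphi n := test_fun_continuous (tphi n).
rewrite -charge_int_indic//.
apply: (@cvgn_ge _ (fun n => charge_int nu `[a, b] (phi n))).
  apply: (@charge_int_cvg _ _ _ _ 1) => //.
  - by move=> n; apply: measurable_funTS; exact: continuous_measurable_fun.
  - by move=> n x _; have /andP[p0 p1] := phi01 n x; rewrite ger0_norm.
move=> n; apply: nu0; first exact: cphi.
by move=> x; have /andP[] := phi01 n x.
Qed.

End charges_and_test_functions.

(** * Differences of charges and total variation *)

Section finite_measure_sum.
Context {R : realType}.
Local Notation fmeasure := {finite_measure set (measurableTypeR R) -> \bar R}.
Variables m1 m2 : fmeasure.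

Definition fmeasure_add : set (measurableTypeR R) -> \bar R := measure_add m1 m2.

HB.instance Definition _ := Measure.on fmeasure_add.

Let fmeasure_add_fin : fin_num_fun fmeasure_add.
Proof.
move=> A mA; rewrite (_ : fmeasure_add A = (m1 A + m2 A)%E); last first.
  exact: measure_addE.
by rewrite fin_numD !fin_num_measure.
Qed.

HB.instance Definition _ := @Measure_isFinite.Build _ _ _ fmeasure_add
  fmeasure_add_fin.

End finite_measure_sum.

Section charge_comparison.
Context {R : realType}.
Local Notation leb := (@lebesgue_measure R).
Local Notation charges := (charge (measurableTypeR R) R).
Local Notation fmeasure := {finite_measure set (measurableTypeR R) -> \bar R}.
Implicit Types (nu : charges) (m : fmeasure) (X A : set (measurableTypeR R)).

Lemma Rintegral_fmeasure_add (m1 m2 : fmeasure) X (f : R -> R) :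
  measurable X -> measurable_fun X f -> (exists M, forall x, X x -> `|f x| <= M) ->
  \int[fmeasure_add m1 m2]_(x in X) f x =
  \int[m1]_(x in X) f x + \int[m2]_(x in X) f x.
Proof.
move=> mX mf [M fM].
have intf m : m.-integrable X (EFin \o f).
  apply: (@le_integrableR _ _ _ _ _ (cst M)) => //.
  exact: finite_measure_integrable_cst.
rewrite /Rintegral -fineD; try by apply: integrable_fin_num => //; exact: intf.
by congr fine; apply: integral_measure_add => //; exact: intf.
Qed.

(** The Jordan parts of a difference are not the differences of the Jordan parts;
    the independence of the decomposition in [charge_intE] is what makes the
    integral additive. *)
Lemma charge_intB nu1 nu2 X (f : R -> R) :
  measurable X -> measurable_fun X f -> (exists M, forall x, X x -> `|f x| <= M) ->
  charge_int (cadd nu1 (copp nu2)) X f = charge_int nu1 X f - charge_int nu2 X f.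
Proof.
move=> mX mf bf.
rewrite (@charge_intE _ _ (fmeasure_add (jordan_pos (hahn nu1)) (jordan_neg (hahn nu2)))
  (fmeasure_add (jordan_neg (hahn nu1)) (jordan_pos (hahn nu2))))//; last first.
  move=> A mA _; apply: (@etrans _ _ (nu1 A - nu2 A)%E) => //.
  rewrite (charge_jordanE nu1 mA) (charge_jordanE nu2 mA).
  have key (x y z t : \bar R) : x \is a fin_num -> y \is a fin_num ->
    z \is a fin_num -> t \is a fin_num ->
    (x - y - (z - t) = x + t - (y + z))%E.
    case: x y z t => [x||] [y||] [z||] [t||]//= _ _ _ _.
    by congr EFin; ring.
  apply: etrans; first by apply: key; exact: fin_num_measure.
  by congr (_ - _)%E; apply/esym; exact: measure_addE.
by rewrite !Rintegral_fmeasure_add// /charge_int; ring.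
Qed.

Lemma test_fun_measurable_bounded (I : set R) (phi : R -> R) X : test_fun I phi ->
  measurable_fun X phi /\ exists M, forall x, X x -> `|phi x| <= M.
Proof.
move=> tphi; split.
  apply: measurable_funTS; apply: continuous_measurable_fun.
  exact: test_fun_continuous tphi.
by have [M h] := test_fun_bounded tphi; exists M => x _; have [] := h x.
Qed.

Lemma total_var_ge nu X : measurable X -> (`|nu X| <= total_var nu X)%E.
Proof. exact: abse_charge_variation. Qed.

(** On a set where the charge is nonnegative, the negative part of its Hahn
    decomposition is null. *)
Lemma total_var_of_ge0 nu X : measurable X ->
  (forall A, measurable A -> A `<=` X -> (0 <= nu A)%E) -> total_var nu X = nu X.
Proof.
move=> mX nu0; have [[mP P0] [mN N0] PN PN0] := hahn nu.
rewrite /total_var /charge_variation jordan_posE jordan_negE.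
rewrite cjordan_posE cjordan_negE /crestr0 mem_set// /crestr.
rewrite [in RHS](charge_partition nu mX mP mN PN PN0); congr (_ + _)%E.
suff -> : nu (X `&` (sval (cid (hahn_exists nu))).2) = 0%E by rewrite oppe0.
apply/eqP; rewrite eq_le N0/=; [|exact: measurableI|exact: subIsetr].
by apply: nu0; [exact: measurableI|exact: subIsetl].
Qed.

Lemma total_var_of_le0 nu X : measurable X ->
  (forall A, measurable A -> A `<=` X -> (nu A <= 0)%E) ->
  total_var nu X = (- nu X)%E.
Proof.
move=> mX nu0; have [[mP P0] [mN N0] PN PN0] := hahn nu.
rewrite /total_var /charge_variation jordan_posE jordan_negE.
rewrite cjordan_posE cjordan_negE /crestr0 mem_set// /crestr.
rewrite [in RHS](charge_partition nu mX mP mN PN PN0).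
suff -> : nu (X `&` (sval (cid (hahn_exists nu))).1) = 0%E by rewrite !add0e.
apply/eqP; rewrite eq_le P0 ?andbT/=; [|exact: measurableI|exact: subIsetr].
by apply: nu0; [exact: measurableI|exact: subIsetl].
Qed.

End charge_comparison.

(** * Absolutely continuous functions of time *)

Section absolutely_continuous_functions.
Context {R : realType}.
Local Notation leb := (@lebesgue_measure R).
Variables (T : R) (f : R -> R).
Hypothesis T0 : 0 <= T.
Hypothesis fAC : abs_continuous T real_dist f.

(** The intervals that are not selected by [P] are collapsed to points. *)
Lemma AC_small (eta : R) : 0 < eta -> exists2 delta : R, 0 < delta &
  forall n (P : pred nat) (x : nat -> R),
   {homo x : i j / (i <= j)%N >-> i <= j} -> (forall i, 0 <= x i <= T) ->
   \sum_(k < n | P k) (x k.+1 - x k) < delta ->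
   \sum_(k < n | P k) `|f (x k.+1) - f (x k)| < eta.
Proof.
move=> /fAC[delta d0 H]; exists delta => // n P x xnd x0T xd.
pose b (k : nat) := if P k then x k.+1 else x k.
have sumE (F : nat -> R -> R) : (forall k, F k (x k) = 0) ->
    \sum_(k < n) F k (b k) = \sum_(k < n | P k) F k (x k.+1).
  move=> F0; rewrite [RHS]big_mkcond/=; apply: eq_bigr => k _.
  by rewrite /b; case: (P k).
have := H n x b; rewrite /real_dist sumEFin lte_fin.
rewrite (sumE (fun k y => y - x k)); last by move=> k; rewrite subrr.
rewrite (sumE (fun k y => `|f (x k) - f y|)); last by move=> k; rewrite subrr normr0.
under [X in _ -> _ -> _ -> X < _]eq_bigr do rewrite distrC.
apply => //.
- move=> i _; have /andP[xi0 xiT] := x0T i; have /andP[_ xiT'] := x0T i.+1.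
  by rewrite /b; case: ifP => _; split => //; exact: xnd.
- have bx i : b i <= x i.+1 by rewrite /b; case: ifP => // _; exact: xnd.
  move=> i j _ _; rewrite neq_ltn => /orP[ij|ji]; [left|right].
    exact: le_trans (bx i) (xnd _ _ ij).
  exact: le_trans (bx j) (xnd _ _ ji).
Qed.

(** A subdivision refined by a uniform mesh splits into cells of length below the
    threshold of absolute continuity, in each of which the variation is at most
    one. *)
Lemma AC_bounded_variation : exists2 C : R, 0 < C &
  forall n (x : nat -> R),
   {homo x : i j / (i <= j)%N >-> i <= j} -> (forall i, 0 <= x i <= T) ->
   \sum_(k < n) `|f (x k.+1) - f (x k)| <= C.
Proof.
have [delta d0 H] := AC_small (@ltr01 R).
pose K := (Num.bound (T / delta)).+1.
have K0 : 0 < K%:R :> R by rewrite ltr0n.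
have TK : T / K%:R < delta.
  rewrite ltr_pdivrMr// -ltr_pdivrMl// mulrC.
  apply: lt_le_trans (archi_boundP _) _; first by rewrite divr_ge0// ltW.
  by rewrite ler_nat.
exists K%:R => // n x xnd x0T.
pose w (j : nat) : R := j%:R * (T / K%:R).
have w0T j : (j <= K)%N -> 0 <= w j <= T.
  move=> jK; rewrite /w mulr_ge0 ?divr_ge0//=.
  by rewrite mulrA ler_pdivrMr// mulrC ler_wpM2l// ler_nat.
have wS j : w j <= w j.+1.
  by rewrite /w ler_wpM2r// ?divr_ge0// ler_nat.
(* Projection onto the cell number j of the mesh. *)
pose cl (j : nat) (y : R) := Num.max (w j) (Num.min y (w j.+1)).
have tele m y : (m <= K)%N -> 0 <= y ->
    \sum_(j < m) (f (cl j y) - f (w j)) = f (Num.min y (w m)) - f 0.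
  elim: m => [|m IH] mK y0.
    by rewrite big_ord0 /w mul0r (min_idPr _)// subrr.
  rewrite big_ord_recr/= IH//; last exact: ltnW.
  rewrite /cl; have [yw|yw] := leP y (w m).
    have yw' := le_trans yw (wS m).
    by rewrite (min_idPl yw') (max_idPl yw) subrr addr0.
  rewrite (max_idPr _); first by ring.
  by rewrite le_min (ltW yw) wS.
have wK : w K = T by rewrite /w mulrC divfK// gt_eqF.
have dec y z : 0 <= y <= T -> 0 <= z <= T ->
    `|f y - f z| <= \sum_(j < K) `|f (cl j y) - f (cl j z)|.
  move=> /andP[y0 yT] /andP[z0 zT].
  have -> : f y - f z = \sum_(j < K) (f (cl j y) - f (cl j z)).
    transitivity ((\sum_(j < K) (f (cl j y) - f (w j))) -
                  (\sum_(j < K) (f (cl j z) - f (w j)))).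
      by rewrite !tele// wK (min_idPl yT) (min_idPl zT); ring.
    by rewrite -sumrB; apply: eq_bigr => j _; ring.
  exact: ler_norm_sum.
apply: (@le_trans _ _ (\sum_(k < n) \sum_(j < K) `|f (cl j (x k.+1)) - f (cl j (x k))|)).
  by apply: ler_sum => k _; exact: dec.
rewrite exchange_big/= -[leRHS]mulr1 mulr_natl -[in leRHS](card_ord K) -sumr_const.
apply: ler_sum => j _.
have clnd : {homo cl j : y z / y <= z}.
  move=> y z yz; rewrite /cl ge_max le_max lexx/= le_max.
  by apply/orP; right; rewrite le_min !ge_min yz lexx orbT.
have clw y : w j <= cl j y <= w j.+1.
  by rewrite /cl le_max lexx/= ge_max wS ge_min lexx orbT.
apply/ltW; apply: (H n xpredT (fun k => cl j (x k))).
- by move=> i k ik; apply: clnd; exact: xnd.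
- move=> i; have /andP[h1 h2] := clw (x i).
  have /andP[h3 _] := w0T j (ltnW (ltn_ord j)).
  have /andP[_ h4] := w0T j.+1 (ltn_ord j).
  by rewrite (le_trans h3)// (le_trans h2).
- rewrite -(big_mkord xpredT (fun k => cl j (x k.+1) - cl j (x k))).
  rewrite telescope_sumr//; apply: le_lt_trans TK.
  have /andP[_ h1] := clw (x n); have /andP[h2 _] := clw (x 0%N).
  have : w j.+1 - w j = T / K%:R by rewrite /w -natr1; ring.
  by lra.
Qed.

End absolutely_continuous_functions.

Section step_functions.
Context {R : realType}.
Local Notation leb := (@lebesgue_measure R).
Variables (x : nat -> R) (c : nat -> R) (n : nat).
Hypothesis xnd : {homo x : i j / (i <= j)%N >-> i <= j}.

Definition stepf (r : R) : R := \sum_(k < n) c k * \1_(`]x k, x k.+1] : set R) r.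

Lemma stepf_cell (k : nat) (r : R) : (k < n)%N -> x k < r <= x k.+1 -> stepf r = c k.
Proof.
move=> kn xkr; rewrite /stepf (bigD1 (Ordinal kn))//= indicE mem_set/=; last first.
  by rewrite in_itv.
rewrite mulr1 big1 ?addr0// => j jk; rewrite indicE memNset ?mulr0//= in_itv/=.
move: xkr => /andP[xk kx] /andP[xj jx].
have : (j : nat) != k by apply: contraNneq jk => e; apply/eqP/val_inj.
rewrite neq_ltn => /orP[jk'|kj].
  by move: (le_lt_trans jx (le_lt_trans (xnd jk') xk)); rewrite ltxx.
by move: (le_lt_trans kx (le_lt_trans (xnd kj) xj)); rewrite ltxx.
Qed.

Lemma stepf_out (r : R) : ~ (x 0%N < r <= x n) -> stepf r = 0.
Proof.
move=> h; rewrite /stepf big1// => k _; rewrite indicE memNset ?mulr0//= in_itv/=.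
move=> /andP[h1 h2]; apply: h; rewrite (le_lt_trans _ h1) ?xnd//=.
by rewrite (le_trans h2)// xnd.
Qed.

Lemma cell_exists (r : R) : x 0%N < r <= x n ->
  exists2 k, (k < n)%N & x k < r <= x k.+1.
Proof.
move=> /andP[r0]; elim: n => [|m IH] rn.
  by move: (lt_le_trans r0 rn); rewrite ltxx.
have [rm|mr] := leP r (x m).
  by have [k km h] := IH rm; exists k => //; exact: ltnW.
by exists m => //; rewrite mr.
Qed.

Let intk (D : set R) k : measurable D ->
  leb.-integrable D (EFin \o (\1_(`]x k, x k.+1] : set R) : R -> R)).
Proof.
move=> mD; apply: (@integrableS _ _ _ leb setT) => //.
exact: integrable_indic_itv.
Qed.

Lemma measurable_stepf (D : set R) : measurable_fun D stepf.
Proof.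
rewrite /stepf; apply: measurable_funTS; apply: measurable_sum => k.
by apply: measurable_funM.
Qed.

Lemma integrable_stepf (D : set R) : measurable D ->
  leb.-integrable D (EFin \o stepf) /\
  \int[leb]_(r in D) stepf r =
  \sum_(k < n) c k * \int[leb]_(r in D) (\1_(`]x k, x k.+1] : set R) r : R).
Proof.
move=> mD; rewrite /stepf; elim: n => [|m [IH1 IH2]].
  split.
    under [X in EFin \o X]eq_fun do rewrite big_ord0.
    exact: integrable0.
  by under eq_Rintegral do rewrite big_ord0; rewrite Rintegral_cst// mul0r big_ord0.
have im : leb.-integrable D (EFin \o (fun r => c m * \1_(`]x m, x m.+1] : set R) r)).
  by apply: integrableZ_EFin => //; exact: intk.
split.
  under [X in EFin \o X]eq_fun do rewrite big_ord_recr/=.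
  exact: integrableD_EFin.
under eq_Rintegral do rewrite big_ord_recr/=.
rewrite RintegralD// IH2 big_ord_recr/= RintegralZl//.
exact: intk.
Qed.

Lemma Rintegral_stepf :
  \int[leb]_(r in `[x 0%N, x n]) stepf r = \sum_(k < n) c k * (x k.+1 - x k).
Proof.
rewrite (integrable_stepf _).2//; apply: eq_bigr => k _; congr (_ * _).
rewrite /Rintegral integral_indic// setIidl.
  transitivity (fine (leb (`]x k, x k.+1] : set R))) => //.
  rewrite lebesgue_measure_itv/= lte_fin.
  have := xnd (leqnSn k); rewrite le_eqVlt => /orP[/eqP ->|->//].
  by rewrite ltxx subrr.
move=> r /=; rewrite !in_itv/= => /andP[h1 h2].
by rewrite (le_trans _ (ltW h1)) ?xnd//= (le_trans h2)// xnd.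
Qed.

End step_functions.

Section truncation.
Context {R : realType}.

(** Truncation at level [M], used to turn difference quotients into a bounded
    sequence to which dominated convergence applies. *)
Definition clip (M y : R) : R := Num.max (- M) (Num.min y M).

Lemma clip_id M y : `|y| <= M -> clip M y = y.
Proof.
rewrite ler_norml => /andP[h1 h2].
by rewrite /clip (min_idPl h2) (max_idPr h1).
Qed.

Lemma clip_bound M y : 0 <= M -> `|clip M y| <= M.
Proof.
move=> M0; rewrite ler_norml /clip le_max lexx/= ge_max ge_min lexx orbT andbT.
by lra.
Qed.

Lemma clip_dist M y : 0 <= M -> `|y - clip M y| <= if M < `|y| then `|y| else 0.
Proof.
move=> M0; case: ltP => h; last by rewrite clip_id// subrr normr0.
rewrite /clip; have [yM|My] := leP y M; have [y0|y0] := leP 0 y.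
- by move: h; rewrite ger0_norm// ltNge yM.
- move: h; rewrite (ltr0_norm y0) => h.
  by rewrite (max_idPl _) ?ler0_norm; lra.
- move: h; rewrite (ger0_norm y0) => h.
  by rewrite (max_idPr _) ?ger0_norm; lra.
- by lra.
Qed.

Lemma clip_nd M : {homo clip M : y z / y <= z}.
Proof.
move=> y z yz; rewrite /clip ge_max le_max lexx/= le_max; apply/orP; right.
by rewrite le_min !ge_min yz lexx orbT.
Qed.

Lemma clip_lip M y z : `|clip M y - clip M z| <= `|y - z|.
Proof.
wlog yz : y z / z <= y.
  by move=> H; have [?|/ltW ?] := leP z y; [exact: H|rewrite distrC (distrC y) H].
rewrite !ger0_norm ?subr_ge0// ?clip_nd//; rewrite /clip.
by case: (leP y M) => ?; case: (leP z M) => ?; case: (leP (- M) y) => ?;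
  case: (leP (- M) z) => ?; case: (leP (- M) M) => ?; lra.
Qed.

Lemma continuous_clip M : continuous (clip M).
Proof.
move=> y; apply/cvgrPdist_lt => e e0; near=> z.
apply: le_lt_trans (clip_lip _ _ _) _.
by near: z; apply/nbhs_ballP; exists e.
Unshelve. all: by end_near. Qed.

Lemma measurable_clip M (D : set R) (f : R -> R) :
  measurable_fun D f -> measurable_fun D (fun r => clip M (f r)).
Proof.
move=> mf; have mc : measurable_fun setT (clip M).
  by apply: continuous_measurable_fun; exact: continuous_clip.
exact: (measurableT_comp mc mf).
Qed.

End truncation.

(** A function fixing zero acts on a step function through its values; used for
    the norm and for truncations. *)
Lemma stepf_map {R : realType} (x c : nat -> R) n (phi : R -> R) r :
  {homo x : i j / (i <= j)%N >-> i <= j} -> phi 0 = 0 ->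
  phi (stepf x c n r) = stepf x (phi \o c) n r.
Proof.
move=> xnd phi0; have [h|h] := pselect (x 0%N < r <= x n).
  have [k kn hk] := cell_exists h.
  by rewrite !(stepf_cell _ xnd kn hk).
by rewrite !stepf_out.
Qed.

Section fundamental_theorem.
Context {R : realType}.
Local Notation leb := (@lebesgue_measure R).
Variables (T : R) (f g : R -> R).
Hypothesis T0 : 0 < T.
Hypothesis fAC : abs_continuous T real_dist f.
Hypothesis fg : {ae leb, forall t, 0 < t < T ->
  (fun h : R => h^-1 * (f (t + h) - f t)) @ 0^' --> g t}.

Let grid (s t : R) (n k : nat) : R := Num.min t (s + k%:R * ((t - s) / n.+1%:R)).

Let slope (s t : R) (n k : nat) : R :=
  (f (grid s t n k.+1) - f (grid s t n k)) / (grid s t n k.+1 - grid s t n k).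

Let D (s t : R) (n : nat) : R -> R := stepf (grid s t n) (slope s t n) n.+1.

Section one_interval.
Variables s t : R.
Hypothesis (s0 : 0 <= s) (st : s < t) (tT : t <= T).

Let h0 n : 0 < (t - s) / n.+1%:R.
Proof. by rewrite divr_gt0 ?subr_gt0// ltr0n. Qed.

Let grid_nd n : {homo grid s t n : i j / (i <= j)%N >-> i <= j}.
Proof.
move=> i j ij; rewrite /grid le_min ge_min lexx/= ge_min; apply/orP; right.
by rewrite lerD2l; apply: ler_wpM2r; [exact: ltW|rewrite ler_nat].
Qed.

Let grid_in n k : 0 <= grid s t n k <= T.
Proof.
rewrite /grid le_min ge_min tT/= andbT (le_trans s0 (ltW st))/=.
by rewrite addr_ge0// mulr_ge0// ltW.
Qed.

Let grid0 n : grid s t n 0 = s.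
Proof. by rewrite /grid mul0r addr0 (min_idPr (ltW st)). Qed.

Let gridE n k : (k <= n.+1)%N -> grid s t n k = s + k%:R * ((t - s) / n.+1%:R).
Proof.
move=> kn; rewrite /grid (min_idPr _)//.
rewrite -lerBrDl mulrA ler_pdivrMr ?ltr0n// mulrC; apply: ler_wpM2l.
  by rewrite subr_ge0 ltW.
by rewrite ler_nat.
Qed.

Let gridN n : grid s t n n.+1 = t.
Proof. by rewrite gridE// mulrC divfK ?pnatr_eq0//; ring. Qed.

Let gridS n k : (k < n.+1)%N ->
  grid s t n k.+1 - grid s t n k = (t - s) / n.+1%:R.
Proof. by move=> kn; rewrite !gridE// ?(ltnW kn)// -natr1; ring. Qed.

(** The quotient over a cell containing [r] is a convex combination of the
    quotients over its two halves at [r]. *)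
Lemma D_cvg (r L : R) : s < r < t ->
  (fun h : R => h^-1 * (f (r + h) - f r)) @ 0^' --> L -> D s t ^~ r @ \oo --> L.
Proof.
move=> /andP[sr rt] fL; apply/cvgrPdist_le => e e0.
have /cvgrPdist_le /(_ e e0) := fL.
move=> [d /= d0 Hd].
have lin y : `|y - r| < d -> `|f y - f r - L * (y - r)| <= e * `|y - r|.
  have [->|yr] := eqVneq y r; first by rewrite !subrr mulr0 subrr !normr0 mulr0.
  move=> yd; have yr0 : y - r != 0 by rewrite subr_eq0.
  have := Hd (y - r); rewrite /ball_/= sub0r normrN => /(_ yd yr0).
  rewrite subrKC => hh.
  have -> : f y - f r - L * (y - r) = - ((L - (y - r)^-1 * (f y - f r)) * (y - r)).
    by field.
  by rewrite normrN normrM ler_wpM2r.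
near=> n.
have hd : (t - s) / n.+1%:R < d.
  rewrite -ltr_pdivlMl ?subr_gt0// mulrC; near: n.
  have dts : 0 < d / (t - s) by rewrite divr_gt0 ?subr_gt0.
  exact: (near_infty_natSinv_lt (PosNum dts)).
have [k kn /andP[kr rk]] : exists2 k, (k < n.+1)%N & grid s t n k < r <= grid s t n k.+1.
  by apply: cell_exists; rewrite grid0 gridN sr ltW.
rewrite /D (stepf_cell (slope s t n) (@grid_nd n) kn) ?kr//.
have hS := gridS kn; have hp := h0 n.
rewrite /slope; move: kr rk hS hp hd; set h := (t - s) / _.
set y := grid s t n k.+1; set z := grid s t n k => zr ry yz hp hd.
have l1 := lin y; have l2 := lin z.
rewrite yz -(@ler_pM2r _ h)// -[X in _ * X <= _](gtr0_norm hp) -normrM mulrBl divfK ?gt_eqF//.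
have : `|y - r| = y - r by rewrite ger0_norm// subr_ge0.
have : `|z - r| = r - z by rewrite ltr0_norm ?opprB// subr_lt0.
move=> zE yE; rewrite yE in l1; rewrite zE in l2.
have {}l1 := l1 (ltac:(lra)); have {}l2 := l2 (ltac:(lra)).
have -> : L * h - (f y - f z) = (f z - f r - L * (z - r)) - (f y - f r - L * (y - r)).
  by rewrite -yz; ring.
apply: le_trans (ler_normB _ _) _.
have -> : e * h = e * (r - z) + e * (y - r) by rewrite -yz; ring.
exact: lerD.
Unshelve. all: by end_near. Qed.

Let slopeM n k : (k < n.+1)%N ->
  slope s t n k * (grid s t n k.+1 - grid s t n k) =
  f (grid s t n k.+1) - f (grid s t n k).
Proof. by move=> kn; rewrite /slope divfK// gridS// gt_eqF. Qed.

Let slope_norm n k : (k < n.+1)%N ->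
  `|f (grid s t n k.+1) - f (grid s t n k)| =
  `|slope s t n k| * (grid s t n k.+1 - grid s t n k).
Proof.
move=> kn; rewrite -slopeM// (normrM (slope s t n k)); congr (_ * _).
by rewrite ger0_norm// subr_ge0 grid_nd.
Qed.

Let int_step n (c : nat -> R) :
  \int[leb]_(r in `[s, t]) stepf (grid s t n) c n.+1 r =
  \sum_(k < n.+1) c k * (grid s t n k.+1 - grid s t n k).
Proof.
have := @Rintegral_stepf _ (grid s t n) c n.+1 (@grid_nd n).
by rewrite grid0 gridN.
Qed.

Let mst : measurable (`[s, t] : set R). Proof. exact: measurable_itv. Qed.

Let int_cst (c : R) : leb.-integrable `[s, t] (EFin \o (fun=> c)).
Proof.
have := @continuous_compact_integrable _ (fun=> c) `[s, t].
apply; first exact: segment_compact.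
by apply: continuous_subspaceT => x; exact: cvg_cst.
Qed.

Let D_int n : \int[leb]_(r in `[s, t]) D s t n r = f t - f s.
Proof.
rewrite /D int_step; under eq_bigr do rewrite slopeM//.
rewrite -(big_mkord xpredT (fun k => f (grid s t n k.+1) - f (grid s t n k))).
by rewrite (telescope_sumr (fun k => f (grid s t n k)))// gridN grid0.
Qed.

Lemma D_L1 : exists C : R, forall n, \int[leb]_(r in `[s, t]) `|D s t n r| <= C.
Proof.
have [C C0 HC] := AC_bounded_variation (ltW T0) fAC; exists C => n.
under eq_Rintegral do rewrite /D (stepf_map _ _ _ (@grid_nd n) (normr0 _)).
rewrite int_step/=; apply: le_trans (HC n.+1 _ (@grid_nd n) (grid_in n)).
by apply: ler_sum => k _; rewrite slope_norm.
Qed.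

(** Uniform integrability of the difference quotients: by Chebyshev the cells of
    slope larger than [M] have total length at most [C / M], and by absolute
    continuity [f] varies little on them. *)
Let D_clip_error eta : 0 < eta -> exists2 M0 : R, 0 <= M0 &
  forall M n, M0 <= M ->
  `|(f t - f s) - \int[leb]_(r in `[s, t]) clip M (D s t n r)| <= eta.
Proof.
move=> /(AC_small fAC)[delta d0 Hd].
have [C C0 HC] := AC_bounded_variation (ltW T0) fAC.
(* Above this level the cells of large slope have total length at most delta / 2. *)
exists (2 * C / delta) => [|M n M0M]; first by rewrite divr_ge0 ?mulr_ge0 ?ltW.
have Mp : 0 < M.
  by apply: lt_le_trans M0M; rewrite divr_gt0 ?mulr_gt0.
pose P k := M < `|slope s t n k|.
pose c k := if P k then `|slope s t n k| else 0.
have iD : leb.-integrable `[s, t] (EFin \o D s t n).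
  exact: (integrable_stepf _ _ _ mst).1.
have iclip : leb.-integrable `[s, t] (EFin \o (fun r => clip M (D s t n r))).
  apply: (@le_integrableR _ _ _ _ _ (fun=> M)) => //.
    by apply: measurable_clip; exact: measurable_stepf.
  by move=> r _; apply: clip_bound; exact: ltW.
rewrite -(D_int n) -RintegralB//.
apply: (@le_trans _ _ (\int[leb]_(r in `[s, t]) stepf (grid s t n) c n.+1 r)).
  apply: Rintegral_bound => //.
  - exact: integrableB_EFin.
  - exact: (integrable_stepf _ _ _ mst).1.
  - move=> r _; apply: le_trans (clip_dist _ (ltW Mp)) _.
    pose phi (y : R) := if M < `|y| then `|y| else 0.
    have phi0 : phi 0 = 0 by rewrite /phi normr0; case: ifP.
    by rewrite -/(phi (D s t n r)) /D (stepf_map _ _ _ (@grid_nd n) phi0).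
rewrite int_step; apply: ltW.
have -> : \sum_(k < n.+1) c k * (grid s t n k.+1 - grid s t n k) =
    \sum_(k < n.+1 | P k) `|f (grid s t n k.+1) - f (grid s t n k)|.
  rewrite [RHS]big_mkcond/=; apply: eq_bigr => k _.
  rewrite /c; case: (P k); last by rewrite mul0r.
  by rewrite slope_norm.
apply: Hd; [exact: grid_nd|exact: grid_in|].
have : M * (\sum_(k < n.+1 | P k) (grid s t n k.+1 - grid s t n k)) <= C.
  apply: le_trans (HC n.+1 _ (@grid_nd n) (grid_in n)).
  rewrite mulr_sumr big_mkcond/=; apply: ler_sum => k _.
  case: ifPn => [Pk|_]; last exact: normr_ge0.
  rewrite slope_norm//.
  by apply: ler_wpM2r; [rewrite subr_ge0 grid_nd|exact: ltW].
set S := \sum_(k < _ | _) _ => MS.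
rewrite -(@ltr_pM2l _ M)//; apply: le_lt_trans MS _.
move: M0M; rewrite ler_pdivrMr// => M0M; lra.
Qed.

(** The step functions [D s t n] have integral [f t - f s] and converge to the
    derivative.  Their truncations converge by dominated convergence, and the
    error of truncation is small uniformly in [n]. *)
Lemma AC_FTC_interval (G : R -> R) : leb.-integrable `[s, t] (EFin \o G) ->
  {ae leb, forall r, s < r < t -> g r = G r} ->
  \int[leb]_(r in `[s, t]) G r = f t - f s.
Proof.
move=> iG gG.
have mG : measurable_fun `[s, t] G.
  by apply/measurable_EFinP; exact: measurable_int iG.
have conv : {ae leb, forall r, `[s, t]%classic r -> D s t ^~ r @ \oo --> G r}.
  have ae1 : {ae leb, forall r : R, r != s /\ r != t}.
    exists [set s; t]; split.
    - by apply: measurableU.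
    - by apply: countable_lebesgue_measure0; apply: finite_set_countable; exact: finite_set2.
    - by move=> r /= /not_andP[/negP|/negP]; rewrite negbK => /eqP ->; [left|right].
  apply: ae_imp3 ae1 gG fg => r [rs rt] gGr fgr /=; rewrite in_itv/= => /andP[sr tr].
  have srt : s < r < t.
    by rewrite lt_neqAle eq_sym rs sr lt_neqAle rt tr.
  rewrite -gGr//; apply: D_cvg => //; apply: fgr.
  case/andP : srt => h1 h2.
  by rewrite (le_lt_trans s0 h1) (lt_le_trans h2).
have cl M : 0 <= M -> leb.-integrable `[s, t] (EFin \o (fun r => clip M (G r))) /\
    (fun n => \int[leb]_(r in `[s, t]) clip M (D s t n r)) @ \oo -->
    \int[leb]_(r in `[s, t]) clip M (G r).
  move=> M0; apply: (@Rintegral_dominated_cvg _ _ _ leb _ _ (fun=> M)) => //.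
  - by move=> n; apply: measurable_clip; exact: measurable_stepf.
  - exact: measurable_clip.
  - apply: ae_imp conv => r + rst => /(_ rst) h.
    by apply: continuous_cvg => //; exact: continuous_clip.
  - by move=> n r _; exact: clip_bound.
have lim : (fun n : nat => \int[leb]_(r in `[s, t]) clip n%:R (G r)) @ \oo -->
    \int[leb]_(r in `[s, t]) G r.
  apply: (@Rintegral_dominated_cvg _ _ _ leb (fun n r => clip n%:R (G r)) G (fun r => `|G r|) `[s, t] mst _ mG _ _ _).2.
  - by move=> n; exact: measurable_clip.
  - apply: aeW => r _; apply: cvg_near_cst; near=> n; apply: clip_id.
    near: n; exact: nbhs_infty_ger.
  - exact: integrable_norm.
  - move=> n r _; have [h|h] := leP `|G r| n%:R; first by rewrite clip_id.
    by apply: le_trans (clip_bound _ _) (ltW h).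
apply/eqP; rewrite -subr_eq0 -normr_le0; apply/ler_addgt0Pl => eta eta0.
rewrite addr0 distrC.
have [M0 M00 HM] := D_clip_error eta0.
have lim' : (fun n : nat => `|f t - f s - \int[leb]_(r in `[s, t]) clip n%:R (G r)|)
    @ \oo --> `|f t - f s - \int[leb]_(r in `[s, t]) G r|.
  by apply: cvg_norm; apply: cvgB => //; exact: cvg_cst.
apply: (@ler_cvg_to nat \oo _ R _ (cst eta) _ _ lim'); first exact: cvg_cst.
near=> n; rewrite /=.
have nM : M0 <= n%:R by near: n; exact: nbhs_infty_ger.
have [_ c] := cl n%:R (ler0n _ _).
have c' : (fun k => `|f t - f s - \int[leb]_(r in `[s, t]) clip n%:R (D s t k r)|)
    @ \oo --> `|f t - f s - \int[leb]_(r in `[s, t]) clip n%:R (G r)|.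
  by apply: cvg_norm; apply: cvgB => //; exact: cvg_cst.
by apply: (cvgn_le c') => k; exact: HM.
Unshelve. all: by end_near. Qed.

End one_interval.
(** Fatou applied to the difference quotients, which are bounded in mean by the
    variation of [f].  The upper limit provides a measurable representative of
    the derivative, which is itself only given almost everywhere. *)
Lemma AC_derivative_integrable : exists G : R -> R,
  leb.-integrable `[0, T] (EFin \o G) /\
  {ae leb, forall r, 0 < r < T -> g r = G r}.
Proof.
pose G r := fine (limn_esup (fun n => (D 0 T n r)%:E)).
have mD n : measurable_fun `[0, T] (D 0 T n) by exact: measurable_stepf.
have mG : measurable_fun `[0, T] G.
  apply: measurableT_comp; first exact: fine_measurable.
  by apply: measurable_fun_limn_esup => n; exact/measurable_EFinP.
have conv : {ae leb, forall r, 0 < r < T -> D 0 T ^~ r @ \oo --> g r}.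
  apply: ae_imp fg => r h r0T; apply: D_cvg => //.
  exact: h.
have gG : {ae leb, forall r, 0 < r < T -> g r = G r}.
  apply: ae_imp conv => r h /h {}h; rewrite /G.
  have h' : (fun n => (D 0 T n r)%:E) @ \oo --> (g r)%:E by apply: cvg_EFin => //; exact: nearW.
  by rewrite (cvg_limn_einf_sup h').2.
exists G; split => //.
have [C HC] := D_L1 (lexx 0) T0 (lexx T).
have m0T : measurable (`[0, T] : set R) by exact: measurable_itv.
have ends : {ae leb, forall r : R, r != 0 /\ r != T}.
  exists [set 0; T]; split.
  - by apply: measurableU.
  - by apply: countable_lebesgue_measure0; apply: finite_set_countable; exact: finite_set2.
  - by move=> r /= /not_andP[/negP|/negP]; rewrite negbK => /eqP ->; [left|right].
apply/integrableP; split; first exact/measurable_EFinP.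
rewrite (@integral_ae_congr _ _ _ leb _ (fun r => limn_einf (fun n => `|D 0 T n r|%:E))); last first.
  apply: ae_imp3 ends conv gG => r [r0 rT] cv gGr /=; rewrite in_itv/= => /andP[h1 h2].
  have r0T : 0 < r < T by rewrite lt_neqAle eq_sym r0 h1 lt_neqAle rT h2.
  have {}cv := cv r0T; rewrite -gGr//.
  have h' : (fun n => `|D 0 T n r|%:E) @ \oo --> `|g r|%:E.
    by apply: cvg_EFin; [exact: nearW|exact: cvg_norm].
  by rewrite (cvg_limn_einf_sup h').1.
apply: (@le_lt_trans _ _ C%:E); last exact: ltry.
apply: le_trans (fatou leb m0T _ _) _.
- by move=> n; apply/measurable_EFinP; do 1 apply: measurableT_comp => //; exact: mD.
- by move=> n r _; rewrite lee_fin.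
rewrite limn_einf_lim; apply: lime_le; first exact: is_cvg_einfs.
apply: nearW => n; apply: (@le_trans _ _ (\int[leb]_(r in `[0%R, T]) `|D 0 T n r|%:E)%E).
  by apply: ereal_inf_lbound; exists n => /=.
have iD : leb.-integrable `[0, T] (EFin \o (fun r => `|D 0 T n r|)).
  by apply: integrable_norm; exact: (integrable_stepf _ _ _ m0T).1.
have := HC n; rewrite -lee_fin /Rintegral fineK//.
by apply: integrable_fin_num => //; exact: iD.
Qed.

(** The fundamental theorem of calculus for an absolutely continuous function
    that is differentiable almost everywhere. *)
Theorem AC_FTC : exists G : R -> R,
  [/\ leb.-integrable `[0, T] (EFin \o G),
      {ae leb, forall r, 0 < r < T -> g r = G r} &
      forall s t, 0 <= s -> s <= t -> t <= T ->
        \int[leb]_(r in `[s, t]) G r = f t - f s].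
Proof.
have [G [iG gG]] := AC_derivative_integrable.
exists G; split => // s t s0; rewrite le_eqVlt => /predU1P[-> _|st tT].
  by rewrite set_itv1 Rintegral_set1 subrr.
apply: AC_FTC_interval => //.
  apply: (integrableS _ _ _ iG) => // r /=; rewrite !in_itv/= => /andP[h1 h2].
  by rewrite (le_trans s0)// (le_trans h2).
apply: ae_imp gG => r h /andP[h1 h2]; apply: h.
by rewrite (le_lt_trans s0 h1) (lt_le_trans h2).
Qed.

End fundamental_theorem.

(** * Square integrable functions and weak derivatives *)

Section square_integrable.
Context {R : realType}.
Local Notation leb := (@lebesgue_measure R).
Implicit Types (D : set R) (f g u v : R -> R).

Lemma le_integrable_leb D g f : measurable D -> measurable_fun D f ->
  (forall x, D x -> `|f x| <= g x) -> leb.-integrable D (EFin \o g) ->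
  leb.-integrable D (EFin \o f).
Proof.
by move=> mD mf fg ig; exact: (@le_integrableR _ _ R leb f g D mD mf fg ig).
Qed.

Lemma L2_mul D u v : measurable D -> L2 D u -> L2 D v ->
  leb.-integrable D (EFin \o (fun x => u x * v x)).
Proof.
move=> mD [mu iu] [mv iv].
apply: (@le_integrable_leb _ (fun x => u x ^+ 2 + v x ^+ 2)) => //.
- exact: measurable_funM.
- move=> x _; rewrite normrM -(real_normK (num_real (u x))) -(real_normK (num_real (v x))).
  by have := sqr_ge0 (`|u x| - `|v x|); have := normr_ge0 (u x); have := normr_ge0 (v x); nra.
- exact: integrableD_EFin.
Qed.

Lemma L2D D u v : measurable D -> L2 D u -> L2 D v -> L2 D (fun x => u x + v x).
Proof.
move=> mD Lu Lv; have [mu iu] := Lu; have [mv iv] := Lv.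
split; first exact: measurable_funD.
apply: (@le_integrable_leb _ (fun x => 2 * (u x ^+ 2 + v x ^+ 2))) => //.
- by apply: measurable_funX; exact: measurable_funD.
- move=> x _; rewrite ger0_norm ?sqr_ge0//.
  by have := sqr_ge0 (u x - v x); nra.
- by apply: integrableZ_EFin => //; exact: integrableD_EFin.
Qed.

Lemma L2Z D (c : R) u : measurable D -> L2 D u -> L2 D (fun x => c * u x).
Proof.
move=> mD [mu iu]; split; first exact: measurable_funM.
have -> : (fun x => (c * u x) ^+ 2) = (fun x => c ^+ 2 * u x ^+ 2).
  by apply/funext => x; rewrite exprMn.
exact: integrableZ_EFin.
Qed.

Lemma L2B D u v : measurable D -> L2 D u -> L2 D v -> L2 D (fun x => u x - v x).
Proof.
move=> mD Lu Lv; have -> : (fun x => u x - v x) = (fun x => u x + (-1) * v x).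
  by apply/funext => x; rewrite mulN1r.
by apply: L2D => //; exact: L2Z.
Qed.

Lemma L2S D D' u : measurable D -> measurable D' -> D `<=` D' -> L2 D' u -> L2 D u.
Proof.
move=> mD mD' DD' [mu iu]; split; first exact: measurable_funS mu.
exact: integrableS iu.
Qed.

Lemma integrable_cst_bounded D (c : R) : measurable D -> (leb D < +oo)%E ->
  leb.-integrable D (EFin \o (fun=> c)).
Proof.
move=> mD Doo; apply: measurable_bounded_integrable => //.
exact: bounded_cst.
Qed.

Lemma L2_L1 D u : measurable D -> (leb D < +oo)%E -> L2 D u ->
  leb.-integrable D (EFin \o u).
Proof.
move=> mD Doo [mu iu].
apply: (@le_integrable_leb _ (fun x => 1 + u x ^+ 2)) => //.
- move=> x _; rewrite -[in leRHS](real_normK (num_real (u x))).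
  by have := sqr_ge0 (`|u x| - 1); nra.
- by apply: integrableD_EFin => //; exact: integrable_cst_bounded.
Qed.

Lemma bounded_L2 D u (M : R) : measurable D -> (leb D < +oo)%E ->
  measurable_fun D u -> (forall x, D x -> `|u x| <= M) -> L2 D u.
Proof.
move=> mD Doo mu uM; split => //.
apply: (@le_integrable_leb _ (fun=> M ^+ 2)) => //.
- exact: measurable_funX.
- move=> x Dx; rewrite normrX; have := uM x Dx; have := normr_ge0 (u x).
  by nra.
- exact: integrable_cst_bounded.
Qed.

Lemma Rintegral_cst_leb D (c l : R) : measurable D -> leb D = l%:E ->
  \int[leb]_(x in D) c = c * l.
Proof.
move=> mD Dl; rewrite Rintegral_cst//; congr (_ * _).
by transitivity (fine (leb D)) => //; rewrite Dl.
Qed.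

(** A form of the Cauchy-Schwarz inequality without square roots, from
    [`|u| <= eta / 2 + u ^+ 2 / (2 * eta)]. *)
Lemma L1_le_L2 D u (eta l : R) : measurable D -> leb D = l%:E -> L2 D u ->
  0 < eta -> \int[leb]_(x in D) (u x ^+ 2) <= eta ^+ 2 ->
  \int[leb]_(x in D) `|u x| <= eta * (l + 1) / 2.
Proof.
move=> mD Dl L2u eta0 ueta.
have Doo : (leb D < +oo)%E by rewrite Dl ltry.
have [mu iu] := L2u; have i1 := L2_L1 mD Doo L2u.
have ic := integrable_cst_bounded (eta / 2) mD Doo.
have iz : leb.-integrable D (EFin \o (fun x => (2 * eta)^-1 * u x ^+ 2)).
  exact: integrableZ_EFin.
have : \int[leb]_(x in D) `|u x| <=
    \int[leb]_(x in D) (eta / 2 + (2 * eta)^-1 * u x ^+ 2).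
  apply: le_Rintegral => //.
  - exact: integrable_norm.
  - exact: integrableD_EFin.
  - move=> x _; rewrite -[in leRHS](real_normK (num_real (u x))).
    rewrite -subr_ge0.
    have -> : eta / 2 + (2 * eta)^-1 * `|u x| ^+ 2 - `|u x| =
        (`|u x| - eta) ^+ 2 / (2 * eta) by field; rewrite gt_eqF.
    by rewrite divr_ge0 ?sqr_ge0// mulr_ge0// ltW.
move=> /le_trans; apply; rewrite RintegralD// (Rintegral_cst_leb _ mD Dl) RintegralZl//.
have : (2 * eta)^-1 * \int[leb]_(x in D) (u x ^+ 2) <= (2 * eta)^-1 * eta ^+ 2.
  by rewrite ler_wpM2l// invr_ge0 mulr_ge0// ltW.
have -> : (2 * eta)^-1 * eta ^+ 2 = eta / 2 by field; rewrite gt_eqF.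
by lra.
Qed.

Lemma L2_int_bound D u (psi : R -> R) (eta l M : R) : measurable D -> leb D = l%:E ->
  L2 D u -> measurable_fun D psi -> (forall x, D x -> `|psi x| <= M) -> 0 <= M ->
  0 < eta -> \int[leb]_(x in D) (u x ^+ 2) <= eta ^+ 2 ->
  `|\int[leb]_(x in D) (u x * psi x)| <= M * (eta * (l + 1) / 2).
Proof.
move=> mD Dl L2u mpsi psiM M0 eta0 ueta.
have Doo : (leb D < +oo)%E by rewrite Dl ltry.
have [mu iu] := L2u; have i1 := L2_L1 mD Doo L2u.
apply: (@le_trans _ _ (\int[leb]_(x in D) (M * `|u x|))).
  apply: Rintegral_bound => //.
  - exact: (@integrable_mul_bounded _ _ R leb u psi M D).
  - by apply: integrableZ_EFin => //; exact: integrable_norm.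
  - by move=> x Dx; rewrite normrM mulrC ler_wpM2r// psiM.
rewrite RintegralZl//; last exact: integrable_norm.
by rewrite ler_wpM2l// (L1_le_L2 mD Dl L2u).
Qed.

Lemma leb_oo (a b : R) : a <= b -> leb (`]a, b[ : set R) = (b - a)%:E.
Proof.
move=> ab; rewrite lebesgue_measure_itv/= lte_fin; case: ltP => // ba.
by rewrite (le_anti (_ : a <= b <= a)) ?subrr// ab.
Qed.

End square_integrable.

Section weak_derivatives.
Context {R : realType}.
Local Notation leb := (@lebesgue_measure R).
Implicit Types (D I : set R) (u v : R -> R).

Lemma test_fun_L2 I D phi : measurable D -> test_fun I phi ->
  L2 D phi /\ L2 D (derive1 phi).
Proof.
move=> mD tphi; have [d c [K [cK KI K0]]] := tphi.
have [M _ KM] : exists2 M : R, 0 <= M & forall x, K x -> - M <= x <= M.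
  have [M [_ h]] := compact_bounded cK.
  exists (`|M| + 1) => [|x Kx]; first by rewrite addr_ge0.
  by rewrite -ler_norml; apply: h => //; rewrite ltr_pwDr// ler_norm.
have tK : test_fun K phi by split => //; exists K; split.
have sq (f : R -> R) : continuous f -> (forall x, ~ K x -> f x = 0) -> L2 D f.
  move=> cf f0; split; first by apply: measurable_funTS; exact: continuous_measurable_fun.
  apply: (@integrable_compact_support _ _ (- M) M) => //.
    by move=> x; apply: cvgM; exact: cf.
  by move=> x h; rewrite f0 ?expr0n//; apply: contra_not h; exact: KM.
split; apply: sq => //.
- exact: test_fun_continuous tphi.
- by move=> x Kx; have [] := test_fun_eq0 tK Kx.
Qed.

Lemma weak_derivativeD I u v g h : measurable I -> L2 I u -> L2 I v ->
  weak_derivative I u g -> weak_derivative I v h ->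
  weak_derivative I (fun x => u x + v x) (fun x => g x + h x).
Proof.
move=> mI Lu Lv [Lg ug] [Lh vh]; split; first exact: L2D.
move=> phi tphi; have [L0 L1] := test_fun_L2 mI tphi.
under eq_Rintegral do rewrite mulrDl.
rewrite RintegralD//; [|exact: L2_mul|exact: L2_mul].
under [in RHS]eq_Rintegral do rewrite mulrDl.
rewrite RintegralD//; [|exact: L2_mul|exact: L2_mul].
by rewrite ug// vh// opprD.
Qed.

Lemma weak_derivativeZ I (c : R) u g : measurable I -> L2 I u ->
  weak_derivative I u g -> weak_derivative I (fun x => c * u x) (fun x => c * g x).
Proof.
move=> mI Lu [Lg ug]; split; first exact: L2Z.
move=> phi tphi; have [L0 L1] := test_fun_L2 mI tphi.
under eq_Rintegral do rewrite -mulrA.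
rewrite RintegralZl//; last exact: L2_mul.
under [in RHS]eq_Rintegral do rewrite -mulrA.
rewrite RintegralZl//; last exact: L2_mul.
by rewrite ug// mulrN.
Qed.

Lemma weak_derivativeB I u v g h : measurable I -> L2 I u -> L2 I v ->
  weak_derivative I u g -> weak_derivative I v h ->
  weak_derivative I (u \- v) (fun x => g x - h x).
Proof.
move=> mI Lu Lv ug vh.
have := weak_derivativeD mI Lu (L2Z (-1) mI Lv) ug (weak_derivativeZ (-1) mI Lv vh).
congr weak_derivative; apply/funext => x; by rewrite mulN1r.
Qed.

Lemma wderivP I u : H1 I u -> weak_derivative I u (wderiv I u).
Proof. by move=> [_ [g ug]]; rewrite /wderiv; apply: (@xgetPex _ (cst 0) [set g | weak_derivative I u g]); exists g. Qed.

Lemma H1B I u v : measurable I -> H1 I u -> H1 I v -> H1 I (u \- v).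
Proof.
move=> mI Hu Hv; split; first by apply: L2B => //; [case: Hu|case: Hv].
by eexists; apply: weak_derivativeB (wderivP Hu) (wderivP Hv) => //; [case: Hu|case: Hv].
Qed.

Lemma H1_norm_bounds I u : measurable I -> H1 I u ->
  \int[leb]_(x in I) (u x ^+ 2) <= H1_norm I u ^+ 2 /\
  \int[leb]_(x in I) (wderiv I u x ^+ 2) <= H1_norm I u ^+ 2.
Proof.
move=> mI Hu; have a0 (f : R -> R) : 0 <= \int[leb]_(x in I) (f x ^+ 2).
  by apply: Rintegral_ge0 => x _; exact: sqr_ge0.
have -> : H1_norm I u ^+ 2 = \int[leb]_(x in I) (u x ^+ 2) +
    \int[leb]_(x in I) (wderiv I u x ^+ 2).
  by rewrite /H1_norm /H1_inner sqr_sqrtr// addr_ge0 ?a0//.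
by rewrite lerDl lerDr !a0.
Qed.

End weak_derivatives.

(** * Continuously differentiable functions and the fundamental lemma *)

Section continuously_differentiable.
Context {R : realType}.
Local Notation leb := (@lebesgue_measure R).
Implicit Types (phi psi F : R -> R).

Definition C1 psi := (forall x, derivable psi x 1) /\ continuous (derive1 psi).

Lemma C1_continuous psi : C1 psi -> continuous psi.
Proof. by move=> [d _] x; apply/differentiable_continuous/derivable1_diffP. Qed.

Lemma C1_is_derive psi : C1 psi -> forall x, is_derive x (1 : R) psi (derive1 psi x).
Proof. by move=> [d _] x; apply: DeriveDef; [exact: d|rewrite derive1E]. Qed.

Lemma C1M phi psi : C1 phi -> C1 psi -> C1 (fun x => phi x * psi x) /\
  derive1 (fun x => phi x * psi x) =
  (fun x => derive1 phi x * psi x + phi x * derive1 psi x).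
Proof.
move=> c1 c2.
have dM x : is_derive x (1 : R) (fun x => phi x * psi x)
    (derive1 phi x * psi x + phi x * derive1 psi x).
  apply: (is_derive_eq (is_deriveM (C1_is_derive c1 x) (C1_is_derive c2 x))).
  by rewrite /GRing.scale/= addrC mulrC [X in _ + X]mulrC.
have e : derive1 (fun x => phi x * psi x) =
    (fun x => derive1 phi x * psi x + phi x * derive1 psi x).
  by apply/funext => x; rewrite derive1E; exact: derive_val.
split; last exact: e.
split; first by move=> x; exact: ex_derive.
rewrite e => x; apply: cvgD; apply: cvgM.
- by case: c1 => _; exact.
- exact: C1_continuous.
- exact: C1_continuous.
- by case: c2 => _; exact.
Qed.

Lemma C1B phi psi : C1 phi -> C1 psi -> C1 (fun x => phi x - psi x) /\
  derive1 (fun x => phi x - psi x) = (fun x => derive1 phi x - derive1 psi x).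
Proof.
move=> c1 c2.
have dM x : is_derive x (1 : R) (fun x => phi x - psi x)
    (derive1 phi x - derive1 psi x).
  exact: (is_deriveB (C1_is_derive c1 x) (C1_is_derive c2 x)).
have e : derive1 (fun x => phi x - psi x) = (fun x => derive1 phi x - derive1 psi x).
  by apply/funext => x; rewrite derive1E; exact: derive_val.
split; last exact: e.
split; first by move=> x; exact: ex_derive.
by rewrite e => x; apply: cvgB; [case: c1 => _|case: c2 => _]; exact.
Qed.

Lemma test_fun_C1 I phi : test_fun I phi -> C1 phi.
Proof. by case. Qed.

Lemma C1_FTC F (a b : R) : C1 F -> a < b ->
  \int[leb]_(x in `]a, b[) derive1 F x = F b - F a /\
  \int[leb]_(x in `[a, b]) derive1 F x = F b - F a.
Proof.
move=> [dF cF] ab; have cF' := C1_continuous (conj dF cF).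
have ci : leb.-integrable `[a, b] (EFin \o derive1 F).
  by apply: continuous_compact_integrable; [exact: segment_compact|exact: continuous_subspaceT].
have e : \int[leb]_(x in `[a, b]) derive1 F x = F b - F a.
  have h : (\int[leb]_(x in `[a, b]) (derive1 F x)%:E = (F b)%:E - (F a)%:E)%E.
    apply: continuous_FTC2; first exact: ab.
    - exact: continuous_subspaceT.
    - split; first by move=> x _; exact: dF.
      + by apply: cvg_at_right_filter; exact: cF'.
      + by apply: cvg_at_left_filter; exact: cF'.
    - by move=> x _.
  by rewrite /Rintegral h.
split; last exact: e.
rewrite -e Rintegral_itv_bndo_bndc.
  apply: Rintegral_itv_obnd_cbnd; apply: integrableS ci => //.
  by move=> x /=; rewrite !in_itv/= => /andP[/ltW -> ->].
apply: integrableS ci => //.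
by move=> x /=; rewrite !in_itv/= => /andP[/ltW -> /ltW ->].
Qed.

End continuously_differentiable.

Section test_function_duality.
Context {R : realType}.
Local Notation leb := (@lebesgue_measure R).
Local Notation charges := (charge (measurableTypeR R) R).
Variables a b : R.
Hypothesis ab : a < b.

(** Explicit bounds for the support of the test function, from which a primitive
    with compact support can be constructed. *)
Definition inner_test (phi : R -> R) := test_fun `]a, b[ phi /\
  exists c d, [/\ a < c, c <= d, d < b & forall x, ~ (c <= x <= d) -> phi x = 0].

Let mI : measurable (`]a, b[ : set R). Proof. exact: measurable_itv. Qed.

(** The charge with density [f] vanishes on intervals, as the limit of bumps, and
    hence on all Borel sets. *)
Lemma ae0_of_test (f : R -> R) : leb.-integrable `]a, b[ (EFin \o f) ->
  (forall phi, inner_test phi -> \int[leb]_(x in `]a, b[) (f x * phi x) = 0) ->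
  {ae leb, forall x, `]a, b[%classic x -> f x = 0}.
Proof.
move=> intf f0.
have mf : measurable_fun `]a, b[ f by apply/measurable_EFinP; exact: measurable_int intf.
pose F := f \_ `]a, b[.
have intF : leb.-integrable setT (EFin \o F) by exact: integrable_patch.
pose nu : charges := induced_charge intF.
have nuE (A : set R) : measurable A -> A `<=` `]a, b[ ->
    nu A = (\int[leb]_(x in A) (f x)%:E)%E.
  move=> mA AI; apply: eq_integral => x /set_mem Ax /=.
  by rewrite /F patchE mem_set//; exact: AI.
have nuI (A : set R) : measurable A -> nu A = nu (A `&` `]a, b[).
  move=> mA; rewrite [RHS]nuE; [|exact: measurableI|by move=> x []].
  rewrite integral_mkcondr; apply: eq_integral => x /set_mem Ax /=.
  by rewrite /F !patchE; case: ifPn.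
have mi (i : interval R) : measurable ([set` i] : set R) by exact: measurable_itv.
have nu0 (c d : R) : nu (`]c, d[) = 0%E.
  rewrite nuI//.
  pose c' := Num.max c a; pose d' := Num.min d b.
  have -> : `]c, d[ `&` `]a, b[ = `]c', d'[ :> set R.
    apply/seteqP; split => x /=; rewrite !in_itv/= /c' /d' gt_max lt_min.
      by move=> [/andP[-> ->] /andP[-> ->]].
    by move=> /andP[/andP[-> ->] /andP[-> ->]].
  have [cd'|dc'] := ltP c' d'; last first.
    by rewrite set_itv_ge ?charge0//= -leNgt bnd_simp.
  have ac' : a <= c' by rewrite /c' le_max lexx orbT.
  have db' : d' <= b by rewrite /d' ge_min lexx orbT.
  have sub : `]c', d'[ `<=` (`]a, b[ : set R).
    move=> x /=; rewrite !in_itv/= => /andP[h1 h2].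
    by rewrite (le_lt_trans ac' h1) (lt_le_trans h2 db').
  have [phi [tphi sphi phi01 phic]] := bump_seq cd'.
  have inn n : inner_test (phi n).
    split; first exact: test_funS (tphi n).
    have [c1 [d1 [h1 h2 h3 h4]]] := sphi n; exists c1, d1; split => //.
      exact: le_lt_trans h1.
    exact: lt_le_trans h3 _.
  have [_ cv] := @Rintegral_dominated_cvg _ _ R leb (fun n x => f x * phi n x)
    (fun x => f x * (\1_(`]c', d'[ : set R) x)) (fun x => `|f x|) `]a, b[ mI
    (fun n => measurable_funM mf (test_fun_measurable_bounded `]a, b[ (tphi n)).1)
    (measurable_funM mf (@measurable_indic _ R R `]a, b[ _ (mi _)))
    (aeW leb (fun x _ => cvgM (cvg_cst (f x)) (phic x)))
    (integrable_norm intf)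
    (fun n x _ => ltac:(by rewrite normrM ler_piMr// ger0_norm; have /andP[] := phi01 n x)).
  have int0 : \int[leb]_(x in `]a, b[) (f x * (\1_(`]c', d'[ : set R) x)) = 0.
    apply: cvgn_unique cv _; apply: cvg_near_cst; apply: nearW => n.
    exact: f0.
  have iS : leb.-integrable `]c', d'[ (EFin \o f) by exact: integrableS intf.
  rewrite nuE// -(@fineK _ (\int[leb]_(x in `]c', d'[) (f x)%:E)%E); last first.
    exact: integrable_fin_num.
  congr EFin; rewrite -[RHS]int0 -[fine _]/(\int[leb]_(x in `]c', d'[) f x).
  rewrite -[in LHS](setIidr sub) Rintegral_mkcondr; apply: eq_Rintegral => x _.
  rewrite patchE indicE; have [h|h] := pselect (`]c', d'[%classic x).
    by rewrite !mem_set//= mulr1n mulr1.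
  by rewrite !memNset//= mulr0n mulr0.
have nuA0 A : measurable A -> nu A = 0%E.
  move=> mA; apply/eqP; rewrite eq_le; apply/andP; split.
    rewrite -oppe_ge0.
    apply: (@charge_ge0_of_open _ (copp nu) setT measurableT _ A mA) => // c d _.
    by rewrite setIT -[X in fine X]/(- nu `]c, d[)%E nu0 oppe0.
  apply: (@charge_ge0_of_open _ nu setT measurableT _ A mA) => // c d _.
  by rewrite setIT nu0.
have : ae_eq leb `]a, b[ (EFin \o f) (cst 0%E).
  apply: integral_ae_eq => //.
  move=> E EI mE; rewrite integral0.
  exact: etrans (esym (nuE E mE EI)) (nuA0 E mE).
by apply: ae_imp => x h /h /= [].
Qed.

End test_function_duality.

Section du_bois_reymond.
Context {R : realType}.
Local Notation leb := (@lebesgue_measure R).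
Variables a b : R.
Hypothesis ab : a < b.

Let mI : measurable (`]a, b[ : set R). Proof. exact: measurable_itv. Qed.

Let Ioo : (leb (`]a, b[ : set R) < +oo)%E.
Proof. by rewrite leb_oo ?ltW// ltry. Qed.

Lemma test_fun_integrable_mul (I : set R) (f phi : R -> R) :
  leb.-integrable `]a, b[ (EFin \o f) -> test_fun I phi ->
  leb.-integrable `]a, b[ (EFin \o (fun x => f x * phi x)) /\
  leb.-integrable `]a, b[ (EFin \o (fun x => f x * derive1 phi x)).
Proof.
move=> intf tphi; have [M hM] := test_fun_bounded tphi.
have [d c _] := tphi; split.
  apply: (@integrable_mul_bounded _ _ R leb f phi M) => //.
    by apply: measurable_funTS; apply: continuous_measurable_fun; exact: test_fun_continuous tphi.
  by move=> x _; have [] := hM x.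
apply: (@integrable_mul_bounded _ _ R leb f (derive1 phi) M) => //.
  by apply: measurable_funTS; apply: continuous_measurable_fun.
by move=> x _; have [] := hM x.
Qed.

(** The du Bois-Reymond lemma.  Fix [H'] of compact support and integral one; for
    a test function [phi] of integral [k], the function [phi - k H'] is the
    derivative of a test function, so the integral of [f phi] is [k] times that
    of [f H']. *)
Lemma const_of_test_derivative (f : R -> R) : leb.-integrable `]a, b[ (EFin \o f) ->
  (forall phi, test_fun `]a, b[ phi -> \int[leb]_(x in `]a, b[) (f x * derive1 phi x) = 0) ->
  exists c, {ae leb, forall x, `]a, b[%classic x -> f x = c}.
Proof.
move=> intf f0.
have mf : measurable_fun `]a, b[ f by apply/measurable_EFinP; exact: measurable_int intf.
pose d := (b - a) / 3; have d0 : 0 < d by have ab' := ab; rewrite /d; lra.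
have ab' := ab.
have [H [dH [cH' cH] _ Hl Hr]] := smooth_step_exists (a + d) d0.
have bd3 : a + d + d <= b by rewrite /d; lra.
have ad3 : a <= a + d by rewrite /d; lra.
have Hb : H b = 1 := (Hr b bd3).1.
have Ha : H a = 0 := (Hl a ad3).1.
have [intH _] := C1_FTC (conj dH cH') ab; rewrite Hb Ha subr0 in intH.
have [MH HM] : exists M : R, forall x, `|derive1 H x| <= M.
  have : bounded_set (derive1 H @` `[a + d, a + d + d]).
    apply: compact_bounded; apply: continuous_compact; last exact: segment_compact.
    exact: continuous_subspaceT.
  move=> [M [_ h]]; exists (`|M| + 1) => x.
  have [xl|xl] := leP x (a + d); first by rewrite (Hl x xl).2 normr0 addr_ge0.
  have [xr|xr] := leP (a + d + d) x; first by rewrite (Hr x xr).2 normr0 addr_ge0.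
  by apply: h; [rewrite ltr_pwDr// ler_norm|exists x; rewrite //= in_itv/= !ltW].
have mH' : measurable_fun `]a, b[ (derive1 H).
  by apply: measurable_funTS; exact: continuous_measurable_fun.
have ifH : leb.-integrable `]a, b[ (EFin \o (fun x => f x * derive1 H x)).
  exact: (@integrable_mul_bounded _ _ R leb f (derive1 H) MH).
have iH : leb.-integrable `]a, b[ (EFin \o derive1 H).
  apply: (@le_integrable_leb _ _ (fun=> MH)) => //.
  exact: integrable_cst_bounded.
pose c := \int[leb]_(x in `]a, b[) (f x * derive1 H x).
exists c.
have ic : leb.-integrable `]a, b[ (EFin \o (fun x => f x - c)).
  apply: integrableB_EFin => //; exact: integrable_cst_bounded.
have := @ae0_of_test _ a b (fun x => f x - c) ic.
suff H0 : forall phi, inner_test a b phi ->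
    \int[leb]_(x in `]a, b[) ((f x - c) * phi x) = 0.
  move=> /(_ H0); apply: ae_imp => x h /h /eqP.
  by rewrite subr_eq0 => /eqP.
move=> phi [tphi [c1 [d1 [ac1 cd1 d1b phi0]]]].
have cphi := test_fun_continuous tphi.
have [ifphi _] := test_fun_integrable_mul intf tphi.
have [L2phi _] := test_fun_L2 mI tphi.
have iphi := L2_L1 mI Ioo L2phi.
pose k := \int[leb]_(x in `]a, b[) phi x.
pose r x : R := phi x - k * derive1 H x.
have cr : continuous r.
  by move=> x; apply: cvgB; [exact: cphi|apply: cvgM; [exact: cvg_cst|exact: cH']].
(* A segment of the open interval that contains both supports. *)
pose al := Num.min c1 (a + d); pose be := Num.max d1 (a + d + d).
have aal : a < al by rewrite /al lt_min ac1 /d; lra.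
have beb : be < b by rewrite /be gt_max d1b /d; lra.
have albe : al <= be by rewrite /al /be ge_min le_max cd1.
have r0 x : ~ (al <= x <= be) -> r x = 0.
  move=> /negP; rewrite negb_and -!ltNge /al /be lt_min gt_max.
  case/orP => /andP[h1 h2].
    rewrite /r phi0 ?(Hl x (ltW h2)).2 ?mulr0 ?subr0// => /andP[h3 _].
    by move: h1; rewrite ltNge h3.
  rewrite /r phi0 ?(Hr x (ltW h2)).2 ?mulr0 ?subr0// => /andP[_ h3].
  by move: h1; rewrite ltNge h3.
have [dF F' Fl Fr] := primitive_C1 cr r0 albe.
set F := (fun x => \int[leb]_(y in `]-oo, x]) r y) in dF F' Fl Fr.
have intr : \int[leb]_(x in `]a, b[) r x = 0.
  rewrite /r RintegralB//; last exact: integrableZ_EFin.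
  by rewrite RintegralZl// intH mulr1 subrr.
have cF' : continuous (derive1 F) by rewrite F'.
have [intF _] := C1_FTC (conj dF cF') ab.
have Fa : F a = 0 by apply: Fl; exact: ltW.
have Fbe x : be <= x -> F x = 0.
  move=> bx; transitivity (F b).
    by rewrite /F (Fr x bx) (Fr b (ltW beb)).
  by move: intF; rewrite F' intr Fa subr0.
have tF : test_fun `]a, b[ F.
  split; [exact: dF|exact: cF'|]; exists `[al, be]; split; first exact: segment_compact.
    move=> x /=; rewrite !in_itv/= => /andP[h1 h2].
    by rewrite (lt_le_trans aal h1) (le_lt_trans h2).
  move=> x /=; rewrite in_itv/= => /negP; rewrite negb_and -!ltNge.
  by case/orP => h; [apply: Fl; exact: ltW|apply: Fbe; exact: ltW].
have := f0 F tF; rewrite F' /r.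
under eq_Rintegral do rewrite mulrBr mulrCA.
rewrite RintegralB//; last exact: integrableZ_EFin.
rewrite RintegralZl// -/c => e.
under eq_Rintegral do rewrite mulrBl.
rewrite RintegralB//; last exact: integrableZ_EFin.
by rewrite RintegralZl// -/k mulrC.
Qed.

Lemma weak_derivative_unique (u g h : R -> R) :
  weak_derivative `]a, b[ u g -> weak_derivative `]a, b[ u h ->
  {ae leb, forall x, `]a, b[%classic x -> g x = h x}.
Proof.
move=> [Lg ug] [Lh uh].
have ig := L2_L1 mI Ioo Lg; have ih := L2_L1 mI Ioo Lh.
have igh : leb.-integrable `]a, b[ (EFin \o (fun x => g x - h x)).
  exact: integrableB_EFin.
have := @ae0_of_test _ a b (fun x => g x - h x) igh.
suff H0 : forall phi, inner_test a b phi ->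
    \int[leb]_(x in `]a, b[) ((g x - h x) * phi x) = 0.
  move=> /(_ H0); apply: ae_imp => x e /e /eqP.
  by rewrite subr_eq0 => /eqP.
move=> phi [tphi _]; have [i1 _] := test_fun_integrable_mul ig tphi.
have [i2 _] := test_fun_integrable_mul ih tphi.
under eq_Rintegral do rewrite mulrBl.
rewrite RintegralB//.
by apply/eqP; rewrite subr_eq0 -eqr_opp -ug// -uh.
Qed.

(** The second part allows [psi] not to vanish at the endpoints; by density it
    extends to all of H10 in [H10_green]. *)
Lemma test_fun_weak_derivative (phi : R -> R) : test_fun `]a, b[ phi ->
  weak_derivative `]a, b[ phi (derive1 phi) /\
  forall psi, C1 psi -> \int[leb]_(x in `]a, b[) (phi x * derive1 psi x) =
    - \int[leb]_(x in `]a, b[) (derive1 phi x * psi x).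
Proof.
move=> tphi; have [L0 L1] := test_fun_L2 mI tphi.
suff G : forall psi, C1 psi -> \int[leb]_(x in `]a, b[) (phi x * derive1 psi x) =
    - \int[leb]_(x in `]a, b[) (derive1 phi x * psi x).
  by split => //; split => // psi /test_fun_C1 /G.
move=> psi cpsi; have cphi := test_fun_C1 tphi.
have [cm dm] := C1M cphi cpsi.
have [e _] := C1_FTC cm ab.
have phi0 x : ~ (`]a, b[%classic x) -> phi x = 0 by move=> /(test_fun_eq0 tphi) [].
have bd (f : R -> R) : continuous f -> L2 `]a, b[ f.
  move=> cf; have [M HM] : exists M : R, forall x, `[a, b]%classic x -> `|f x| <= M.
    have : bounded_set (f @` `[a, b]).
      apply: compact_bounded; apply: continuous_compact; last exact: segment_compact.
      exact: continuous_subspaceT.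
    move=> [M [_ h]]; exists (`|M| + 1) => x xab.
    by apply: h; [rewrite ltr_pwDr// ler_norm|exists x].
  apply: (@bounded_L2 _ _ _ M) => //.
    by apply: measurable_funTS; exact: continuous_measurable_fun.
  move=> x /=; rewrite in_itv/= => /andP[h1 h2]; apply: HM.
  by rewrite /= in_itv/= !ltW.
have L2psi : L2 `]a, b[ psi by apply: bd; exact: C1_continuous.
have L2psi' : L2 `]a, b[ (derive1 psi) by apply: bd; case: cpsi.
rewrite dm RintegralD in e; [|exact: mI|exact: L2_mul|exact: L2_mul].
rewrite (phi0 a) ?(phi0 b) ?mul0r ?subrr in e; last 2 first.
- by rewrite /= in_itv/= ltxx andbF.
- by rewrite /= in_itv/= ltxx.
by apply/eqP; rewrite -addr_eq0 addrC e.
Qed.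

End du_bois_reymond.

(** * Green formulas *)

Section green_formulas.
Context {R : realType}.
Local Notation leb := (@lebesgue_measure R).

Lemma continuous_bounded_segment (f : R -> R) (a b : R) : continuous f ->
  exists2 M : R, 0 <= M & forall x, a <= x <= b -> `|f x| <= M.
Proof.
move=> cf.
have : bounded_set (f @` `[a, b]).
  apply: compact_bounded; apply: continuous_compact; last exact: segment_compact.
  exact: continuous_subspaceT.
move=> [M [_ h]]; exists (`|M| + 1); first by rewrite addr_ge0.
move=> x xab; apply: h; first by rewrite ltr_pwDr// ler_norm.
by exists x; rewrite //= in_itv.
Qed.

Lemma Rintegral_supported (f : R -> R) (D : set R) :
  (forall x, ~ D x -> f x = 0) -> \int[leb]_x f x = \int[leb]_(x in D) f x.
Proof.
move=> f0; rewrite [RHS]Rintegral_mkcond; apply: eq_Rintegral => x _.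
by rewrite patchE; case: ifPn => //; rewrite notin_setE => /f0.
Qed.

Lemma unit_dist (y z : R) : 0 <= y <= 1 -> 0 <= z <= 1 -> `|y - z| <= 1.
Proof. by move=> /andP[? ?] /andP[? ?]; rewrite ler_norml; apply/andP; split; lra. Qed.

(** The derivative of a smooth step starting at [a] has mean one and is supported
    in [`[a, a + d]]. *)
Lemma approximate_delta (f H : R -> R) (a d al be e : R) : 0 < d -> C1 H ->
  (forall x, 0 <= derive1 H x) ->
  (forall x, x <= a -> H x = 0 /\ derive1 H x = 0) ->
  (forall x, a + d <= x -> H x = 1 /\ derive1 H x = 0) ->
  continuous f -> al <= a -> a + d <= be ->
  (forall x, a <= x <= a + d -> `|f x - f a| <= e) ->
  `|\int[leb]_(x in `[al, be]) (f x * derive1 H x) - f a| <= e.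
Proof.
move=> d0 cH H0 Hl Hr cf ala dbe fe.
have cH' : continuous (derive1 H) by case: cH.
have albe : al < be by lra.
have iJ (k : R -> R) : continuous k -> leb.-integrable `[al, be] (EFin \o k).
  by move=> ck; apply: continuous_compact_integrable; [exact: segment_compact|exact: continuous_subspaceT].
have [_ intH] := C1_FTC cH albe.
have Hbe : H be = 1 := (Hr be dbe).1.
have Hal : H al = 0 := (Hl al ala).1.
rewrite Hbe Hal subr0 in intH.
have mJ : measurable (`[al, be] : set R) by exact: measurable_itv.
have -> : \int[leb]_(x in `[al, be]) (f x * derive1 H x) - f a =
    \int[leb]_(x in `[al, be]) ((f x - f a) * derive1 H x).
  under [RHS]eq_Rintegral do rewrite mulrBl.
  rewrite RintegralB//; last 2 first.
  - by apply: iJ => x; apply: cvgM; [exact: cf|exact: cH'].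
  - by apply: integrableZ_EFin => //; exact: iJ.
  by rewrite RintegralZl//; [rewrite intH mulr1|exact: iJ].
rewrite -[leRHS]mulr1 -intH -RintegralZl//; last exact: iJ.
apply: Rintegral_bound => //.
- apply: iJ => x; apply: cvgM; last exact: cH'.
  by apply: cvgB; [exact: cf|exact: cvg_cst].
- by apply: integrableZ_EFin => //; exact: iJ.
- move=> x _; rewrite normrM (ger0_norm (H0 x)).
  have [xl|xl] := leP x a; first by rewrite (Hl x xl).2 !mulr0.
  have [xr|xr] := leP (a + d) x; first by rewrite (Hr x xr).2 !mulr0.
  by rewrite ler_wpM2r// fe// !ltW.
Qed.

(** Integration by parts on [`]0, L[] for a function whose weak derivative is
    taken on the whole line.  Test with [psi] times a smooth cutoff of [`[0, L]]:
    the derivative of the cutoff tends to the difference of the Dirac masses at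
    [0] and [L], and continuity of [w] produces the boundary terms. *)
Lemma green_line (L : R) (w g psi : R -> R) : 0 < L ->
  L2 setT w -> continuous w -> weak_derivative setT w g -> C1 psi ->
  \int[leb]_(x in `]0, L[) (w x * derive1 psi x) =
  w L * psi L - w 0 * psi 0 - \int[leb]_(x in `]0, L[) (g x * psi x).
Proof.
move=> L0 L2w cw [L2g wg] cpsi.
have cpsi0 := C1_continuous cpsi; have cpsi' : continuous (derive1 psi) by case: cpsi.
pose d (n : nat) : R := n.+1%:R^-1.
have d0 n : 0 < d n by rewrite /d invr_gt0.
have d1 n : d n <= 1 by rewrite /d invf_le1 ?ltr0n// ler1n.
pose f n := sval (cid (smooth_step_exists 0 (d0 n))).
pose h n := sval (cid (smooth_step_exists L (d0 n))).
have fP n := svalP (cid (smooth_step_exists 0 (d0 n))).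
have hP n := svalP (cid (smooth_step_exists L (d0 n))).
have cf n : C1 (f n) by have [d' [c' _] _ _ _] := fP n; exact: (conj d' c').
have ch n : C1 (h n) by have [d' [c' _] _ _ _] := hP n; exact: (conj d' c').
have [M M0 psiM] := continuous_bounded_segment 0 (L + 1) cpsi0.
(* A cutoff rising from 0 to 1 just after 0 and falling back just after L. *)
pose chi n x := f n x - h n x.
have cchi n : C1 (chi n) := (C1B (cf n) (ch n)).1.
have dchi n : derive1 (chi n) = (fun x => derive1 (f n) x - derive1 (h n) x).
  exact: (C1B (cf n) (ch n)).2.
pose J : set R := `[0, L + 1]%classic.
have mJ : measurable J by exact: measurable_itv.
have chi_out n x : ~ J x -> chi n x = 0.
  rewrite /J/= in_itv/= => /negP; rewrite negb_and -!ltNge => /orP[xl|xr].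
    have [_ _ _ fl _] := fP n; have [_ _ _ hl _] := hP n.
    rewrite /chi /f /h (fl x (ltW xl)).1 (hl x _).1 ?subrr//.
    by apply: ltW; exact: lt_trans L0.
  have [_ _ _ _ fr] := fP n; have [_ _ _ _ hr] := hP n.
  have xL : L + d n <= x by rewrite (le_trans _ (ltW xr))// lerD2l.
  have x0 : 0 + d n <= x by rewrite (le_trans _ xL)// lerD2r ltW.
  by rewrite /chi /f /h (fr x x0).1 (hr x xL).1 subrr.
have chi_bd n x : `|chi n x| <= 1.
  have [_ _ [_ f01] _ _] := fP n; have [_ _ [_ h01] _ _] := hP n.
  have := f01 x; have := h01 x; rewrite -/(f n x) -/(h n x).
  by move=> z01 y01; exact: unit_dist.
have chi_cvg x : chi ^~ x @ \oo --> (\1_(`]0, L] : set R) x : R).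
  apply: cvg_near_cst; rewrite indicE.
  have [x0|x0] := leP x 0.
    near=> n; have [_ _ _ fl _] := fP n; have [_ _ _ hl _] := hP n.
    rewrite memNset/=; last by rewrite in_itv/= ltNge x0.
    by rewrite /chi /f /h (fl x x0).1 (hl x (le_trans x0 (ltW L0))).1 subrr.
  have small y : 0 < y -> \forall n \near \oo, d n <= y.
    move=> y0; near=> n; apply: ltW; near: n.
    exact: (near_infty_natSinv_lt (PosNum y0)).
  have [xL|xL] := leP x L.
    have dx := small x x0.
    near=> n; have [_ _ _ _ fr] := fP n; have [_ _ _ hl _] := hP n.
    rewrite mem_set/=; last by rewrite in_itv/= x0 xL.
    rewrite /chi /f /h (hl x xL).1 subr0 (fr x _).1// add0r.
    by near: n.
  have xL0 : 0 < x - L by rewrite subr_gt0.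
  have dx := small _ xL0.
  near=> n; have [_ _ _ _ fr] := fP n; have [_ _ _ _ hr] := hP n.
  have dn : d n <= x - L by near: n.
  have h1 : L + d n <= x by rewrite -lerBrDl.
  have h0 : 0 + d n <= x by rewrite (le_trans _ h1)// lerD2r ltW.
  rewrite memNset/=; last by rewrite in_itv/= leNgt xL andbF.
  by rewrite /chi /f /h (fr x h0).1 (hr x h1).1 subrr.
pose phi n x := psi x * chi n x.
have cphi n := (C1M cpsi (cchi n)).1.
have dphi n := (C1M cpsi (cchi n)).2.
have tphi n : test_fun setT (phi n).
  have [dp cp] := cphi n; split; [exact: dp|exact: cp|].
  exists J; split; [exact: segment_compact|by []|].
  by move=> x /chi_out; rewrite /phi => ->; rewrite mulr0.
have tphiJ n : test_fun J (phi n).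
  have [dp cp] := cphi n; split; [exact: dp|exact: cp|].
  exists J; split; [exact: segment_compact|by []|].
  by move=> x /chi_out; rewrite /phi => ->; rewrite mulr0.
have iJ (k : R -> R) : continuous k -> leb.-integrable J (EFin \o k).
  by move=> ck; apply: continuous_compact_integrable; [exact: segment_compact|exact: continuous_subspaceT].
have Joo : (leb J < +oo)%E.
  by rewrite /J lebesgue_measure_itv/= lte_fin; case: ifPn => // _; rewrite -EFinB ltry.
have igJ : leb.-integrable J (EFin \o g).
  by apply: L2_L1 => //; apply: L2S L2g.
have mpsi : measurable_fun J psi.
  by apply: measurable_funTS; exact: continuous_measurable_fun.
have igpsi : leb.-integrable J (EFin \o (fun x => g x * psi x)).
  by apply: (@integrable_mul_bounded _ _ R leb g psi M) => // x; rewrite /J/= in_itv; exact: psiM.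
have lim (k : R -> R) : leb.-integrable J (EFin \o k) ->
    (fun n => \int[leb]_(x in J) (k x * chi n x)) @ \oo -->
    \int[leb]_(x in `]0, L[) k x.
  move=> ik; have mk : measurable_fun J k by apply/measurable_EFinP; exact: measurable_int ik.
  have mchi n : measurable_fun J (chi n).
    by apply: measurable_funTS; apply: continuous_measurable_fun; exact: C1_continuous.
  have mind : measurable_fun J (\1_(`]0, L] : set R) : R -> R).
    have mi (i : interval R) : measurable ([set` i] : set R) by exact: measurable_itv.
    exact: (@measurable_indic _ R R J _ (mi _)).
  have [_ cv] := @Rintegral_dominated_cvg _ _ R leb (fun n x => k x * chi n x)
    (fun x => k x * (\1_(`]0, L] : set R) x)) (fun x => `|k x|) J mJ
    (fun n => measurable_funM mk (mchi n)) (measurable_funM mk mind)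
    (aeW leb (fun x _ => cvgM (cvg_cst (k x)) (chi_cvg x)))
    (integrable_norm ik)
    (fun n x _ => ltac:(by rewrite normrM ler_piMr)).
  suff <- : \int[leb]_(x in J) (k x * (\1_(`]0, L] : set R) x)) =
      \int[leb]_(x in `]0, L[) k x by [].
  have sub : `]0, L] `<=` J.
    by move=> x; rewrite /J/= !in_itv/= => /andP[x0 xL]; rewrite ltW//= (le_trans xL)// lerDl.
  transitivity (\int[leb]_(x in `]0, L]) k x).
    rewrite -[in RHS](setIidr sub) Rintegral_mkcondr; apply: eq_Rintegral => x _.
    rewrite patchE indicE; have [xL|xL] := pselect (`]0, L]%classic x).
      by rewrite !mem_set//= mulr1n mulr1.
    by rewrite !memNset//= mulr0n mulr0.
  apply/esym/Rintegral_itv_bndo_bndc; apply: integrableS ik => //.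
  move=> x; rewrite /J/= !in_itv/= => /andP[x0 xL].
  by rewrite ltW//= (le_trans (ltW xL))// lerDl.
pose wpsi x := w x * psi x.
have cwpsi : continuous wpsi by move=> x; apply: cvgM; [exact: cw|exact: cpsi0].
have delta (a : R) (H : nat -> R -> R) : 0 <= a -> a <= L ->
    (forall n, [/\ C1 (H n), (forall x, 0 <= derive1 (H n) x),
      (forall x, x <= a -> H n x = 0 /\ derive1 (H n) x = 0) &
      (forall x, a + d n <= x -> H n x = 1 /\ derive1 (H n) x = 0)]) ->
    (fun n => \int[leb]_(x in J) (wpsi x * derive1 (H n) x)) @ \oo --> wpsi a.
  move=> a0 aL HP; apply/cvgrPdist_le => e e0.
  have [r /= r0 Hr] := (@cvgrPdist_le _ _ _ _ _ _ _).1 (cwpsi a) e e0.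
  near=> n; rewrite distrC; have [c1 c2 c3 c4] := HP n.
  apply: (approximate_delta (d0 n) c1 c2 c3 c4 cwpsi a0).
    by rewrite lerD.
  move=> x /andP[ax xa]; rewrite distrC; apply: Hr; rewrite /ball_/= distrC ger0_norm ?subr_ge0//.
  have : d n < r by near: n; exact: (near_infty_natSinv_lt (PosNum r0)).
  by move=> dr; rewrite ltrBlDl; apply: le_lt_trans xa _; rewrite ltrD2l.
have l1 := delta 0 f (lexx 0) (ltW L0) (fun n =>
  let: And5 _ _ p q r := fP n in And4 (cf n) p.1 q r).
have l2 := delta L h (ltW L0) (lexx L) (fun n =>
  let: And5 _ _ p q r := hP n in And4 (ch n) p.1 q r).
have iwp' : leb.-integrable J (EFin \o (fun x => w x * derive1 psi x)).
  by apply: iJ => x; apply: cvgM; [exact: cw|exact: cpsi'].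
have l3 := lim _ iwp'; have l4 := lim _ igpsi.
have E n : \int[leb]_(x in J) (w x * derive1 psi x * chi n x) +
   (\int[leb]_(x in J) (wpsi x * derive1 (f n) x) -
    \int[leb]_(x in J) (wpsi x * derive1 (h n) x)) =
   - \int[leb]_(x in J) (g x * psi x * chi n x).
  have := wg (phi n) (tphi n).
  rewrite (@Rintegral_supported _ J); last first.
    by move=> x /(test_fun_eq0 (tphiJ n)) [_ ->]; rewrite mulr0.
  rewrite (@Rintegral_supported _ J) => [e|]; last first.
    by move=> x /(test_fun_eq0 (tphiJ n)) [-> _]; rewrite mulr0.
  have -> : \int[leb]_(x in J) (g x * psi x * chi n x) = \int[leb]_(x in J) (g x * phi n x).
    by apply: eq_Rintegral => x _; rewrite /phi mulrA.
  rewrite -e -RintegralB; last 3 first.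
  - exact: mJ.
  - by apply: iJ => x; apply: cvgM; [exact: cwpsi|case: (cf n) => _; exact].
  - by apply: iJ => x; apply: cvgM; [exact: cwpsi|case: (ch n) => _; exact].
  rewrite -RintegralD; last 3 first.
  - exact: mJ.
  - apply: iJ => x; apply: cvgM; last exact: C1_continuous.
    by apply: cvgM; [exact: cw|exact: cpsi'].
  - apply: iJ => x; apply: cvgB; apply: cvgM.
    + exact: cwpsi.
    + by case: (cf n) => _; exact.
    + exact: cwpsi.
    + by case: (ch n) => _; exact.
  apply: eq_Rintegral => x _; rewrite /phi dphi dchi /wpsi; ring.
have lhs := cvgD l3 (cvgB l1 l2); have rhs := cvgN l4.
have e : \int[leb]_(x in `]0, L[) (w x * derive1 psi x) + (wpsi 0 - wpsi L) =
    - \int[leb]_(x in `]0, L[) (g x * psi x).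
  pose X n : R := - \int[leb]_(x in J) (g x * psi x * chi n x).
  have rhs' : X @ \oo --> - \int[leb]_(x in `]0, L[) (g x * psi x) by exact: rhs.
  pose Y n : R := \int[leb]_(x in J) (w x * derive1 psi x * chi n x) +
   (\int[leb]_(x in J) (wpsi x * derive1 (f n) x) -
    \int[leb]_(x in J) (wpsi x * derive1 (h n) x)).
  have lhs' : Y @ \oo --> \int[leb]_(x in `]0, L[) (w x * derive1 psi x) +
    (wpsi 0 - wpsi L) by exact: lhs.
  have XY : Y = X by apply/funext => n; exact: E.
  rewrite XY in lhs'.
  exact: cvgn_unique lhs' rhs'.
move: e; rewrite /wpsi; lra.
Unshelve. all: by end_near. Qed.

End green_formulas.

Section boundary_value_problem.
Context {R : realType}.
Local Notation leb := (@lebesgue_measure R).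
Variable L : R.
Hypothesis L0 : 0 < L.
Local Notation I := (`]0, L[%classic : set R).

Let mI : measurable I. Proof. exact: measurable_itv. Qed.

Let lebI : leb I = L%:E.
Proof. by rewrite leb_oo ?ltW// subr0. Qed.

Let Ioo : (leb I < +oo)%E. Proof. by rewrite lebI ltry. Qed.

Lemma continuous_L2_I (f : R -> R) : continuous f -> L2 I f.
Proof.
move=> cf; have [M _ HM] := continuous_bounded_segment 0 L cf.
apply: (@bounded_L2 _ _ _ M) => //.
  by apply: measurable_funTS; exact: continuous_measurable_fun.
by move=> x /=; rewrite in_itv/= => /andP[h1 h2]; apply: HM; rewrite !ltW.
Qed.

Lemma weak_derivative_restrict (w g : R -> R) : weak_derivative setT w g ->
  weak_derivative I w g.
Proof.
move=> [Lg wg]; split; first exact: L2S Lg.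
move=> phi tphi; have := wg phi (test_funS (@subsetT _ _) tphi).
rewrite (@Rintegral_supported _ _ I); last first.
  by move=> x /(test_fun_eq0 tphi) [_ ->]; rewrite mulr0.
rewrite (@Rintegral_supported _ (fun x => g x * phi x) I)//.
by move=> x /(test_fun_eq0 tphi) [-> _]; rewrite mulr0.
Qed.

(** Both sides are continuous for the norm of H1, in which test functions are
    dense in H10. *)
Lemma H10_green (v gv psi : R -> R) : H10 I v -> weak_derivative I v gv -> C1 psi ->
  \int[leb]_(x in I) (v x * derive1 psi x) = - \int[leb]_(x in I) (gv x * psi x).
Proof.
move=> [H1v cl] vgv cpsi.
have L2v : L2 I v by case: H1v.
have L2gv : L2 I gv by case: vgv.
have cpsi0 := C1_continuous cpsi; have cpsi' : continuous (derive1 psi) by case: cpsi.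
have L2psi := continuous_L2_I cpsi0; have L2psi' := continuous_L2_I cpsi'.
have [M M0 HM] := continuous_bounded_segment 0 L cpsi0.
have [M' M'0 HM'] := continuous_bounded_segment 0 L cpsi'.
set A := \int[leb]_(x in I) _; set B := \int[leb]_(x in I) _.
apply/eqP; rewrite -addr_eq0 -normr_le0; apply/ler_addgt0Pl => e e0; rewrite addr0.
pose K := (M + M') * ((L + 1) / 2) + 1.
have K0 : 0 < K by rewrite /K ltr_wpDl// mulr_ge0// ?addr_ge0// divr_ge0// addr_ge0// ltW.
pose eta := e / K; have eta0 : 0 < eta by rewrite divr_gt0.
have [phi tphi close] := cl eta eta0.
have [wphi greenphi] := test_fun_weak_derivative L0 tphi.
have [L2phi L2phi'] := test_fun_L2 mI tphi.
have H1phi : H1 I phi by split => //; exists (derive1 phi).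
have H1d : H1 I (v \- phi) by exact: H1B.
have [bd1 bd2] := H1_norm_bounds mI H1d.
have etab : H1_norm I (v \- phi) ^+ 2 <= eta ^+ 2.
  by apply: lerXn2r; [exact: sqrtr_ge0|exact: ltW|exact: ltW].
have wd := wderivP H1d; set dd := wderiv I (v \- phi) in bd2 wd.
have L2d : L2 I (v \- phi) by case: H1d.
have L2dd : L2 I dd by case: wd.
have gvE : {ae leb, forall x, I x -> gv x = derive1 phi x + dd x}.
  apply: (weak_derivative_unique L0 vgv).
  have := weak_derivativeD mI L2phi L2d wphi wd.
  by congr weak_derivative; apply/funext => x /=; rewrite addrC subrK.
have -> : A + B = \int[leb]_(x in I) ((v \- phi) x * derive1 psi x) +
    \int[leb]_(x in I) (dd x * psi x).
  have -> : A = \int[leb]_(x in I) ((v \- phi) x * derive1 psi x) +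
      \int[leb]_(x in I) (phi x * derive1 psi x).
    rewrite -RintegralD//; [|exact: L2_mul|exact: L2_mul].
    by apply: eq_Rintegral => x _ /=; ring.
  have -> : B = \int[leb]_(x in I) (derive1 phi x * psi x) +
      \int[leb]_(x in I) (dd x * psi x).
    rewrite -RintegralD//; [|exact: L2_mul|exact: L2_mul].
    apply: Rintegral_ae_congr; apply: ae_imp gvE => x h Ix.
    by rewrite h// mulrDl.
  by rewrite greenphi//; ring.
have I1 : `|\int[leb]_(x in I) ((v \- phi) x * derive1 psi x)| <=
    M' * (eta * (L + 1) / 2).
  apply: (L2_int_bound mI lebI L2d) => //.
  - by case: L2psi'.
  - by move=> x /=; rewrite in_itv/= => /andP[h1 h2]; apply: HM'; rewrite !ltW.
  - exact: le_trans bd1 etab.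
have I2 : `|\int[leb]_(x in I) (dd x * psi x)| <= M * (eta * (L + 1) / 2).
  apply: (L2_int_bound mI lebI L2dd) => //.
  - by case: L2psi.
  - by move=> x /=; rewrite in_itv/= => /andP[h1 h2]; apply: HM; rewrite !ltW.
  - exact: le_trans bd2 etab.
apply: le_trans (ler_normD _ _) _; apply: le_trans (lerD I1 I2) _.
have -> : M' * (eta * (L + 1) / 2) + M * (eta * (L + 1) / 2) = eta * (K - 1).
  by rewrite /K; field.
have -> : e = eta * K by rewrite /eta divfK// gt_eqF.
by rewrite ler_pM2l// lerBlDr lerDl.
Qed.

Lemma C1_cst1 : C1 (fun _ : R => 1 : R) /\ derive1 (fun _ : R => 1 : R) = (fun=> 0).
Proof.
have e : derive1 (fun _ : R => 1 : R) = (fun=> 0).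
  by apply/funext => x; rewrite derive1E derive_cst.
split; last exact: e; split; first by move=> x; exact: derivable_cst.
by rewrite e => x; exact: cvg_cst.
Qed.

Lemma H10_int_derivative (v gv : R -> R) : H10 I v -> weak_derivative I v gv ->
  \int[leb]_(x in I) gv x = 0.
Proof.
move=> hv vgv; have [c1 d1] := C1_cst1.
have := H10_green hv vgv c1; rewrite d1.
under eq_Rintegral do rewrite mulr0.
rewrite Rintegral_cst// mul0r => /eqP; rewrite eq_sym oppr_eq0 => /eqP.
by under eq_Rintegral do rewrite mulr1.
Qed.

Lemma line_int_derivative (w g : R -> R) : L2 setT w -> continuous w ->
  weak_derivative setT w g -> \int[leb]_(x in I) g x = w L - w 0.
Proof.
move=> hw cw wg; have [c1 d1] := C1_cst1.
have := green_line L0 hw cw wg c1; rewrite d1.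
under eq_Rintegral do rewrite mulr0.
rewrite Rintegral_cst// mul0r !mulr1 => /eqP; rewrite eq_sym subr_eq0 => /eqP ->.
by apply: eq_Rintegral => x _; rewrite mulr1.
Qed.

(** The boundary values enter through [w], whose continuous representative is
    defined on the whole line, and not through traces of [u]. *)
Lemma admissible_green (w u psi : R -> R) : H1 setT w -> continuous w ->
  admissible L w u -> C1 psi ->
  \int[leb]_(x in I) (u x * derive1 psi x) =
  w L * psi L - w 0 * psi 0 - \int[leb]_(x in I) (wderiv I u x * psi x).
Proof.
move=> Hw cw [Hu Huw] cpsi.
have cpsi0 := C1_continuous cpsi; have cpsi' : continuous (derive1 psi) by case: cpsi.
have L2psi := continuous_L2_I cpsi0; have L2psi' := continuous_L2_I cpsi'.
have wg := wderivP Hw; have L2w : L2 setT w by case: Hw.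
have g1 := green_line L0 L2w cw wg cpsi.
have wgI := weak_derivative_restrict wg; have ug := wderivP Hu.
have L2u : L2 I u by case: Hu.
have L2wI : L2 I w by exact: L2S L2w.
have g2 := H10_green Huw (weak_derivativeB mI L2u L2wI ug wgI) cpsi.
have L2g : L2 I (wderiv setT w) by case: wgI.
have L2gu : L2 I (wderiv I u) by case: ug.
have -> : \int[leb]_(x in I) (u x * derive1 psi x) =
    \int[leb]_(x in I) ((u \- w) x * derive1 psi x) +
    \int[leb]_(x in I) (w x * derive1 psi x).
  rewrite -RintegralD//; [|by apply: L2_mul => //; exact: L2B|exact: L2_mul].
  by apply: eq_Rintegral => x _ /=; ring.
rewrite g2 g1.
have -> : \int[leb]_(x in I) ((wderiv I u x - wderiv setT w x) * psi x) =
    \int[leb]_(x in I) (wderiv I u x * psi x) -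
    \int[leb]_(x in I) (wderiv setT w x * psi x).
  rewrite -RintegralB//; [|exact: L2_mul|exact: L2_mul].
  by apply: eq_Rintegral => x _ /=; ring.
by ring.
Qed.

Lemma admissible_int_derivative (w u : R -> R) : H1 setT w -> continuous w ->
  admissible L w u -> \int[leb]_(x in I) wderiv I u x = w L - w 0.
Proof.
move=> Hw cw Hu; have [c1 d1] := C1_cst1.
have := admissible_green Hw cw Hu c1; rewrite d1.
under eq_Rintegral do rewrite mulr0.
rewrite Rintegral_cst// mul0r !mulr1 => /eqP; rewrite eq_sym subr_eq0 => /eqP ->.
by apply: eq_Rintegral => x _; rewrite mulr1.
Qed.

Lemma admissible_perturb (w u phi : R -> R) (s : R) : admissible L w u ->
  test_fun I phi -> admissible L w (fun x => u x + s * phi x) /\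
  {ae leb, forall x, I x -> wderiv I (fun x => u x + s * phi x) x =
    wderiv I u x + s * derive1 phi x}.
Proof.
move=> [Hu [Huw cl]] tphi.
have [wphi _] := test_fun_weak_derivative L0 tphi.
have [L2phi L2phi'] := test_fun_L2 mI tphi.
have L2u : L2 I u by case: Hu.
have wd := weak_derivativeD mI L2u (L2Z s mI L2phi) (wderivP Hu)
  (weak_derivativeZ s mI L2phi wphi).
have Hus : H1 I (fun x => u x + s * phi x).
  by split; [apply: L2D => //; exact: L2Z|eexists; exact: wd].
split; last exact: (weak_derivative_unique L0 (wderivP Hus) wd).
split; first exact: Hus.
split.
  have L2uw : L2 I (u \- w) by case: Huw.
  have -> : ((fun x => u x + s * phi x) \- w) = (fun x => (u \- w) x + s * phi x).
    by apply/funext => x /=; ring.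
  split; first by apply: L2D => //; exact: L2Z.
  eexists; apply: weak_derivativeD (wderivP Huw) (weak_derivativeZ s mI L2phi wphi) => //.
  exact: L2Z.
move=> eta /cl [chi tchi close]; exists (fun x => chi x + s * phi x); last first.
  rewrite (_ : _ \- _ = (u \- w) \- chi)//.
  by apply/funext => x /=; ring.
have cchi := test_fun_C1 tchi; have cphi := test_fun_C1 tphi.
have dM x : is_derive x (1 : R) (fun x => chi x + s * phi x)
    (derive1 chi x + s * derive1 phi x).
  exact: (is_deriveD (C1_is_derive cchi x) (is_deriveZ s (C1_is_derive cphi x))).
have [_ _ [K1 [cK1 K1I K10]]] := tchi; have [_ _ [K2 [cK2 K2I K20]]] := tphi.
split.
- by move=> x; exact: ex_derive.
- have -> : derive1 (fun x => chi x + s * phi x) =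
      (fun x => derive1 chi x + s * derive1 phi x).
    by apply/funext => x; rewrite derive1E; exact: derive_val.
  move=> x; apply: cvgD; first by case: cchi => _; exact.
  by apply: cvgM; [exact: cvg_cst|case: cphi => _; exact].
- exists (K1 `|` K2); split.
  + exact: compactU.
  + by move=> x [/K1I|/K2I].
  + move=> x /= /not_orP[h1 h2]; rewrite K10// K20//.
    by rewrite mulr0 addr0.
Qed.

(** The Euler-Lagrange equation of the elastic problem says that the stress is
    orthogonal to the derivatives of test functions. *)
Lemma stress_constant (w u a : R -> R) : admissible L w u -> Linf I a ->
  (forall v, admissible L w v ->
    \int[leb]_(x in I) (a x * (wderiv I u x) ^+ 2) <=
    \int[leb]_(x in I) (a x * (wderiv I v x) ^+ 2)) ->
  {ae leb, forall x, I x -> a x * wderiv I u x = stress L a u}.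
Proof.
move=> Hu [ma [M aM]] umin.
have [H1u _] := Hu; have [L2g _] := wderivP H1u.
set g := wderiv I u in L2g *.
have ab (h : R -> R) : leb.-integrable I (EFin \o h) ->
    leb.-integrable I (EFin \o (fun x => a x * h x)).
  move=> ih; pose a' x := clip `|M| (a x).
  have aa' : {ae leb, forall x, I x -> a' x * h x = a x * h x}.
    apply: ae_imp aM => x hx Ix; rewrite /a' clip_id//.
    by rewrite (le_trans (hx Ix))// ler_norm.
  have mh : measurable_fun I h by apply/measurable_EFinP; exact: measurable_int ih.
  have ma' : measurable_fun I a' by exact: measurable_clip.
  have i' : leb.-integrable I (EFin \o (fun x => h x * a' x)).
    apply: (@integrable_mul_bounded _ _ R leb h a' `|M|) => // x _.
    exact: clip_bound.
  apply: (@ae_integrable _ _ R leb (fun x => h x * a' x)) => //.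
    exact: measurable_funM.
  by apply: ae_imp aa' => x hx Ix; rewrite mulrC hx.
have [c hc] : exists c, {ae leb, forall x, I x -> a x * g x = c}.
  have iag : leb.-integrable I (EFin \o (fun x => a x * g x)).
    by apply: ab; exact: L2_L1.
  apply: const_of_test_derivative => // phi tphi.
  have [_ L2p] := test_fun_L2 mI tphi.
  pose A := \int[leb]_(x in I) (a x * (g x) ^+ 2).
  pose B := \int[leb]_(x in I) (a x * g x * derive1 phi x).
  pose C := \int[leb]_(x in I) (a x * (derive1 phi x) ^+ 2).
  have quad s : 0 <= 2 * s * B + s ^+ 2 * C.
    have [adm dv] := admissible_perturb s Hu tphi.
    have := umin _ adm.
    have -> : \int[leb]_(x in I) (a x * (wderiv I (fun x => u x + s * phi x) x) ^+ 2) =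
        A + (2 * s * B + s ^+ 2 * C).
      have i1 : leb.-integrable I (EFin \o (fun x => a x * g x ^+ 2)).
        by apply: ab; case: L2g.
      have i2 : leb.-integrable I (EFin \o (fun x => a x * (derive1 phi x) ^+ 2)).
        by apply: ab; case: L2p.
      have i3 : leb.-integrable I (EFin \o (fun x => a x * g x * derive1 phi x)).
        have := ab _ (L2_mul mI L2g L2p).
        by congr (leb.-integrable I _); apply/funext => x /=; rewrite mulrA.
      rewrite /A /B /C -RintegralZl// -[_ ^+ 2 * _]RintegralZl//.
      rewrite -[X in _ + X]RintegralD//; [|exact: integrableZ_EFin|exact: integrableZ_EFin].
      rewrite -RintegralD//; last first.
        by apply: integrableD_EFin => //; exact: integrableZ_EFin.
      by apply: Rintegral_ae_congr; apply: ae_imp dv => x hx Ix; rewrite hx// -/g; ring.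
    by rewrite -/A lerDl.
  rewrite -/B; apply/eqP; apply/negPn/negP => B0.
  (* If B were nonzero, the quadratic would be negative at s = - B / K. *)
  pose K := `|C| + 1; have K0 : 0 < K by rewrite ltr_wpDl.
  have := quad (- B / K); have CK : C <= K by rewrite (le_trans (ler_norm C))// lerDl.
  have -> : 2 * (- B / K) * B + (- B / K) ^+ 2 * C = (B / K) ^+ 2 * (C - 2 * K).
    by field; rewrite gt_eqF.
  rewrite pmulr_rge0; last by rewrite exprn_even_gt0//= mulf_neq0// invr_neq0// gt_eqF.
  by lra.
rewrite /stress -/g; apply: (@xgetPex _ 0 [set c | {ae leb, forall x, I x -> a x * g x = c}]).
by exists c.
Qed.

End boundary_value_problem.

(** * Damage evolutions at a fixed parameter *)

Section damage_at_fixed_eps.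
Context {R : realType}.
Local Notation leb := (@lebesgue_measure R).
Variables (L T kappa a0 a1 eps : R) (w wdot u Theta a : R -> R -> R).
Hypotheses (L0 : 0 < L) (T0 : 0 < T) (kappa0 : 0 < kappa) (a00 : 0 < a0) (a10 : 0 < a1).
Hypotheses (eps0 : 0 < eps) (epsa : eps * a0 < a1).
Hypothesis Hw : forall t, 0 <= t <= T -> H1 setT (w t) /\ continuous (w t).
Hypothesis Hwdot : forall t, 0 <= t <= T -> H1 setT (wdot t).
Hypothesis evol : brittle_damage_evolution L T kappa a0 a1 w wdot eps u Theta a.
Local Notation I := (`]0, L[%classic : set R).
Local Notation dx := (wderiv I).

Let mI : measurable I. Proof. exact: measurable_itv. Qed.

Let lebI : leb I = L%:E.
Proof. by rewrite leb_oo ?ltW// subr0. Qed.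

Let Ioo : (leb I < +oo)%E. Proof. by rewrite lebI ltry. Qed.

Definition sig (t : R) : R := stress L (a t) (u t).

Definition mass (t : R) : R := \int[leb]_(x in I) ((1 - Theta t x) / eps).

Lemma bounded_integrable (f : R -> R) (M : R) : measurable_fun I f ->
  (forall x, I x -> `|f x| <= M) -> leb.-integrable I (EFin \o f).
Proof.
move=> mf fM; apply: (@le_integrable_leb _ _ (fun=> M)) => //.
exact: integrable_cst_bounded.
Qed.

(** The damage field satisfies its bounds almost everywhere; the truncated field
    satisfies them everywhere, and is easier to integrate. *)
Lemma Theta_representative t : 0 <= t <= T -> exists th : R -> R,
  [/\ measurable_fun I th, forall x, 0 <= th x <= 1 &
      {ae leb, forall x, I x -> Theta t x = th x}].
Proof.
move=> tT; have [_ H _ _ _] := evol; have [_ [mTh Th01] _ _] := H t tT.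
exists (fun x => Num.max 0 (Num.min (Theta t x) 1)); split.
- have -> : (fun x => Num.max 0 (Num.min (Theta t x) 1)) =
      (fun x => 2^-1 * (clip 1 (2 * Theta t x - 1) + 1)).
    apply/funext => x; rewrite /clip.
    by case: (leP (2 * Theta t x - 1) 1) => ?; case: (leP (Theta t x) 1) => ?;
      case: (leP (-1) _) => ?; case: (leP 0 _) => ?; lra.
  apply: measurable_funM => //; apply: measurable_funD => //.
  by apply: measurable_clip; apply: measurable_funB => //; exact: measurable_funM.
- by move=> x; rewrite le_max lexx/= ge_max ler01 ge_min lexx orbT.
- apply: ae_imp Th01 => x h Ix; have /andP[h1 h2] := h Ix.
  by rewrite (min_idPl h2) (max_idPr h1).
Qed.

(** One-sided minimality with [theta = 0] is elastic minimality. *)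
Lemma sigE t : 0 <= t <= T -> {ae leb, forall x, I x -> a t x * dx (u t) x = sig t}.
Proof.
move=> tT; have [_ H _ _ [osm _]] := evol; have [adm _ Lina _] := H t tT.
apply: (stress_constant L0 adm Lina) => v admv.
have th0 : Linf01 I (fun _ : R => 0 : R).
  by split => //; apply: aeW => x _; rewrite lexx ler01.
have := osm t v (fun=> 0) tT admv th0.
have -> : \int[leb]_(x in I) (eps * a0 * a t x /
    (0 * a t x + (1 - 0) * (eps * a0)) * (dx v x) ^+ 2) =
    \int[leb]_(x in I) (a t x * (dx v x) ^+ 2).
  apply: eq_Rintegral => x _; congr (_ * _).
  by field; rewrite !gt_eqF.
have -> : \int[leb]_(x in I) ((fun=> 0) x * Theta t x : R) = 0.
  by under eq_Rintegral do rewrite mul0r; rewrite Rintegral_cst// mul0r.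
by rewrite mulr0 addr0 ler_pM2l.
Qed.

Lemma strainE t : 0 <= t <= T -> {ae leb, forall x, I x ->
  dx (u t) x = sig t * ((1 - Theta t x) / eps / a0 + Theta t x / a1)}.
Proof.
move=> tT; have [_ H _ _ _] := evol; have [_ [_ Th01] _ aE] := H t tT.
apply: ae_imp3 Th01 aE (sigE tT) => x h1 h2 h3 Ix.
have {h1}/andP[t0 t1] := h1 Ix; have {}h2 := h2 Ix; have {}h3 := h3 Ix.
have kE : (1 - Theta t x) / (eps * a0) + Theta t x / a1 =
    (1 - Theta t x) / eps / a0 + Theta t x / a1.
  by field; rewrite !gt_eqF.
have k0 : 0 < (1 - Theta t x) / eps / a0 + Theta t x / a1.
  have [t1'|t1'] := ltP (Theta t x) 1.
    apply: ltr_pwDl; first by rewrite !divr_gt0// subr_gt0.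
    by rewrite divr_ge0// ltW.
  apply: ltr_wpDl.
    by apply: divr_ge0; [apply: divr_ge0; [rewrite subr_ge0|exact: ltW]|exact: ltW].
  by rewrite divr_gt0// (lt_le_trans ltr01).
by rewrite -h3 h2 kE mulrAC mulVf ?mul1r// gt_eqF.
Qed.

Lemma ThetaL t : 0 <= t <= T -> L2 I (Theta t) /\ L2 I (fun x => (1 - Theta t x) / eps).
Proof.
move=> tT; have [th [mth th01 thE]] := Theta_representative tT.
have [_ H _ _ _] := evol; have [_ [mTh _] _ _] := H t tT.
have sq (f g : R -> R) (M : R) : measurable_fun I f -> measurable_fun I g ->
    (forall x, `|g x| <= M) -> {ae leb, forall x, I x -> f x = g x} -> L2 I f.
  move=> mf mg gM fg; split => //.
  apply: (@ae_integrable _ _ R leb (fun x => g x ^+ 2)) => //.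
  - exact: measurable_funX.
  - by apply: ae_imp fg => x h Ix; rewrite h.
  - by have [] := @bounded_L2 _ I g M mI Ioo mg (fun x _ => gM x).
split; first by apply: (sq _ th 1) => // x; have /andP[h1 h2] := th01 x; rewrite ger0_norm.
apply: (sq _ (fun x => (1 - th x) / eps) (eps^-1)) => //.
- by apply: measurable_funM => //; exact: measurable_funB.
- by apply: measurable_funM => //; exact: measurable_funB.
- move=> x; have /andP[h1 h2] := th01 x.
  rewrite ger0_norm ?divr_ge0 ?subr_ge0//; last exact: ltW.
  by apply: ler_piMl; [rewrite invr_ge0 ltW|lra].
- by apply: ae_imp thE => x h Ix; rewrite h.
Qed.

(** The strain splits into an elastic part carried by the sound material and a
    part proportional to the damage measure; these are the quantities whose
    limits are [e] and [p]. *)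
Lemma green_eps t psi : 0 <= t <= T -> C1 psi ->
  \int[leb]_(x in I) (u t x * derive1 psi x) =
  w t L * psi L - w t 0 * psi 0 -
  (\int[leb]_(x in I) (sig t / a1 * Theta t x * psi x) +
   \int[leb]_(x in I) (psi x * (sig t / a0 * ((1 - Theta t x) / eps)))).
Proof.
move=> tT cpsi; have [Hwt cwt] := Hw tT.
have [_ H _ _ _] := evol; have [adm _ _ _] := H t tT.
rewrite (admissible_green L0 Hwt cwt adm cpsi); congr (_ - _).
have L2psi := continuous_L2_I L0 (C1_continuous cpsi).
have [L2T L2m] := ThetaL tT.
rewrite -RintegralD//.
- by apply: Rintegral_ae_congr; apply: ae_imp (strainE tT) => x h Ix; rewrite h//; ring.
- by apply: L2_mul => //; exact: L2Z.
- by apply: L2_mul => //; exact: L2Z.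
Qed.

Lemma mass_ge0 t : 0 <= t <= T -> 0 <= mass t /\
  \int[leb]_(x in I) Theta t x = L - eps * mass t.
Proof.
move=> tT; have [L2T L2m] := ThetaL tT.
have [th [mth th01 thE]] := Theta_representative tT.
split.
  rewrite /mass (@Rintegral_ae_congr _ _ _ leb _ (fun x => (1 - th x) / eps)).
    apply: Rintegral_ge0 => x _; have /andP[h1 h2] := th01 x.
    by rewrite divr_ge0 ?subr_ge0// ltW.
  by apply: ae_imp thE => x h Ix; rewrite h.
rewrite /mass -RintegralZl//; last exact: L2_L1.
have e1 : \int[leb]_(x in I) (1 : R) = L by rewrite (Rintegral_cst_leb _ mI lebI) mul1r.
rewrite -[X in _ = X - _]e1 -RintegralB//.
- by apply: eq_Rintegral => x _; field; rewrite gt_eqF.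
- exact: integrable_cst_bounded.
- by apply: integrableZ_EFin => //; exact: L2_L1.
Qed.

(** Integrate the strain over the bar: the total elongation is the jump of the
    boundary datum. *)
Lemma sig_compliance t : 0 <= t <= T ->
  sig t * (mass t / a0 + (L - eps * mass t) / a1) = boundary_jump L (w t).
Proof.
move=> tT; have [Hwt cwt] := Hw tT.
have [_ H _ _ _] := evol; have [adm _ _ _] := H t tT.
rewrite /boundary_jump -(admissible_int_derivative L0 Hwt cwt adm).
have [L2T L2m] := ThetaL tT; have iT := L2_L1 mI Ioo L2T; have im := L2_L1 mI Ioo L2m.
rewrite (@Rintegral_ae_congr _ _ _ leb _ (fun x => sig t / a0 * ((1 - Theta t x) / eps)
   + sig t / a1 * Theta t x)); last first.
  by apply: ae_imp (strainE tT) => x h Ix; rewrite h//; ring.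
rewrite RintegralD//; [|exact: integrableZ_EFin|exact: integrableZ_EFin].
rewrite !RintegralZl// (mass_ge0 tT).2 -/(mass t).
by ring.
Qed.

Lemma compliance_ge t : 0 <= t <= T ->
  L / a1 <= mass t / a0 + (L - eps * mass t) / a1.
Proof.
move=> tT; have [m0 _] := mass_ge0 tT.
rewrite -subr_ge0; have -> : mass t / a0 + (L - eps * mass t) / a1 - L / a1 =
    mass t * (a1 - eps * a0) / (a0 * a1) by field; rewrite !gt_eqF.
apply: divr_ge0; last by apply: mulr_ge0; exact: ltW.
by apply: mulr_ge0 => //; rewrite subr_ge0 ltW.
Qed.

Lemma sig_bound t : 0 <= t <= T ->
  `|sig t| <= a1 / L * `|boundary_jump L (w t)|.
Proof.
move=> tT; rewrite -(sig_compliance tT) normrM.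
have cge := compliance_ge tT; set c := _ + _ / a1 in cge *.
have c0 : 0 < c by apply: lt_le_trans cge; rewrite divr_gt0.
rewrite (gtr0_norm c0) mulrCA ler_peMr//.
by rewrite -ler_pdivrMl ?divr_gt0// invf_div mulr1.
Qed.

(** Monotonicity of damage, in the weighted form that survives weak-star limits. *)
Lemma mass_nd (psi : R -> R) (M : R) s t : 0 <= s -> s <= t -> t <= T ->
  measurable_fun I psi -> (forall x, I x -> 0 <= psi x <= M) ->
  \int[leb]_(x in I) (psi x * ((1 - Theta s x) / eps)) <=
  \int[leb]_(x in I) (psi x * ((1 - Theta t x) / eps)).
Proof.
move=> s0 st tT mpsi psi0.
have sT : 0 <= s <= T by rewrite s0 (le_trans st).
have t0T : 0 <= t <= T by rewrite tT (le_trans s0).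
have [ths [mths ths01 thsE]] := Theta_representative sT.
have [tht [mtht tht01 thtE]] := Theta_representative t0T.
have [_ _ _ mono _] := evol.
have L2psi : L2 I psi.
  by apply: (@bounded_L2 _ _ _ M) => // x Ix; have /andP[h1 h2] := psi0 x Ix; rewrite ger0_norm.
have [_ L2s] := ThetaL sT; have [_ L2t] := ThetaL t0T.
rewrite -subr_ge0 -RintegralB//; [|exact: L2_mul|exact: L2_mul].
rewrite (@Rintegral_ae_congr _ _ _ leb _ (fun x => `|psi x * ((Theta s x - Theta t x) / eps)|)).
  by apply: Rintegral_ge0 => x _.
apply: ae_imp (mono s t s0 st tT) => x h Ix; have {h}[_ h] := h Ix.
have /andP[p0 _] := psi0 x Ix.
rewrite ger0_norm; last by rewrite mulr_ge0// divr_ge0 ?subr_ge0// ltW.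
by field; rewrite gt_eqF.
Qed.

Lemma mass_monotone s t : 0 <= s -> s <= t -> t <= T -> mass s <= mass t.
Proof.
move=> s0 st tT; have := @mass_nd (fun=> 1) 1 s t s0 st tT.
under eq_Rintegral do rewrite mul1r.
under [X in _ -> _ -> _ <= X]eq_Rintegral do rewrite mul1r.
by apply => // x _; rewrite ler01 lexx.
Qed.

Lemma energy_eps t : 0 <= t <= T ->
  damage_energy L kappa eps (a t) (u t) (Theta t) =
  2^-1 * (sig t * boundary_jump L (w t)) + kappa * mass t.
Proof.
move=> tT; have [Hwt cwt] := Hw tT.
have [_ H _ _ _] := evol; have [adm _ _ _] := H t tT.
have [_ L2m] := ThetaL tT.
have L2g : L2 I (dx (u t)) by have [/wderivP [] ] := adm.
rewrite /damage_energy /boundary_jump -(admissible_int_derivative L0 Hwt cwt adm).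
congr (_ * _ + _).
  rewrite -RintegralZl//; last exact: L2_L1.
  apply: Rintegral_ae_congr; apply: ae_imp (sigE tT) => x h Ix.
  by rewrite -h//; ring.
rewrite -mulrA; congr (_ * _); rewrite /mass.
have im : leb.-integrable I (EFin \o (fun x => 1 - Theta t x)).
  apply: integrableB_EFin => //; first exact: integrable_cst_bounded.
  by apply: L2_L1 => //; have [] := ThetaL tT.
by rewrite RintegralZr// mulrC.
Qed.

(** The derivative of the boundary jump, written so that it is defined for every
    time at which [wdot] is in H1. *)
Definition jump_rate (t : R) : R := \int[leb]_(x in I) wderiv setT (wdot t) x.

Lemma work_eps t : 0 <= t <= T ->
  external_work L wdot (fun s x => a s x * dx (u s) x) t =
  \int[leb]_(s in `[0, t]) (sig s * jump_rate s).
Proof.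
move=> /andP[t0 tT]; apply: eq_Rintegral => s; rewrite inE/= in_itv/= => /andP[s0 st].
have sT : 0 <= s <= T by rewrite s0 (le_trans st).
have L2d : L2 I (wderiv setT (wdot s)).
  by have [L2d _] := wderivP (Hwdot sT); exact: L2S L2d.
rewrite /jump_rate -RintegralZl//; last exact: L2_L1.
apply: Rintegral_ae_congr; apply: ae_imp (sigE sT) => x h Ix.
by rewrite h.
Qed.

Lemma energy_balance_eps t : 0 <= t <= T ->
  2^-1 * (sig t * boundary_jump L (w t)) + kappa * mass t =
  2^-1 * (sig 0 * boundary_jump L (w 0)) + kappa * mass 0 +
  \int[leb]_(s in `[0, t]) (sig s * jump_rate s).
Proof.
move=> tT; have [_ _ _ _ [_ EB]] := evol.
have z : 0 <= (0 : R) <= T by rewrite lexx ltW.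
by rewrite -work_eps// -!energy_eps//; exact: EB.
Qed.

(** Keep the displacement and lower the damaged fraction by a factor [1 - r].
    The saving in surface energy is [r * kappa * mass], the cost in elastic energy
    is at most [sigma ^+ 2 * mass * r / (2 * a0 * (1 - r))]; minimality at the
    initial time compares the two as [r] tends to zero. *)
Lemma initial_yield : 0 < mass 0 -> 2 * kappa * a0 <= sig 0 ^+ 2.
Proof.
move=> m0; have z : 0 <= (0 : R) <= T by rewrite lexx ltW.
have [_ H ini _ _] := evol; have [adm [mTh Th01] _ aE] := H 0 z.
have [th [mth th01 thE]] := Theta_representative z.
pose D x := 1 - th x; pose b := (eps * a0)^-1 - a1^-1; pose s := sig 0.
have mD : measurable_fun I D by exact: measurable_funB.
have D01 x : 0 <= D x <= 1 by rewrite /D; have := th01 x => /andP[? ?]; apply/andP; split; lra.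
have b0 : 0 < b by rewrite /b subr_gt0 ltf_pV2// posrE ?mulr_gt0.
have a1V : 0 < a1^-1 by rewrite invr_gt0.
pose A x := D x * b + a1^-1.
have A0 x : a1^-1 <= A x.
  by rewrite /A lerDr; apply: mulr_ge0; [have /andP[] := D01 x|exact: ltW].
pose d := \int[leb]_(x in I) D x.
have md : mass 0 = d / eps.
  rewrite /mass /d -RintegralZr//; last first.
    apply: (@bounded_integrable _ 1) => // x _.
    by have /andP[h1 h2] := D01 x; rewrite ger0_norm.
  by apply: Rintegral_ae_congr; apply: ae_imp thE => x h Ix; rewrite h.
have d0 : 0 < d by move: m0; rewrite md pmulr_lgt0// invr_gt0.
have iD : leb.-integrable I (EFin \o D).
  by apply: (@bounded_integrable _ 1) => // x _; have /andP[h1 h2] := D01 x; rewrite ger0_norm.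
have key r : 0 < r -> r < 1 -> kappa / eps * (1 - r) <= 2^-1 * s ^+ 2 * b.
  move=> r0 r1; have r1' : 0 < 1 - r by rewrite subr_gt0.
  pose th' x := (1 - r) * D x.
  have th'P : Linf01 I th'.
    split; first exact: measurable_funM.
    apply: aeW => x _; have /andP[h1 h2] := D01 x.
    by rewrite /th' mulr_ge0 ?(ltW r1')//= mulr_ile1// ?(ltW r1')//; lra.
  have := ini (u 0) th' adm th'P.
  have -> : \int[leb]_(x in I) (2^-1 * a 0 x * (dx (u 0) x) ^+ 2 +
      kappa / eps * (1 - Theta 0 x)) =
      \int[leb]_(x in I) (2^-1 * s ^+ 2 / a1 + (2^-1 * s ^+ 2 * b + kappa / eps) * D x).
    apply: Rintegral_ae_congr; apply: ae_imp3 (strainE z) (sigE z) thE => x h1 h2 h3 Ix.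
    have {}h2 := h2 Ix; have {}h1 := h1 Ix; have {}h3 := h3 Ix.
    transitivity (2^-1 * (a 0 x * dx (u 0) x) * dx (u 0) x + kappa / eps * (1 - Theta 0 x)).
      by ring.
    rewrite h2 h1 h3 -/s /D /b.
    by field; rewrite !gt_eqF.
  have -> : \int[leb]_(x in I) (2^-1 * (eps * a0 * a1 / (th' x * a1 + (1 - th' x) * (eps * a0))) *
      (dx (u 0) x) ^+ 2 + kappa / eps * th' x) =
      \int[leb]_(x in I) (2^-1 * s ^+ 2 * (A x ^+ 2 / (A x - r * D x * b)) +
        kappa / eps * (1 - r) * D x).
    apply: Rintegral_ae_congr; apply: ae_imp2 (strainE z) thE => x h1 h3 Ix.
    have {}h1 := h1 Ix; have {}h3 := h3 Ix.
    have -> : dx (u 0) x = s * A x.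
      by rewrite h1 h3 -/s /A /D /b; field; rewrite !gt_eqF.
    have den : A x - r * D x * b = (th' x * a1 + (1 - th' x) * (eps * a0)) / (eps * a0 * a1).
      by rewrite /A /th' /b; field; rewrite !gt_eqF.
    rewrite den invf_div exprMn /th'; ring.
  have quot x : A x ^+ 2 / (A x - r * D x * b) <= A x + r / (1 - r) * D x * b.
    have Ax := A0 x; have /andP[D0 _] := D01 x.
    have Db : 0 <= D x * b by rewrite mulr_ge0// ltW.
    have den0 : 0 < A x - r * D x * b.
      have -> : A x - r * D x * b = (1 - r) * (D x * b) + a1^-1 by rewrite /A; ring.
      by rewrite ltr_wpDl//; apply: mulr_ge0 => //; exact: ltW.
    rewrite ler_pdivrMr// -subr_ge0.
    have -> : (A x + r / (1 - r) * D x * b) * (A x - r * D x * b) - A x ^+ 2 =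
        r ^+ 2 / (1 - r) * (D x * b) * (A x - D x * b).
      by field; rewrite gt_eqF.
    have AD : 0 <= A x - D x * b.
      have -> : A x - D x * b = a1^-1 by rewrite /A; ring.
      exact: ltW.
    apply: mulr_ge0 => //; apply: mulr_ge0 => //.
    by apply: divr_ge0; [exact: sqr_ge0|exact: ltW].
  have quot0 x : 0 <= A x ^+ 2 / (A x - r * D x * b).
    have Ax := A0 x; have /andP[D0 _] := D01 x.
    have Db : 0 <= D x * b by rewrite mulr_ge0// ltW.
    rewrite divr_ge0 ?sqr_ge0//.
    have -> : A x - r * D x * b = (1 - r) * (D x * b) + a1^-1 by rewrite /A; ring.
    by rewrite addr_ge0//; [apply: mulr_ge0 => //; exact: ltW|exact: ltW].
  have mA : measurable_fun I A.
    by apply: measurable_funD => //; exact: measurable_funM.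
  have inv_meas (f : R -> R) (c : R) : 0 < c -> (forall x, c <= f x) ->
      measurable_fun I f -> measurable_fun I (fun x => (f x)^-1).
    move=> c0 fc mf.
    have -> : (fun x => (f x)^-1) = (fun y => (Num.max c y)^-1) \o f.
      by apply/funext => x /=; rewrite (max_idPr (fc x)).
    apply: (@measurableT_comp _ _ _ _ _ _ (fun y => (Num.max c y)^-1)) mf.
    have nd : measurable_fun [set: R] (fun y => - (Num.max c y)^-1).
      apply: nondecreasing_measurable => // x y xy.
      have cx : 0 < Num.max c x by rewrite lt_max c0.
      have cy : 0 < Num.max c y by rewrite lt_max c0.
      by rewrite lerN2 lef_pV2 ?posrE// ge_max !le_max lexx xy orbT.
    rewrite (_ : (fun y => _) = (fun y => - - (Num.max c y)^-1)).
      exact: measurable_funN nd.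
    by apply/funext => y; rewrite opprK.
  have den1 x : a1^-1 <= A x - r * D x * b.
    have -> : A x - r * D x * b = (1 - r) * (D x * b) + a1^-1 by rewrite /A; ring.
    have /andP[D0 _] := D01 x.
    by rewrite lerDr; apply: mulr_ge0; [exact: ltW|apply: mulr_ge0 => //; exact: ltW].
  have mq : measurable_fun I (fun x => A x ^+ 2 / (A x - r * D x * b)).
    apply: measurable_funM; first exact: measurable_funX.
    apply: (inv_meas _ a1^-1) => //.
    apply: measurable_funB => //; apply: measurable_funM => //.
    exact: measurable_funM.
  have ibound : leb.-integrable I (EFin \o (fun x => A x + r / (1 - r) * D x * b)).
    apply: integrableD_EFin => //.
      apply: integrableD_EFin => //; last exact: integrable_cst_bounded.
      under [X in EFin \o X]eq_fun do rewrite mulrC.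
      exact: integrableZ_EFin.
    rewrite (_ : (fun x => _) = (fun x => (r / (1 - r) * b) * D x)); last first.
      by apply/funext => x; ring.
    exact: integrableZ_EFin.
  have iq : leb.-integrable I (EFin \o (fun x => A x ^+ 2 / (A x - r * D x * b))).
    apply: (@le_integrable_leb _ _ (fun x => A x + r / (1 - r) * D x * b)) => //.
    by move=> x _; rewrite ger0_norm.
  have ic (c : R) : leb.-integrable I (EFin \o (fun=> c)) by exact: integrable_cst_bounded.
  have iDc (c : R) : leb.-integrable I (EFin \o (fun x => c * D x)) by exact: integrableZ_EFin.
  have s2 : 0 <= 2^-1 * s ^+ 2 by rewrite mulr_ge0 ?sqr_ge0// invr_ge0.
  have step : \int[leb]_(x in I) (2^-1 * s ^+ 2 * (A x ^+ 2 / (A x - r * D x * b)) +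
        kappa / eps * (1 - r) * D x) <=
      \int[leb]_(x in I) (2^-1 * s ^+ 2 / a1 +
        (2^-1 * s ^+ 2 * b + 2^-1 * s ^+ 2 * b * (r / (1 - r)) + kappa / eps * (1 - r)) * D x).
    apply: le_Rintegral => //.
    - by apply: integrableD_EFin => //; exact: integrableZ_EFin.
    - exact: integrableD_EFin.
    - move=> x _; have h := ler_wpM2l s2 (quot x).
      apply: (@le_trans _ _ (2^-1 * s ^+ 2 * (A x + r / (1 - r) * D x * b) +
        kappa / eps * (1 - r) * D x)); first by rewrite lerD2r.
      by rewrite le_eqVlt; apply/orP; left; apply/eqP; rewrite /A; ring.
  move=> /le_trans /(_ step).
  rewrite !RintegralD// !RintegralZl// -/d lerD2l ler_pM2r// => h.
  have h' : kappa / eps * r <= 2^-1 * s ^+ 2 * b * (r / (1 - r)) by lra.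
  rewrite -(@ler_pM2r _ (r / (1 - r))) ?divr_gt0//.
  apply: le_trans h'; rewrite le_eqVlt; apply/orP; left; apply/eqP.
  by field; rewrite !gt_eqF.
have key0 : kappa / eps <= 2^-1 * s ^+ 2 * b.
  apply/ler_addgt0Pl => e e0.
  pose r := Num.min 2^-1 (e / (kappa / eps)).
  have ke : 0 < kappa / eps by rewrite divr_gt0.
  have r0 : 0 < r by rewrite lt_min invr_gt0 ltr0n/= divr_gt0.
  have r1 : r < 1 by rewrite gt_min invf_lt1 ?ltr1n.
  have re : kappa / eps * r <= e.
    by rewrite mulrC -ler_pdivlMr// ge_min lexx orbT.
  by have := key r r0 r1; lra.
have bE : b <= (eps * a0)^-1 by rewrite /b gerBl ltW.
have key1 : kappa / eps <= 2^-1 * s ^+ 2 * (eps * a0)^-1.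
  by apply: le_trans key0 _; apply: ler_wpM2l => //; rewrite mulr_ge0 ?sqr_ge0// invr_ge0.
have -> : 2 * kappa * a0 = kappa / eps * (2 * (eps * a0)) by field; rewrite gt_eqF.
apply: (@le_trans _ _ (2^-1 * s ^+ 2 * (eps * a0)^-1 * (2 * (eps * a0)))).
  by apply: ler_wpM2r => //; apply: mulr_ge0 => //; apply: mulr_ge0; exact: ltW.
rewrite le_eqVlt; apply/orP; left; apply/eqP; rewrite -/s.
by field; rewrite !gt_eqF.
Qed.

End damage_at_fixed_eps.

(** * The boundary jump as a function of time *)

Section boundary_jump_in_time.
Context {R : realType}.
Local Notation leb := (@lebesgue_measure R).
Variables (L T : R) (w wdot : R -> R -> R).
Hypotheses (L0 : 0 < L) (T0 : 0 < T).
Local Notation I := (`]0, L[%classic : set R).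

Let mI : measurable I. Proof. exact: measurable_itv. Qed.

Let lebI : leb I = L%:E.
Proof. by rewrite leb_oo ?ltW// subr0. Qed.

(** Continuity of the boundary jump in the norm of H1, through the integral of
    the derivative. *)
Lemma int_wderiv_bound (r : R -> R) : H1 setT r ->
  `|\int[leb]_(x in I) wderiv setT r x| <= H1_norm setT r * ((L + 1) / 2).
Proof.
move=> Hr; have [_ b2] := H1_norm_bounds measurableT Hr.
have [L2g _] := wderivP Hr; have L2gI : L2 I (wderiv setT r) by exact: L2S L2g.
have n0 : 0 <= H1_norm setT r by exact: sqrtr_ge0.
have C0 : 0 < (L + 1) / 2 by rewrite divr_gt0// addr_gt0.
apply/ler_addgt0Pl => e e0.
(* The slack makes eta positive even when the norm vanishes. *)
pose eta := H1_norm setT r + e / ((L + 1) / 2).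
have eta0 : 0 < eta by rewrite ltr_wpDl// divr_gt0.
have le2 : \int[leb]_(x in I) (wderiv setT r x ^+ 2) <= eta ^+ 2.
  apply: (@le_trans _ _ (\int[leb]_x (wderiv setT r x ^+ 2))).
    apply: ge0_subset_Rintegral => //; first by move=> x _; exact: sqr_ge0.
    by case: L2g.
  apply: le_trans b2 _; apply: lerXn2r; [exact: n0|exact: ltW|].
  by rewrite lerDl divr_ge0// ltW.
have := @L2_int_bound _ I (wderiv setT r) (fun=> 1) eta L 1 mI lebI L2gI.
have -> : \int[leb]_(x in I) (wderiv setT r x * (fun=> 1) x) =
    \int[leb]_(x in I) wderiv setT r x.
  by apply: eq_Rintegral => x _; rewrite mulr1.
move=> h; apply: le_trans (h _ _ _ eta0 le2) _ => //.
- by move=> x _; rewrite normr1.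
- rewrite mul1r le_eqVlt; apply/orP; left; apply/eqP; rewrite /eta.
  by field; rewrite gt_eqF// addr_gt0.
Qed.

Lemma jump_bound (v : R -> R) : H1 setT v -> continuous v ->
  `|boundary_jump L v| <= H1_norm setT v * ((L + 1) / 2).
Proof.
move=> Hv cv; have L2v : L2 setT v by case: Hv.
rewrite /boundary_jump -(line_int_derivative L0 L2v cv (wderivP Hv)).
exact: int_wderiv_bound.
Qed.

(** The jump is a bounded linear functional on H1. *)
Lemma jump_AC : AC_H1 T w -> abs_continuous T real_dist (fun t => boundary_jump L (w t)).
Proof.
move=> [Hw wAC] eta eta0.
have C0 : 0 < (L + 1) / 2 by rewrite divr_gt0// addr_gt0.
have [delta d0 H] := wAC (eta / ((L + 1) / 2)) (divr_gt0 eta0 C0).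
exists delta => // n a b ab disj small; have := H n a b ab disj small.
rewrite /H1_dist /real_dist !sumEFin !lte_fin => h.
apply: (@le_lt_trans _ _ ((\sum_(i < n) H1_norm setT (w (a i) \- w (b i))) * ((L + 1) / 2))).
  rewrite mulr_suml; apply: ler_sum => i _.
  have [a0 aib bT] := ab i (ltn_ord i).
  have [Ha ca] := Hw (a i) (ltac:(by rewrite a0 (le_trans aib))).
  have [Hb cb] := Hw (b i) (ltac:(by rewrite bT (le_trans a0))).
  have cab : continuous (w (a i) \- w (b i)) by move=> x; apply: cvgB; [exact: ca|exact: cb].
  apply: le_trans (jump_bound (H1B measurableT Ha Hb) cab).
  rewrite le_eqVlt; apply/orP; left; apply/eqP; congr (`|_|).
  by rewrite /boundary_jump /=; ring.
by rewrite -ltr_pdivlMr.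
Qed.

(** A bounded linear functional maps the difference quotients of [w], which
    converge in H1, to convergent difference quotients. *)
Lemma jump_derivative : AC_H1 T w -> H1_time_derivative T w wdot ->
  {ae leb, forall t, 0 < t < T ->
   (fun h : R => h^-1 * (boundary_jump L (w (t + h)) - boundary_jump L (w t))) @ 0^' -->
   jump_rate L wdot t}.
Proof.
move=> [Hw _] [Hd _ ae_d]; apply: ae_imp ae_d => t cv t0T.
have {}cv := cv t0T; have /andP[t0 tT] := t0T.
have C0 : 0 < (L + 1) / 2 by rewrite divr_gt0// addr_gt0.
have tT' : 0 <= t <= T by rewrite !ltW.
have Hdt := Hd t tT'; have [Hwt cwt] := Hw t tT'.
apply/cvgrPdist_le => e e0.
have eC : 0 < e / ((L + 1) / 2) by rewrite divr_gt0.
have close := (@cvgrPdist_le _ _ _ _ _ _ _).1 cv _ eC.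
near=> h.
have hclose : `|0 - H1_norm setT (fun x => h^-1 * (w (t + h) x - w t x) - wdot t x)| <=
    e / ((L + 1) / 2).
  near: h; exact: close.
have hne : h != 0 by near: h; exact: nbhs_dnbhs_neq.
have ht : `|h| < Num.min t (T - t).
  near: h; apply: dnbhs0_lt; by rewrite lt_min t0 subr_gt0.
move: ht; rewrite lt_min => /andP[ht hT].
have thT : 0 <= t + h <= T.
  by move: ht hT; rewrite !ltr_norml => /andP[? ?] /andP[? ?]; apply/andP; split; lra.
have [Hwh cwh] := Hw _ thT.
have L2wh : L2 setT (w (t + h)) by case: Hwh.
have L2wt : L2 setT (w t) by case: Hwt.
have L2dt : L2 setT (wdot t) by case: Hdt.
pose q x := h^-1 * (w (t + h) x - w t x).
have L2q : L2 setT q by apply: L2Z => //; exact: L2B.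
have wq : weak_derivative setT q
    (fun x => h^-1 * (wderiv setT (w (t + h)) x - wderiv setT (w t) x)).
  apply: weak_derivativeZ => //; first exact: L2B.
  by apply: weak_derivativeB => //; exact: wderivP.
have Hq : H1 setT q by split => //; eexists; exact: wq.
have cq : continuous q.
  by move=> x; apply: cvgM; [exact: cvg_cst|apply: cvgB; [exact: cwh|exact: cwt]].
have Hr : H1 setT (q \- wdot t) by exact: H1B.
have wr := wderivP Hr.
have L2r : L2 setT (q \- wdot t) by case: Hr.
have wsum := weak_derivativeD measurableT L2r L2dt wr (wderivP Hdt).
have qE : (fun x => (q \- wdot t) x + wdot t x) = q.
  by apply/funext => x /=; rewrite subrK.
rewrite qE in wsum.
have Ioo : (leb I < +oo)%E by rewrite lebI ltry.
have i1 : leb.-integrable I (EFin \o wderiv setT (q \- wdot t)).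
  by apply: L2_L1 => //; have [L2d _] := wr; exact: L2S L2d.
have i2 : leb.-integrable I (EFin \o wderiv setT (wdot t)).
  by apply: L2_L1 => //; have [L2d _] := wderivP Hdt; exact: L2S L2d.
have := line_int_derivative L0 L2q cq wsum; rewrite RintegralD// => qint.
have -> : h^-1 * (boundary_jump L (w (t + h)) - boundary_jump L (w t)) = q L - q 0.
  by rewrite /q /boundary_jump; ring.
rewrite -qint /jump_rate opprD addrCA subrr addr0 normrN.
apply: le_trans (int_wderiv_bound Hr) _.
rewrite -ler_pdivlMr//.
move: hclose; rewrite sub0r normrN ger0_norm//; exact: sqrtr_ge0.
Unshelve. all: by end_near. Qed.

End boundary_jump_in_time.

Section uniform_continuity.
Context {R : realType}.
Variables (T : R) (f : R -> R).
Hypotheses (T0 : 0 < T) (fAC : abs_continuous T real_dist f).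

Lemma AC_uniform eta : 0 < eta -> exists2 delta : R, 0 < delta &
  forall s t, 0 <= s -> s <= t -> t <= T -> t - s < delta -> `|f t - f s| < eta.
Proof.
move=> /(AC_small fAC)[delta d0 H]; exists delta => // s t s0 st tT small.
have := H 1%N xpredT (fun k => if k is 0%N then s else t).
rewrite !big_ord_recl !big_ord0 !addr0/=; apply => //.
- move=> [|i] [|j]//= _; exact: lexx.
- by move=> [|i]; rewrite ?s0 ?(le_trans s0 st) ?tT ?(le_trans st tT).
Qed.

(** Retraction onto [`[0, T]]: it turns a function controlled only on that segment
    into one that is continuous, or monotone, on the whole line. *)
Definition clamp (t : R) : R := Num.max 0 (Num.min t T).

Lemma clamp_in t : 0 <= clamp t <= T.
Proof. by rewrite /clamp le_max lexx/= ge_max ltW// ge_min lexx orbT. Qed.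

Lemma clamp_id t : 0 <= t <= T -> clamp t = t.
Proof. by move=> /andP[t0 tT]; rewrite /clamp (min_idPl tT) (max_idPr t0). Qed.

Lemma clamp_nd : {homo clamp : s t / s <= t}.
Proof.
move=> s t st; rewrite /clamp ge_max le_max lexx/= le_max; apply/orP; right.
by rewrite le_min !ge_min st lexx orbT.
Qed.

Lemma clamp_lip s t : s <= t -> clamp t - clamp s <= t - s.
Proof.
move=> st; rewrite /clamp.
by case: (leP s T) => ?; case: (leP t T) => ?; case: (leP 0 s) => ?;
  case: (leP 0 t) => ?; case: (leP 0 T) => ?; lra.
Qed.

Lemma AC_clamp_continuous : continuous (f \o clamp).
Proof.
move=> t; apply/cvgrPdist_lt => e e0; have [delta d0 H] := AC_uniform e0.
near=> s; have ts : `|t - s| < delta by near: s; apply/nbhs_ballP; exists delta.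
have key x y : x <= y -> y - x < delta -> `|f (clamp y) - f (clamp x)| < e.
  move=> xy yx; have /andP[x0 xT] := clamp_in x; have /andP[y0 yT] := clamp_in y.
  apply: H => //; first exact: clamp_nd.
  exact: le_lt_trans (clamp_lip xy) yx.
have [st|st] := leP s t.
  by apply: key => //; move: ts; rewrite ger0_norm// subr_ge0.
rewrite /= distrC; apply: key; first exact: ltW.
by move: ts; rewrite distrC ger0_norm// subr_ge0 ltW.
Unshelve. all: by end_near. Qed.

End uniform_continuity.

(** * Scalar quantities of a limit evolution *)

Section limit_of_damage.
Context {R : realType}.
Local Notation leb := (@lebesgue_measure R).
Local Notation charges := (charge (measurableTypeR R) R).
Variables (L T kappa a0 a1 : R) (w wdot : R -> R -> R).
Variables (eps : nat -> R) (un Tn an : nat -> R -> R -> R).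
Variables (e sigma : R -> R) (p mu : R -> charges).
Hypotheses (L0 : 0 < L) (T0 : 0 < T) (kappa0 : 0 < kappa) (a00 : 0 < a0) (a10 : 0 < a1).
Hypotheses (Hw : AC_H1 T w) (Hwd : H1_time_derivative T w wdot).
Hypothesis eps_small : forall n, 0 < eps n /\ eps n * a0 < a1.
Hypothesis eps_cvg : eps @ \oo --> (0 : R).
Hypothesis evol : forall n,
  brittle_damage_evolution L T kappa a0 a1 w wdot (eps n) (un n) (Tn n) (an n).
Hypothesis mu_cvg : forall t, 0 <= t <= T ->
  density_wstar_cvg L (fun n x => (1 - Tn n t x) / eps n) (mu t).
Hypothesis sigma_cvg : forall t, 0 <= t <= T ->
  (fun n => stress L (an n t) (un n t)) @ \oo --> sigma t.
Hypothesis e_cvg : forall t, 0 <= t <= T -> forall g, L2 `]0, L[ g ->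
  (fun n => \int[leb]_(x in `]0, L[)
     (stress L (an n t) (un n t) / a1 * Tn n t x * g x)) @ \oo -->
  \int[leb]_(x in `]0, L[) (e t * g x).
Hypothesis sigmaAC : abs_continuous T real_dist sigma.
Local Notation I := (`]0, L[%classic : set R).
Local Notation ell := (fun t => boundary_jump L (w t)).
Local Notation sign := (fun n t => sig L (un n) (an n) t).
Local Notation mn := (fun n t => mass L (eps n) (Tn n) t).

Let mI : measurable I. Proof. exact: measurable_itv. Qed.

Let lebI : leb I = L%:E.
Proof. by rewrite leb_oo ?ltW// subr0. Qed.

Let HwT : forall t, 0 <= t <= T -> H1 setT (w t) /\ continuous (w t).
Proof. by case: Hw. Qed.

Let HwdT : forall t, 0 <= t <= T -> H1 setT (wdot t).
Proof. by case: Hwd. Qed.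

Let z : 0 <= (0 : R) <= T. Proof. by rewrite lexx ltW. Qed.

Definition limit_mass t : R := charge_int (mu t) `[0, L] (fun=> 1).

Lemma mass_cvg t : 0 <= t <= T -> (fun n => mn n t) @ \oo --> limit_mass t.
Proof.
move=> tT; have c1 : {within `[0, L], continuous (fun _ : R => 1 : R)}.
  by apply: continuous_subspaceT => x; exact: cvg_cst.
have := mu_cvg tT c1; apply: cvg_trans; apply: near_eq_cvg.
by apply: nearW => n; apply: eq_Rintegral => x _; rewrite mul1r.
Qed.

Lemma eps_mass_cvg t : 0 <= t <= T -> (fun n => eps n * mn n t) @ \oo --> (0 : R).
Proof.
by move=> tT; rewrite -(mul0r (limit_mass t)); apply: cvgM => //; exact: mass_cvg.
Qed.

(** The mass of the sound part differs from [L] by [eps * mass], which vanishes in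
    the limit. *)
Lemma limit_stress_compliance t : 0 <= t <= T ->
  sigma t * (limit_mass t / a0 + L / a1) = ell t.
Proof.
move=> tT; pose c n := mn n t / a0 + (L - eps n * mn n t) / a1.
have ccvg : c @ \oo --> limit_mass t / a0 + L / a1.
  apply: cvgD; first by apply: cvgM; [exact: mass_cvg|exact: cvg_cst].
  apply: cvgM; last exact: cvg_cst.
  rewrite -[X in _ --> X]subr0; apply: cvgB; [exact: cvg_cst|exact: eps_mass_cvg].
have lim1 : (fun n => sign n t * c n) @ \oo --> sigma t * (limit_mass t / a0 + L / a1).
  exact: cvgM (sigma_cvg tT) ccvg.
apply: cvgn_unique lim1 _; rewrite (_ : (fun n => _) = cst (ell t)); first exact: cvg_cst.
apply/funext => n; have [en en1] := eps_small n.
exact: (sig_compliance L0 a00 a10 en HwT (evol n) tT).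
Qed.

Lemma limit_strain t : 0 <= t <= T -> a1 * e t = sigma t.
Proof.
move=> tT; have L21 : L2 I (fun=> 1).
  by apply: (@bounded_L2 _ _ _ 1) => //; [rewrite lebI ltry|move=> x _; rewrite normr1].
have lim1 : (fun n => \int[leb]_(x in I) (sign n t / a1 * Tn n t x * 1)) @ \oo -->
    \int[leb]_(x in I) (e t * 1) by exact: e_cvg tT _ L21.
have lim2 : (fun n => sign n t / a1 * (L - eps n * mn n t)) @ \oo --> sigma t / a1 * L.
  rewrite -[in X in _ --> X](subr0 L).
  apply: cvgM; first by apply: cvgM; [exact: sigma_cvg|exact: cvg_cst].
  by apply: cvgB; [exact: cvg_cst|exact: eps_mass_cvg].
have : \int[leb]_(x in I) (e t * 1) = sigma t / a1 * L.
  apply: cvgn_unique lim1 _; apply: cvg_trans lim2; apply: near_eq_cvg; apply: nearW => n.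
  have [en en1] := eps_small n.
  rewrite -(mass_ge0 L0 en (evol n) tT).2 -RintegralZl//; last first.
    apply: L2_L1 => //; first by rewrite lebI ltry.
    by have [] := ThetaL L0 en (evol n) tT.
  by apply: eq_Rintegral => x _; rewrite mulr1.
rewrite (Rintegral_cst_leb _ mI lebI) mulr1 => /(mulIf (lt0r_neq0 L0)) ->.
by rewrite mulrC divfK// gt_eqF.
Qed.

Lemma limit_mass_ge0 t : 0 <= t <= T -> 0 <= limit_mass t.
Proof.
move=> tT; apply: cvgn_ge (mass_cvg tT) _ => n; have [en _] := eps_small n.
by have [] := mass_ge0 L0 en (evol n) tT.
Qed.

Lemma limit_mass_nd s t : 0 <= s -> s <= t -> t <= T -> limit_mass s <= limit_mass t.
Proof.
move=> s0 st tT; have sT : 0 <= s <= T by rewrite s0 (le_trans st).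
have t0T : 0 <= t <= T by rewrite tT (le_trans s0).
rewrite -subr_ge0; apply: (cvgn_ge (cvgB (mass_cvg t0T) (mass_cvg sT))) => n.
by have [en _] := eps_small n; rewrite subr_ge0 (mass_monotone L0 en (evol n)).
Qed.

Lemma limit_initial_yield : 0 < limit_mass 0 -> 2 * kappa * a0 <= sigma 0 ^+ 2.
Proof.
move=> m0; have lim2 : (fun n => sign n 0 ^+ 2) @ \oo --> sigma 0 ^+ 2.
  by rewrite expr2; exact: cvgM (sigma_cvg z) (sigma_cvg z).
have mpos := @cvgr_gt _ _ _ _ _ _ (mass_cvg z) _ m0.
apply: (@ler_cvg_to nat \oo _ R (cst (2 * kappa * a0)) (fun n => sign n 0 ^+ 2)) lim2 _.
  exact: cvg_cst.
near=> n; have [en en1] := eps_small n.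
apply: (initial_yield L0 T0 kappa0 a00 a10 en en1 (evol n)).
by near: n; exact: mpos.
Unshelve. all: by end_near. Qed.

Variable G : R -> R.
Hypotheses (iG : leb.-integrable `[0, T] (EFin \o G))
  (aeG : {ae leb, forall r, 0 < r < T -> jump_rate L wdot r = G r}).

Lemma int_jump_rate t (f : R -> R) : 0 <= t <= T ->
  \int[leb]_(s in `[0, t]) (f s * jump_rate L wdot s) =
  \int[leb]_(s in `[0, t]) (f s * G s).
Proof.
move=> /andP[t0 tT]; apply: Rintegral_ae_congr.
have ne (c : R) : {ae leb, forall s : R, s != c}.
  by exists [set c]; split => [|| s /= /negP]; rewrite ?lebesgue_measure_set1// negbK => /eqP.
apply: ae_imp3 (ne 0) (ne T) aeG => s s0 sT h.
rewrite /= in_itv/= => /andP[s0' st]; congr (_ * _); apply: h.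
by rewrite !lt_neqAle eq_sym s0 s0' sT (le_trans st).
Qed.

(** The compliance is nondecreasing in time and the jump is continuous, so their
    quotient, the stress, is measurable. *)
Lemma damage_stress_measurable n :
  measurable_fun setT (fun t => sign n (clamp T t)).
Proof.
have [en en1] := eps_small n.
pose c t := mn n (clamp T t) / a0 + (L - eps n * mn n (clamp T t)) / a1.
have cge t : L / a1 <= c t.
  exact: (compliance_ge L0 a00 a10 en en1 (evol n) (clamp_in T0 t)).
have c0 t : 0 < c t by apply: lt_le_trans (cge t); rewrite divr_gt0.
have cE t : c t = mn n (clamp T t) * (a0^-1 - eps n / a1) + L / a1 by rewrite /c; ring.
have slope0 : 0 <= a0^-1 - eps n / a1.
  by rewrite subr_ge0 ler_pdivrMr// mulrC ler_pdivlMr// ltW.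
have cnd s t : s <= t -> c s <= c t.
  move=> st; rewrite !cE lerD2r; apply: ler_wpM2r => //.
  have /andP[s0 _] := clamp_in T0 s; have /andP[_ tT] := clamp_in T0 t.
  by apply: (mass_monotone L0 en (evol n)) => //; exact: clamp_nd.
have mci : measurable_fun [set: R] (fun t => - (c t)^-1).
  apply: nondecreasing_measurable => // s t st.
  by rewrite lerN2 lef_pV2 ?posrE//; exact: cnd.
rewrite (_ : (fun t => _) = (fun t => (ell \o clamp T) t * - - (c t)^-1)).
  apply: measurable_funM; last exact: measurable_funN.
  apply: continuous_measurable_fun.
  exact: (AC_clamp_continuous T0 (jump_AC L0 Hw)).
apply/funext => t; rewrite opprK /=.
rewrite -(sig_compliance L0 a00 a10 en HwT (evol n) (clamp_in T0 t)) -/(c t).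
by rewrite mulfK// gt_eqF.
Qed.

(** Dominated convergence in the power of the external forces: the stresses are
    bounded by a multiple of the jump, uniformly in the damage parameter. *)
Lemma limit_energy_balance t : 0 <= t <= T ->
  2^-1 * (sigma t * ell t) + kappa * limit_mass t =
  2^-1 * (sigma 0 * ell 0) + kappa * limit_mass 0 +
  \int[leb]_(s in `[0, t]) (sigma s * G s).
Proof.
move=> t0T; have /andP[t0 tT] := t0T.
have energy_cvg r : 0 <= r <= T ->
    (fun n => 2^-1 * (sign n r * ell r) + kappa * mn n r) @ \oo -->
    2^-1 * (sigma r * ell r) + kappa * limit_mass r.
  move=> rT; apply: cvgD; apply: cvgM; try exact: cvg_cst; last exact: mass_cvg.
  by apply: cvgM; [exact: sigma_cvg|exact: cvg_cst].
have cj := AC_clamp_continuous T0 (jump_AC L0 Hw).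
have cs := AC_clamp_continuous T0 sigmaAC.
have [M M0 HM] := continuous_bounded_segment 0 T cj.
have iGt : leb.-integrable `[0, t] (EFin \o G).
  apply: integrableS iG => //; apply: subset_itvl.
  by rewrite bnd_simp.
have mG : measurable_fun `[0, t] G by apply/measurable_EFinP; exact: measurable_int iGt.
have work_cvg : (fun n => \int[leb]_(s in `[0, t]) (sign n s * jump_rate L wdot s)) @ \oo -->
    \int[leb]_(s in `[0, t]) (sigma s * G s).
  have mf n : measurable_fun `[0, t] (fun s => sign n (clamp T s) * G s).
    apply: measurable_funM => //.
    by apply: measurable_funS (damage_stress_measurable n).
  have mlim : measurable_fun `[0, t] (fun s => sigma (clamp T s) * G s).
    by apply: measurable_funM => //; apply: measurable_funS (continuous_measurable_fun cs).
  have ptw : {ae leb, forall s, `[0, t]%classic s ->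
      (fun n => sign n (clamp T s) * G s) @ \oo --> sigma (clamp T s) * G s}.
    apply: aeW => s; rewrite /= in_itv/= => /andP[s0 st].
    by apply: cvgM; [apply: sigma_cvg; exact: clamp_in|exact: cvg_cst].
  have iB : leb.-integrable `[0, t] (EFin \o (fun s => a1 / L * M * `|G s|)).
    by apply: integrableZ_EFin => //; exact: integrable_norm.
  have dom n s : `[0, t]%classic s -> `|sign n (clamp T s) * G s| <= a1 / L * M * `|G s|.
    rewrite /= in_itv/= => /andP[s0 st]; rewrite normrM ler_wpM2r//.
    have [en en1] := eps_small n.
    apply: le_trans (sig_bound L0 a00 a10 en en1 HwT (evol n) (clamp_in T0 s)) _.
    rewrite ler_wpM2l ?divr_ge0 ?(ltW L0) ?(ltW a10)//.
    by apply: HM; rewrite s0 (le_trans st).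
  have [_] := @Rintegral_dominated_cvg _ _ R leb
    (fun n s => sign n (clamp T s) * G s) (fun s => sigma (clamp T s) * G s)
    (fun s => a1 / L * M * `|G s|) `[0, t]%classic (measurable_itv _) mf mlim ptw iB dom.
  have sE (f : R -> R) : \int[leb]_(s in `[0, t]) (f (clamp T s) * G s) =
      \int[leb]_(s in `[0, t]) (f s * G s).
    apply: eq_Rintegral => s; rewrite inE/= in_itv/= => /andP[s0 st].
    by rewrite clamp_id// s0 (le_trans st).
  rewrite sE; apply: cvg_trans; apply: near_eq_cvg; apply: nearW => n.
  by rewrite sE int_jump_rate.
apply: cvgn_unique (energy_cvg _ t0T) _.
apply: cvg_trans (cvgD (energy_cvg _ z) work_cvg); apply: near_eq_cvg; apply: nearW => n.
have [en en1] := eps_small n.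
by rewrite (energy_balance_eps L0 T0 a00 en HwT HwdT (evol n) t0T).
Qed.

End limit_of_damage.

(** * Variation in time of the plastic strain *)

Section pointwise_variation.
Context {R : realType}.
Variables (X : Type) (d : X -> X -> \bar R) (f : R -> X).

(** Append one interval to a subdivision. *)
Lemma variation_upto_add s t : (d (f t) (f s)) \is a fin_num -> s <= t ->
  (variation_upto d f s + d (f t) (f s) <= variation_upto d f t)%E.
Proof.
move=> dfin st; rewrite -leeBrDr//.
apply: ge_ereal_sup => _ [n [x [x0 xn xmono ->]]]; rewrite leeBrDr//.
apply: ereal_sup_ubound; exists n.+1, (fun i => if (i <= n)%N then x i else t).
split => //; first by rewrite ltnn.
  move=> i; rewrite ltnS => ile; rewrite ile.
  case: ltnP => h; first exact: xmono.
  by have -> : i = n; [apply/eqP; rewrite eqn_leq ile h|rewrite xn].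
rewrite big_ord_recr/= ltnn leqnn xn; congr (_ + _)%E.
by apply: eq_bigr => i _; rewrite ltn_ord (ltnW (ltn_ord i)).
Qed.

Lemma variation_upto_monotone (A : R -> R) (T : R) :
  (forall s t, 0 <= s -> s <= t -> t <= T -> d (f t) (f s) = (A t - A s)%:E) ->
  forall t, 0 <= t <= T -> variation_upto d f t = (A t - A 0)%:E.
Proof.
move=> dA t /andP[t0 tT].
have partition n x : x 0%N = 0 -> x n = t ->
    (forall i, (i < n)%N -> x i <= x i.+1) ->
    (\sum_(i < n) d (f (x i.+1)) (f (x i)))%E = (A t - A 0)%:E.
  move=> x0 xn xmono.
  have below k : (k <= n)%N -> x (n - k)%N <= t.
    elim: k => [|k IH] kn; first by rewrite subn0 xn.
    apply: le_trans (IH (ltnW kn)); rewrite -(subnSK kn); apply: xmono.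
    by rewrite ltn_subrL (leq_trans _ kn).
  suff H m : (m <= n)%N -> 0 <= x m /\
      (\sum_(i < m) d (f (x i.+1)) (f (x i)))%E = (A (x m) - A 0)%:E.
    by have [_ ->] := H n (leqnn n); rewrite xn.
  elim: m => [|m IH] mn; first by rewrite x0 big_ord0 subrr.
  have [xm0 sm] := IH (ltnW mn); have xm := xmono m mn; split; first exact: le_trans xm.
  rewrite big_ord_recr/= sm dA//; last first.
    apply: le_trans tT; have := below (n - m.+1)%N (leq_subr _ _).
    by rewrite subKn.
  by rewrite -EFinD; congr EFin; rewrite addrC addrA subrK.
apply/eqP; rewrite eq_le; apply/andP; split.
  by apply: ge_ereal_sup => _ [n [x [x0 xn xmono ->]]]; rewrite partition.
apply: ereal_sup_ubound; exists 1%N, (fun i => if i is 0%N then 0 else t).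
split => //; first by case. by apply/esym/(partition 1%N (fun i => if i is 0%N then 0 else t)) => //; case.
Qed.

End pointwise_variation.

Lemma var_dist_fin {R : realType} (nu1 nu2 : charge (measurableTypeR R) R) X :
  measurable X -> var_dist X nu1 nu2 \is a fin_num.
Proof. by move=> mX; rewrite fin_numD !fin_num_measure. Qed.

Section plastic_strain.
Context {R : realType}.
Local Notation leb := (@lebesgue_measure R).
Local Notation charges := (charge (measurableTypeR R) R).
Variables (L T kappa a0 a1 : R) (w wdot : R -> R -> R).
Variables (eps : nat -> R) (un Tn an : nat -> R -> R -> R).
Variables (sigma : R -> R) (p mu : R -> charges).
Hypotheses (L0 : 0 < L) (a00 : 0 < a0).
Hypothesis eps_small : forall n, 0 < eps n /\ eps n * a0 < a1.
Hypothesis evol : forall n,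
  brittle_damage_evolution L T kappa a0 a1 w wdot (eps n) (un n) (Tn n) (an n).
Hypothesis mu_cvg : forall t, 0 <= t <= T ->
  density_wstar_cvg L (fun n x => (1 - Tn n t x) / eps n) (mu t).
Hypothesis sigma_cvg : forall t, 0 <= t <= T ->
  (fun n => stress L (an n t) (un n t)) @ \oo --> sigma t.
Hypothesis p_cvg : forall t, 0 <= t <= T ->
  density_wstar_cvg L
    (fun n x => stress L (an n t) (un n t) / a0 * ((1 - Tn n t x) / eps n)) (p t).
Local Notation I := (`]0, L[%classic : set R).
Local Notation J := (`[0, L]%classic : set R).

Let mI : measurable I. Proof. exact: measurable_itv. Qed.
Let mJ : measurable (J : set (measurableTypeR R)). Proof. exact: measurable_itv. Qed.
Let lebI : leb I = L%:E.
Proof. by rewrite leb_oo ?ltW// subr0. Qed.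

(** At positive parameter the plastic density is the damage density times the
    number [sigma / a0]. *)
Lemma plastic_strain_int t (phi : R -> R) : 0 <= t <= T -> continuous phi ->
  charge_int (p t) J phi = sigma t / a0 * charge_int (mu t) J phi.
Proof.
move=> tT cphi; have cw := continuous_subspaceT cphi (A := J).
have lim1 := p_cvg tT cw.
have lim2 : (fun n => stress L (an n t) (un n t) / a0 *
    \int[leb]_(x in I) (phi x * ((1 - Tn n t x) / eps n))) @ \oo -->
    sigma t / a0 * charge_int (mu t) J phi.
  by apply: cvgM; [apply: cvgM; [exact: sigma_cvg|exact: cvg_cst]|exact: mu_cvg].
apply: cvgn_unique lim1 _; apply: cvg_trans lim2; apply: near_eq_cvg; apply: nearW => n.
have [en en1] := eps_small n.
rewrite -RintegralZl//; last first.
  apply: L2_mul => //; first exact: continuous_L2_I.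
  by have [] := ThetaL L0 en (evol n) tT.
by apply: eq_Rintegral => x _; rewrite mulrCA.
Qed.

Lemma damage_measure_monotone s t (phi : R -> R) : 0 <= s -> s <= t -> t <= T ->
  continuous phi -> (forall x, 0 <= phi x) ->
  charge_int (mu s) J phi <= charge_int (mu t) J phi.
Proof.
move=> s0 st tT cphi phi0; have cw := continuous_subspaceT cphi (A := J).
have sT : 0 <= s <= T by rewrite s0 (le_trans st).
have t0T : 0 <= t <= T by rewrite tT (le_trans s0).
have [M M0 HM] := continuous_bounded_segment 0 L cphi.
rewrite -subr_ge0; apply: (cvgn_ge (cvgB (mu_cvg t0T cw) (mu_cvg sT cw))) => n.
have [en _] := eps_small n; rewrite subr_ge0.
apply: (mass_nd L0 en (evol n) s0 st tT (M := M)).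
  by apply: measurable_funS (continuous_measurable_fun cphi).
move=> x; rewrite /= in_itv/= => /andP[x0 xL]; rewrite phi0/=.
by rewrite (le_trans (ler_norm _))// HM// !ltW.
Qed.

Lemma damage_measure_bound t (phi : R -> R) M : 0 <= t <= T ->
  continuous phi -> (forall x, J x -> 0 <= phi x <= M) ->
  0 <= charge_int (mu t) J phi <= M * limit_mass L mu t.
Proof.
move=> tT cphi phi0M; have cw := continuous_subspaceT cphi (A := J).
have IJ x : I x -> J x by move=> /=; rewrite !in_itv/= => /andP[h1 h2]; rewrite !ltW.
have bnd n : 0 <= \int[leb]_(x in I) (phi x * ((1 - Tn n t x) / eps n)) <=
    M * mass L (eps n) (Tn n) t.
  have [en _] := eps_small n.
  have [th [mth th01 thE]] := Theta_representative (evol n) tT.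
  have [_ L2m] := ThetaL L0 en (evol n) tT.
  have L2p := continuous_L2_I L0 cphi.
  have L2m' : L2 I (fun x => (1 - th x) / eps n).
    apply: (@bounded_L2 _ I _ (eps n)^-1 mI) => //; first by rewrite lebI ltry.
      by apply: measurable_funM => //; exact: measurable_funB.
    move=> x _; have /andP[h1 h2] := th01 x.
    rewrite ger0_norm ?divr_ge0 ?subr_ge0//; last exact: ltW.
    by apply: ler_piMl; [rewrite invr_ge0 ltW|rewrite lerBlDr lerDl].
  have d0 x : 0 <= (1 - th x) / eps n.
    by have /andP[h1 h2] := th01 x; rewrite divr_ge0 ?subr_ge0// ltW.
  have Ioo : (leb I < +oo)%E by rewrite lebI ltry.
  rewrite (@Rintegral_ae_congr _ _ _ leb _ (fun x => phi x * ((1 - th x) / eps n))); last first.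
    by apply: ae_imp thE => x h Ix; rewrite h.
  have -> : mass L (eps n) (Tn n) t = \int[leb]_(x in I) ((1 - th x) / eps n).
    by apply: Rintegral_ae_congr; apply: ae_imp thE => x h Ix; rewrite h.
  apply/andP; split.
    apply: Rintegral_ge0 => x /IJ/phi0M/andP[h1 h2].
    by rewrite mulr_ge0.
  rewrite -RintegralZl//; last exact: L2_L1.
  apply: le_Rintegral => //.
  - exact: L2_mul.
  - by apply: integrableZ_EFin => //; exact: L2_L1.
  - move=> x /IJ/phi0M/andP[h1 h2].
    by rewrite ler_wpM2r.
apply/andP; split.
  by apply: cvgn_ge (mu_cvg tT cw) _ => n; have /andP[] := bnd n.
have c1 : {within J, continuous (fun _ : R => 1 : R)}.
  by apply: continuous_subspaceT => x; exact: cvg_cst.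
have lim : (fun n => M * \int[leb]_(x in I) (1 * ((1 - Tn n t x) / eps n))) @ \oo -->
    M * limit_mass L mu t by apply: cvgM; [exact: cvg_cst|exact: mu_cvg tT _ c1].
rewrite -subr_ge0; apply: (cvgn_ge (cvgB lim (mu_cvg tT cw))) => n.
have /andP[_ h] := bnd n; rewrite subr_ge0; apply: le_trans h _.
rewrite le_eqVlt; apply/orP; left; apply/eqP; congr (_ * _).
by apply: eq_Rintegral => x _; rewrite mul1r.
Qed.

Lemma plastic_strain_mass t : 0 <= t <= T ->
  p t J = (sigma t * (limit_mass L mu t / a0))%:E.
Proof.
move=> tT; have fin : p t J \is a fin_num by exact: fin_num_measure.
rewrite -(fineK fin); congr EFin.
have -> : fine (p t J) = charge_int (p t) J (fun=> 1).
  rewrite -[in LHS](setIid J) -charge_int_indic//.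
  by apply: charge_int_ext => x Jx; rewrite indicE mem_set.
rewrite plastic_strain_int//; last by move=> x; exact: cvg_cst.
by rewrite -/(limit_mass L mu t) mulrAC mulrA.
Qed.

Lemma var_dist_ge_mass s t : 0 <= s <= T -> 0 <= t <= T ->
  (`|sigma t * (limit_mass L mu t / a0) - sigma s * (limit_mass L mu s / a0)|%:E <=
   var_dist J (p t) (p s))%E.
Proof.
move=> sT tT; apply: le_trans (total_var_ge _ mJ).
have h : (`|sigma t * (limit_mass L mu t / a0) - sigma s * (limit_mass L mu s / a0)|%:E <=
    `|p t J - p s J|)%E by rewrite !plastic_strain_mass.
exact: h.
Qed.

(** The measures [mu t] increase with time.  When [mu s] is zero or the stress is
    the same at both times, the increment of [p] is therefore a measure of
    constant sign, and its variation is the absolute value of its mass. *)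
Lemma var_dist_of_flow s t : 0 <= s -> s <= t -> t <= T ->
  limit_mass L mu s = 0 \/ sigma t = sigma s ->
  var_dist J (p t) (p s) =
  `|sigma t * (limit_mass L mu t / a0) - sigma s * (limit_mass L mu s / a0)|%:E.
Proof.
move=> s0 st tT flow.
have sT : 0 <= s <= T by rewrite s0 (le_trans st).
have t0T : 0 <= t <= T by rewrite tT (le_trans s0).
have key (phi : R -> R) : continuous phi -> (forall x, 0 <= phi x) ->
    exists2 c, 0 <= c & charge_int (cadd (p t) (copp (p s))) J phi = sigma t / a0 * c.
  move=> cphi phi0; have [M M0 HM] := continuous_bounded_segment 0 L cphi.
  have bnd x : J x -> 0 <= phi x <= M.
    by rewrite /= in_itv/= => Jx; rewrite phi0/= (le_trans (ler_norm _))// HM.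
  rewrite charge_intB//; first last.
  - by exists M => x; rewrite /= in_itv/=; exact: HM.
  - by apply: measurable_funS (continuous_measurable_fun cphi).
  rewrite !plastic_strain_int//.
  case: flow => [ms0|sts].
    have := damage_measure_bound sT cphi bnd; rewrite ms0 mulr0 => h.
    exists (charge_int (mu t) J phi).
      by have /andP[] := damage_measure_bound t0T cphi bnd.
    have -> : charge_int (mu s) J phi = 0 by apply/eqP; rewrite eq_le andbC.
    by rewrite mulr0 subr0.
  exists (charge_int (mu t) J phi - charge_int (mu s) J phi).
    by rewrite subr_ge0 damage_measure_monotone.
  by rewrite sts [RHS]mulrBr.
have massE : cadd (p t) (copp (p s)) J =
    (sigma t * (limit_mass L mu t / a0) - sigma s * (limit_mass L mu s / a0))%:E.
  by apply: (@etrans _ _ (p t J - p s J)%E) => //; rewrite !plastic_strain_mass.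
have [st0|st0] := leP 0 (sigma t).
  have pos A : measurable A -> A `<=` J -> (0 <= cadd (p t) (copp (p s)) A)%E.
    apply: charge_ge0_of_continuous => phi cphi phi0.
    have [c c0 ->] := key phi cphi phi0.
    by rewrite mulr_ge0// divr_ge0// ltW.
  apply: (etrans (total_var_of_ge0 mJ pos)); apply: (etrans massE); congr EFin.
  by rewrite ger0_norm// -lee_fin -massE; exact: pos.
have swap (phi : R -> R) : continuous phi ->
    charge_int (cadd (p s) (copp (p t))) J phi = - charge_int (cadd (p t) (copp (p s))) J phi.
  move=> cphi; have [M M0 HM] := continuous_bounded_segment 0 L cphi.
  have mphi : measurable_fun J phi by apply: measurable_funS (continuous_measurable_fun cphi).
  have bphi : exists M, forall x, J x -> `|phi x| <= M.
    by exists M => x; rewrite /= in_itv/=; exact: HM.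
  rewrite (charge_intB _ _ mJ mphi bphi) (charge_intB _ _ mJ mphi bphi) [RHS]opprB. by [].
have neg A : measurable A -> A `<=` J -> (cadd (p t) (copp (p s)) A <= 0)%E.
  move=> mA AJ.
  have : (0 <= cadd (p s) (copp (p t)) A)%E.
    apply: charge_ge0_of_continuous mA AJ => phi cphi phi0.
    have [c c0 E] := key phi cphi phi0.
    rewrite swap// E -mulNr mulr_ge0// -mulNr; apply: divr_ge0; last exact: ltW.
    by rewrite oppr_ge0 ltW.
  suff : (0 <= p s A - p t A)%E -> (p t A - p s A <= 0)%E by [].
  rewrite -(fineK (fin_num_measure (p s) A mA)) -(fineK (fin_num_measure (p t) A mA)).
  by rewrite -!EFinB !lee_fin subr_ge0 subr_le0.
apply: (etrans (total_var_of_le0 mJ neg)); apply: (etrans (congr1 oppe massE)).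
by rewrite -EFinN; congr EFin; rewrite ler0_norm// -lee_fin -massE; exact: neg.
Qed.

End plastic_strain.

(** * The scalar evolution *)

Section interval_additivity.
Context {R : realType}.
Local Notation leb := (@lebesgue_measure R).

Lemma Rintegral_itv_add (f : R -> R) r s t : r <= s -> s <= t ->
  leb.-integrable `[r, t] (EFin \o f) ->
  \int[leb]_(x in `[r, s]) f x + \int[leb]_(x in `[s, t]) f x =
  \int[leb]_(x in `[r, t]) f x.
Proof.
move=> rs st fi.
have := @Rintegral_itvB R f (BLeft r) (BRight t) s fi.
rewrite !bnd_simp => /(_ rs st) h.
suff <- : \int[leb]_(x in `]s, t]) f x = \int[leb]_(x in `[s, t]) f x.
  by rewrite -h addrC subrK.
rewrite Rintegral_itv_obnd_cbnd//.
apply: integrableS fi => //.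
by move=> x /=; rewrite !in_itv/= => /andP[h1 h2]; rewrite h2 (le_trans rs)// ltW.
Qed.

End interval_additivity.

Section last_time_above_a_level.
Context {R : realType}.

(** The supremum of the times at which [f] is at least [b]. *)
Lemma last_time_at_level (f : R -> R) (s t b : R) : continuous f -> s <= t ->
  f t < b -> b <= f s ->
  exists r, [/\ s <= r, r <= t, f r = b & forall x, r <= x -> x <= t -> f x <= b].
Proof.
move=> fc st ftb bfs.
pose A := [set x | s <= x <= t /\ b <= f x].
have As : A s by split; rewrite ?lexx.
have uA : has_ubound A by exists t => x [/andP[]].
have sA : has_sup A by split => //; exists s.
pose r := sup A.
have sr : s <= r by exact: ub_le_sup.
have rt : r <= t by apply: ge_sup; [exists s|move=> x [/andP[]]].
have br : b <= f r.
  rewrite leNgt; apply/negP => frb.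
  have /cvgrPdist_lt /(_ (b - f r)) := fc r; rewrite subr_gt0 => /(_ frb).
  move=> /nbhs_ballP[d d0 Hd].
  have [x Ax rx] := sup_adherent d0 sA; have [/andP[sx xt] bx] := Ax.
  have xr : x <= r by exact: ub_le_sup.
  have /Hd /= : ball r d x.
    by rewrite /ball/= ger0_norm ?subr_ge0//; rewrite -/r in rx; lra.
  by rewrite ltr_norml => /andP[h1 _]; lra.
have above x : r < x -> x <= t -> f x < b.
  move=> rx xt; rewrite ltNge; apply/negP => bx.
  have Ax : A x by split => //; rewrite xt (le_trans sr)// ltW.
  by have := ub_le_sup uA Ax; rewrite -/r leNgt rx.
have frb : f r = b.
  have := @IVT _ f r t b rt (continuous_subspaceT fc).
  have ftr : f t <= f r by rewrite (le_trans (ltW ftb)).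
  rewrite (min_idPr ftr) (max_idPl ftr) (ltW ftb) br => /(_ isT)[c].
  rewrite in_itv/= => /andP[]; rewrite le_eqVlt => /predU1P[-> //|rc ct] fcb.
  by have := above c rc ct; rewrite fcb ltxx.
exists r; split => // x; rewrite le_eqVlt => /predU1P[<- _|rx xt]; first by rewrite frb.
exact/ltW/above.
Qed.

End last_time_above_a_level.

Section scalar_evolution.
Context {R : realType}.
Local Notation leb := (@lebesgue_measure R).
Variables (T k b : R) (sigma P ell G : R -> R).
Hypotheses (T0 : 0 < T) (k0 : 0 < k) (b0 : 0 < b).
Hypothesis compliance : forall t, 0 <= t <= T -> sigma t * (P t + b) = ell t.
Hypothesis P_ge0 : forall t, 0 <= t <= T -> 0 <= P t.
Hypothesis P_nd : forall s t, 0 <= s -> s <= t -> t <= T -> P s <= P t.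
Hypothesis yield : forall t, 0 <= t <= T -> sigma t ^+ 2 <= k ^+ 2.
Hypothesis initial : 0 < P 0 -> sigma 0 ^+ 2 = k ^+ 2.
Hypothesis sigmaAC : abs_continuous T real_dist sigma.
Hypothesis iG : leb.-integrable `[0, T] (EFin \o G).
Hypothesis FTC : forall s t, 0 <= s -> s <= t -> t <= T ->
  \int[leb]_(r in `[s, t]) G r = ell t - ell s.
Hypothesis balance : forall t, 0 <= t <= T ->
  2^-1 * (sigma t * ell t) + 2^-1 * k ^+ 2 * P t =
  2^-1 * (sigma 0 * ell 0) + 2^-1 * k ^+ 2 * P 0 +
  \int[leb]_(r in `[0, t]) (sigma r * G r).

Let sub_integrable (f : R -> R) s t : 0 <= s -> t <= T ->
  leb.-integrable `[0, T] (EFin \o f) -> leb.-integrable `[s, t] (EFin \o f).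
Proof.
move=> s0 tT; apply: integrableS => // x /=; rewrite !in_itv/= => /andP[h1 h2].
by rewrite (le_trans s0)// (le_trans h2).
Qed.

Let cs : continuous (sigma \o clamp T).
Proof. exact: (AC_clamp_continuous T0 sigmaAC). Qed.

Let stress_le t : 0 <= t <= T -> `|sigma t| <= k.
Proof.
move=> tT; have := yield tT.
by rewrite -(ger0_norm (sqr_ge0 (sigma t))) normrX ler_pXn2r ?nnegrE// ltW.
Qed.

Lemma integrable_stress_power : leb.-integrable `[0, T] (EFin \o (fun r => sigma r * G r)).
Proof.
have h : leb.-integrable `[0, T] (EFin \o (fun r => G r * sigma (clamp T r))).
  apply: (@integrable_mul_bounded _ _ _ leb _ _ k) => //.
    by apply: measurable_funS (continuous_measurable_fun cs).
  by move=> r _; exact/stress_le/clamp_in.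
apply: eq_integrable h => // r; rewrite inE/= in_itv/= => r0T.
by rewrite (clamp_id r0T) mulrC.
Qed.

Lemma balance_between s t : 0 <= s -> s <= t -> t <= T ->
  2^-1 * (sigma t * ell t) + 2^-1 * k ^+ 2 * P t =
  2^-1 * (sigma s * ell s) + 2^-1 * k ^+ 2 * P s +
  \int[leb]_(r in `[s, t]) (sigma r * G r).
Proof.
move=> s0 st tT; have t0T : 0 <= t <= T by rewrite tT (le_trans s0).
have sT : 0 <= s <= T by rewrite s0 (le_trans st).
rewrite (balance t0T) (balance sT) -(Rintegral_itv_add s0 st) ?addrA//.
by apply: sub_integrable => //; exact: integrable_stress_power.
Qed.

(** Subtract from the balance the power that would be spent at the constant stress
    [sigma s].  What remains on the left is
    [(P t + b) (sigma t - sigma s) ^+ 2 / 2 + (k ^+ 2 - sigma s ^+ 2) (P t - P s) / 2],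
    and on the right the integral of [(sigma - sigma s) l']. *)
Lemma local_flow_bound eta c s t : 0 <= s -> s <= t -> t <= T ->
  (forall r, s <= r -> r <= t -> `|sigma r - sigma s| <= eta) ->
  sigma s ^+ 2 <= k ^+ 2 - c ->
  c * (P t - P s) <= 2 * eta * \int[leb]_(r in `[s, t]) `|G r|.
Proof.
move=> s0 st tT osc below.
have t0T : 0 <= t <= T by rewrite tT (le_trans s0).
have sT : 0 <= s <= T by rewrite s0 (le_trans st).
have iGs : leb.-integrable `[s, t] (EFin \o G) by exact: sub_integrable.
have ip : leb.-integrable `[s, t] (EFin \o (fun r => sigma r * G r)).
  by apply: sub_integrable => //; exact: integrable_stress_power.
have icG (c' : R) : leb.-integrable `[s, t] (EFin \o (fun r => c' * G r)).
  exact: integrableZ_EFin.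
have iA : leb.-integrable `[s, t] (EFin \o (fun r => eta * `|G r|)).
  by apply: integrableZ_EFin => //; exact: integrable_norm.
have bound : \int[leb]_(r in `[s, t]) (sigma r * G r) - sigma s * (ell t - ell s) <=
    eta * \int[leb]_(r in `[s, t]) `|G r|.
  rewrite -(FTC s0 st tT) -!RintegralZl//; last exact: integrable_norm.
  rewrite -RintegralB//.
  apply: le_trans (ler_norm _) _; apply: Rintegral_bound => //.
    exact: (integrableB_EFin _ ip (icG (sigma s))).
  move=> r; rewrite /= in_itv/= => /andP[sr rt].
  by rewrite -mulrBl normrM ler_wpM2r// osc.
have := balance_between s0 st tT; have := P_nd s0 st tT; have := P_ge0 t0T.
rewrite -(compliance t0T) -(compliance sT) in bound *.
move: bound; set V := \int[leb]_(r in _) `|_|; set W := \int[leb]_(r in _) _.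
move=> bound Pt0 Pnd bal.
have sq : 0 <= (P t + b) * (sigma t - sigma s) ^+ 2.
  by apply: mulr_ge0; [rewrite addr_ge0// ltW|exact: sqr_ge0].
have dP : 0 <= (k ^+ 2 - sigma s ^+ 2 - c) * (P t - P s).
  by apply: mulr_ge0; [lra|rewrite subr_ge0].
have idn : (P t + b) * (sigma t - sigma s) ^+ 2 +
    (k ^+ 2 - sigma s ^+ 2) * (P t - P s) =
    2 * (W - sigma s * (sigma t * (P t + b) - sigma s * (P s + b))).
  have -> : W = 2^-1 * (sigma t * (sigma t * (P t + b))) + 2^-1 * k ^+ 2 * P t -
    (2^-1 * (sigma s * (sigma s * (P s + b))) + 2^-1 * k ^+ 2 * P s) by rewrite bal; ring.
  by field.
have -> : c * (P t - P s) = (P t + b) * (sigma t - sigma s) ^+ 2 +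
    (k ^+ 2 - sigma s ^+ 2) * (P t - P s) - (P t + b) * (sigma t - sigma s) ^+ 2 -
    (k ^+ 2 - sigma s ^+ 2 - c) * (P t - P s) by ring.
rewrite idn -mulrA; set X := W - _ in bound *; set Y := eta * V in bound *.
lra.
Qed.

(** On short intervals [local_flow_bound] holds with an arbitrarily small [eta];
    the bounds add up to a multiple of [eta] times the variation of [ell]. *)
Lemma no_flow_below_yield c s t : 0 < c -> 0 <= s -> s <= t -> t <= T ->
  (forall r, s <= r -> r <= t -> sigma r ^+ 2 <= k ^+ 2 - c) -> P t = P s.
Proof.
move=> c0 s0 st tT below; apply/eqP; rewrite eq_le (P_nd s0 st tT) andbT -subr_le0.
pose V x y := \int[leb]_(r in `[x, y]) `|G r|.
have inG : leb.-integrable `[0, T] (EFin \o (fun r => `|G r|)) by exact: integrable_norm.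
have V0 x y : 0 <= V x y by apply: Rintegral_ge0.
have step eta : 0 < eta -> c * (P t - P s) <= 2 * eta * V s t.
  move=> eta0; have [delta d0 Hd] := AC_uniform sigmaAC eta0.
  have short x y : s <= x -> x <= y -> y <= t -> y - x < delta ->
      c * (P y - P x) <= 2 * eta * V x y.
    move=> sx xy yt yx; apply: local_flow_bound => //; first exact: le_trans sx.
    - exact: le_trans tT.
    - move=> r xr ry; apply/ltW/Hd => //; first exact: le_trans sx.
        by rewrite (le_trans ry)// (le_trans yt).
      by apply: le_lt_trans yx; rewrite lerD2r.
    - by apply: below => //; rewrite (le_trans xy).
  (* The short intervals are chained backwards from t, each of length delta / 2. *)
  have all n : forall x, s <= x -> x <= t -> t - x <= n%:R * (delta / 2) ->
      c * (P t - P x) <= 2 * eta * V x t.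
    elim: n => [|n IH] x sx xt.
      rewrite mul0r subr_le0 => tx; have -> : x = t by apply/eqP; rewrite eq_le xt.
      by rewrite subrr mulr0 mulr_ge0// mulr_ge0// ltW.
    rewrite -natr1 mulrDl mul1r => tx; pose y := Num.min t (x + delta / 2).
    have d2 : 0 < delta / 2 by rewrite divr_gt0.
    have xy : x <= y by rewrite le_min xt lerDl ltW.
    have yt : y <= t by rewrite ge_min lexx.
    have yx : y - x < delta.
      have : y <= x + delta / 2 by rewrite ge_min lexx orbT.
      by lra.
    have yn : t - y <= n%:R * (delta / 2).
      have n0 : 0 <= n%:R * (delta / 2) by rewrite mulr_ge0// ltW.
      rewrite /y; have [h|h] := leP t (x + delta / 2).
        by rewrite subrr.
      by move: tx; set N := n%:R * _; lra.
    have h1 := IH y (le_trans sx xy) yt yn; have h2 := short x y sx xy yt yx.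
    have -> : c * (P t - P x) = c * (P t - P y) + c * (P y - P x) by ring.
    rewrite /V -(@Rintegral_itv_add _ _ x y t)//; last first.
      by apply: sub_integrable => //; exact: le_trans sx.
    by rewrite [leRHS]mulrDr addrC; exact: lerD.
  have d2 : 0 < delta / 2 by rewrite divr_gt0.
  apply: (all (Num.bound ((t - s) / (delta / 2)))) => //.
  rewrite -ler_pdivrMr//; apply/ltW/archi_boundP.
  by rewrite divr_ge0 ?subr_ge0// ltW.
rewrite -(pmulr_rle0 _ c0); apply/ler_addgt0Pl => x x0; rewrite addr0.
pose eta := x / (2 * (V s t + 1)).
have V1 : 0 < V s t + 1 by rewrite ltr_wpDl.
have eta0 : 0 < eta by rewrite divr_gt0// mulr_gt0.
apply: le_trans (step _ eta0) _.
rewrite [leRHS](_ : x = 2 * eta * (V s t + 1)).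
  by apply: ler_wpM2l; [rewrite mulr_ge0// ltW|rewrite lerDl].
by rewrite /eta; field; rewrite gt_eqF.
Qed.

(** Cut the interval at the last time at which the stress has the level [beta]; no
    flow occurs afterwards. *)
Lemma stress_drop s t beta : 0 <= s -> s <= t -> t <= T ->
  sigma t ^+ 2 < beta -> beta <= sigma s ^+ 2 -> beta < k ^+ 2 ->
  exists r, [/\ s <= r, r <= t, sigma r ^+ 2 = beta & P r = P t].
Proof.
move=> s0 st tT tb bs bk.
pose f r := sigma (clamp T r) ^+ 2.
have fc : continuous f.
  have -> : f = fun r => sigma (clamp T r) * sigma (clamp T r).
    by apply/funext => r; rewrite /f expr2.
  by move=> r; apply: cvgM; exact: cs.
have fE r : s <= r -> r <= t -> f r = sigma r ^+ 2.
  by move=> sr rt; rewrite /f clamp_id// (le_trans s0 sr) (le_trans rt).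
have [|| r [sr rt frb below]] := last_time_at_level fc st (b := beta).
- by rewrite fE.
- by rewrite fE.
exists r; split => //; first by rewrite -fE.
apply/esym; apply: (@no_flow_below_yield (k ^+ 2 - beta)) => //.
- by rewrite subr_gt0.
- exact: le_trans sr.
- by move=> x rx xt; rewrite subKr -fE ?below// (le_trans sr).
Qed.

Let jump_condition := forall s t : R, 0 <= s -> s < t -> t <= T ->
  `|ell t| < `|ell s| -> `|ell t| <= k * b.

(** The hypothesis bounds the dissipation from below by the change of the mass of
    [p].  It forbids the stress to decrease once [P] is positive: along a decrease
    [P] is constant, so the right-hand side is negative.  After that, [`|ell|] is a
    product of two nondecreasing factors. *)
Lemma jump_condition_of_dissipation :
  (forall s t, 0 <= s -> s <= t -> t <= T ->
    k * `|sigma t * P t - sigma s * P s| <=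
    2^-1 * (sigma t ^+ 2 + k ^+ 2) * P t - 2^-1 * (sigma s ^+ 2 + k ^+ 2) * P s) ->
  jump_condition.
Proof.
move=> diss.
have grow s t : 0 <= s -> s <= t -> t <= T -> 0 < P s -> sigma s ^+ 2 <= sigma t ^+ 2.
  move=> s0 st tT Ps; rewrite leNgt; apply/negP => lt.
  have sT : 0 <= s <= T by rewrite s0 (le_trans st).
  (* Any level strictly between the two would do. *)
  pose beta := (sigma s ^+ 2 + sigma t ^+ 2) / 2.
  have tb : sigma t ^+ 2 < beta by rewrite /beta; lra.
  have bs : beta < sigma s ^+ 2 by rewrite /beta; lra.
  have [r [sr rt rb Pr]] := stress_drop s0 st tT tb (ltW bs) (lt_le_trans bs (yield sT)).
  have := diss r t (le_trans s0 sr) rt tT; rewrite Pr rb -mulrBl normrM.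
  have Pt : 0 < P t by apply: lt_le_trans Ps _; exact: P_nd.
  rewrite leNgt => /negP; apply.
  apply: (@lt_le_trans _ _ 0); last by rewrite mulr_ge0 ?mulr_ge0// ltW.
  rewrite -mulrBl pmulr_llt0//; lra.
move=> s t s0 /ltW st tT; apply: contraTT; rewrite -ltNge -leNgt => big.
have sT : 0 <= s <= T by rewrite s0 (le_trans st).
have tT' : 0 <= t <= T by rewrite tT (le_trans s0).
have normE r : 0 <= r <= T -> `|ell r| = `|sigma r| * (P r + b).
  move=> rT; rewrite -compliance// normrM [X in _ * X]ger0_norm//.
  by rewrite addr_ge0 ?P_ge0// ltW.
rewrite normE// normE//.
have [Ps|] := ltP 0 (P s).
  have := grow _ _ s0 st tT Ps; rewrite -(ger0_norm (sqr_ge0 _)) -[leRHS](ger0_norm (sqr_ge0 _)).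
  rewrite !normrX ler_pXn2r ?nnegrE// => h.
  apply: ler_pM => //; first by rewrite addr_ge0 ?P_ge0// ltW.
  by rewrite lerD2r P_nd.
move=> Ps; have {}Ps : P s = 0 by apply/eqP; rewrite eq_le Ps P_ge0.
rewrite Ps add0r -normE//; apply: le_trans (ltW big).
by rewrite ler_wpM2r ?stress_le// ltW.
Qed.

Section under_the_jump_condition.
Hypothesis jumps : jump_condition.

(** If the stress is strictly below yield while [P t > 0], it has been above any
    level [b2 < k ^+ 2] before, since otherwise there would have been no flow and
    the initial stress would be at yield.  Going down from level [b2] to level
    [b1] with [P] frozen, [`|ell|] decreases and stays above [k * b]. *)
Lemma yield_of_plastic_strain t : 0 <= t <= T -> 0 < P t -> sigma t ^+ 2 = k ^+ 2.
Proof.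
move=> t0T Pt; have /andP[t0 tT] := t0T.
apply/eqP; rewrite eq_le yield//= leNgt; apply/negP => lt.
have q0 : 0 < P t + b by rewrite addr_gt0.
pose m := Num.max (sigma t ^+ 2) ((k * b / (P t + b)) ^+ 2).
have mk : m < k ^+ 2.
  rewrite gt_max lt/= ltr_pXn2r ?nnegrE ?divr_ge0 ?mulr_ge0// ?ltW//.
  by rewrite ltr_pdivrMr// ltr_pM2l// ltrDr.
(* m bounds the square of the present stress and the one at which the jump would be k b. *)
pose b1 := m + (k ^+ 2 - m) / 3; pose b2 := m + 2 * (k ^+ 2 - m) / 3.
have mb1 : m < b1 by rewrite /b1; lra.
have b12 : b1 < b2 by rewrite /b1 /b2; lra.
have b2k : b2 < k ^+ 2 by rewrite /b2; lra.
have tb1 : sigma t ^+ 2 < b1 by apply: le_lt_trans mb1; rewrite le_max lexx.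
have zz : (0 : R) <= 0 by [].
have [r [r0 rt rb2]] : exists r, [/\ 0 <= r, r <= t & b2 <= sigma r ^+ 2].
  apply: contrapT => no.
  have below r : 0 <= r -> r <= t -> sigma r ^+ 2 <= k ^+ 2 - (k ^+ 2 - b2).
    move=> r0 rt; rewrite subKr leNgt; apply/negP => /ltW h.
    by apply: no; exists r.
  have Pt0 : P t = P 0.
    by apply: no_flow_below_yield below => //; rewrite subr_gt0.
  have s0k : sigma 0 ^+ 2 = k ^+ 2 by apply: initial; rewrite -Pt0.
  by apply: no; exists 0; split => //; rewrite s0k ltW.
have [s2 [rs2 s2t s2b Ps2]] := stress_drop r0 rt tT (lt_trans tb1 b12) rb2 b2k.
have s20 := le_trans r0 rs2.
have b1s2 : b1 <= sigma s2 ^+ 2 by rewrite s2b ltW.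
have [s1 [s2s1 s1t s1b Ps1]] := stress_drop s20 s2t tT tb1 b1s2 (lt_trans b12 b2k).
have s2T : 0 <= s2 <= T by rewrite s20 (le_trans s2t).
have s1T : 0 <= s1 <= T by rewrite (le_trans s20 s2s1) (le_trans s1t).
have lt21 : s2 < s1.
  rewrite lt_neqAle s2s1 andbT; apply/eqP => E.
  by move: b12; rewrite -s1b -s2b E ltxx.
have sqE x : 0 <= x <= T -> P x = P t -> `|ell x| ^+ 2 = sigma x ^+ 2 * (P t + b) ^+ 2.
  by move=> xT Px; rewrite -compliance// -normrX ger0_norm ?sqr_ge0// exprMn Px.
have lt_ell : `|ell s1| < `|ell s2|.
  have : `|ell s1| ^+ 2 < `|ell s2| ^+ 2.
    by rewrite !sqE// s1b s2b ltr_pM2r ?exprn_gt0.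
  by rewrite ltr_pXn2r ?nnegrE.
have le_ell := jumps s20 lt21 (le_trans s1t tT) lt_ell.
have h : `|ell s1| ^+ 2 <= (k * b) ^+ 2.
  by rewrite ler_pXn2r ?nnegrE// mulr_ge0// ltW.
rewrite sqE// s1b leNgt in h; move/negP: h; apply.
have : (k * b / (P t + b)) ^+ 2 * (P t + b) ^+ 2 < b1 * (P t + b) ^+ 2.
  by rewrite ltr_pM2r ?exprn_gt0//; apply: le_lt_trans mb1; rewrite le_max lexx orbT.
by rewrite -exprMn divfK// gt_eqF.
Qed.

(** The stress is continuous with values in [k] and [- k]. *)
Lemma stress_constant_after_flow s t : 0 <= s -> s <= t -> t <= T -> 0 < P s ->
  sigma t = sigma s.
Proof.
move=> s0 st tT Ps.
have yk r : s <= r -> r <= t -> sigma r ^+ 2 = k ^+ 2.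
  move=> sr rt; apply: yield_of_plastic_strain.
    by rewrite (le_trans s0 sr) (le_trans rt).
  by apply: lt_le_trans Ps _; apply: P_nd => //; exact: le_trans tT.
have /eqP := etrans (yk t st (lexx t)) (esym (yk s (lexx s) st)).
rewrite eqf_sqr => /orP[/eqP //|/eqP opp].
have clE r : s <= r -> r <= t -> (sigma \o clamp T) r = sigma r.
  by move=> sr rt; rewrite /= clamp_id// (le_trans s0 sr) (le_trans rt).
have := @IVT _ (sigma \o clamp T) s t 0 st (continuous_subspaceT cs).
rewrite !clE// opp => H.
have [|c] := H; last first.
  rewrite in_itv/= => /andP[sc ct]; have /= -> := clE c sc ct => c0.
  by have := yk c sc ct; rewrite c0 expr0n/= => /esym/eqP; rewrite sqrf_eq0 gt_eqF.
by rewrite ge_min le_max oppr_le0 oppr_ge0; have := le_total 0 (sigma s); case: (0 <= sigma s); case: (sigma s <= 0).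
Qed.

End under_the_jump_condition.

Variables (X : Type) (d : X -> X -> \bar R) (p : R -> X).
Hypothesis d_fin : forall x y, d x y \is a fin_num.
Hypothesis d_ge : forall s t, 0 <= s <= T -> 0 <= t <= T ->
  (`|sigma t * P t - sigma s * P s|%:E <= d (p t) (p s))%E.
Hypothesis d_eq : forall s t, 0 <= s -> s <= t -> t <= T ->
  P s = 0 \/ sigma t = sigma s ->
  d (p t) (p s) = `|sigma t * P t - sigma s * P s|%:E.

Let plastic_balance t := 2^-1 * (sigma t ^+ 2 + k ^+ 2) * P t.

(** The difference between the elastic energy of the limit and its scalar energy
    is [plastic_balance]. *)
Let balanceE t : 0 <= t <= T ->
  2^-1 * (b * sigma 0 ^+ 2) + \int[leb]_(r in `[0, t]) (sigma r * G r) =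
  2^-1 * (b * sigma t ^+ 2) + (plastic_balance t - plastic_balance 0).
Proof.
move=> t0T; have z : 0 <= (0 : R) <= T by rewrite lexx ltW.
have := balance t0T; rewrite -(compliance t0T) -(compliance z) /plastic_balance.
set W := \int[leb]_(r in _) _ => h; apply/eqP; rewrite addrC -subr_eq; apply/eqP.
have -> : W = 2^-1 * (sigma t * (sigma t * (P t + b))) + 2^-1 * k ^+ 2 * P t -
  (2^-1 * (sigma 0 * (sigma 0 * (P 0 + b))) + 2^-1 * k ^+ 2 * P 0) by rewrite h; ring.
by ring.
Qed.

(** By [balanceE] the energy balance says that [k] times the variation of [p] is the
    increase of [plastic_balance].  Under the jump condition the stress is [k] or
    [- k] and constant as soon as [P] is positive, so [d (p t) (p s)] is
    [k * (P t - P s)] for all [s <= t], and [plastic_balance] is [k ^+ 2 * P]. *)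
Lemma energy_balance_iff :
  ((variation_upto d p T < +oo)%E /\
   forall t, 0 <= t <= T ->
     ((2^-1 * (b * sigma t ^+ 2))%:E + k%:E * variation_upto d p t =
      (2^-1 * (b * sigma 0 ^+ 2) + \int[leb]_(r in `[0, t]) (sigma r * G r))%:E)%E) <->
  jump_condition.
Proof.
split=> [[_ EB]|jumps].
  have kV t : 0 <= t <= T ->
      (k%:E * variation_upto d p t = (plastic_balance t - plastic_balance 0)%:E)%E.
    move=> t0T; have := EB t t0T; rewrite (balanceE t0T) EFinD.
    by move/(congr1 (fun y => y - (2^-1 * (b * sigma t ^+ 2))%:E)%E); rewrite !(addeC (2^-1 * _)%:E) !addeK.
  apply: jump_condition_of_dissipation => s t s0 st tT.
  have sT : 0 <= s <= T by rewrite s0 (le_trans st).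
  have t0T : 0 <= t <= T by rewrite tT (le_trans s0).
  have := @variation_upto_add R X d p s t (d_fin (p t) (p s)) st.
  rewrite -(@lee_pmul2l _ k%:E)// muleDr//; last exact: fin_num_adde_defl.
  rewrite (kV s sT) (kV t t0T) => h.
  have kd : (k%:E * `|sigma t * P t - sigma s * P s|%:E <= k%:E * d (p t) (p s))%E.
    by rewrite lee_pmul2l// d_ge.
  have := le_trans (leeD2l (plastic_balance s - plastic_balance 0)%:E kd) h.
  rewrite -EFinM -EFinD lee_fin -/(plastic_balance t) -/(plastic_balance s).
  by move: (plastic_balance t) (plastic_balance s) (plastic_balance 0) => x y z h'; lra.
have dE s t : 0 <= s -> s <= t -> t <= T -> d (p t) (p s) = (k * P t - k * P s)%:E.
  move=> s0 st tT; have sT : 0 <= s <= T by rewrite s0 (le_trans st).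
  have t0T : 0 <= t <= T by rewrite tT (le_trans s0).
  have Pst := P_nd s0 st tT.
  have normk r : 0 <= r <= T -> 0 < P r -> `|sigma r| = k.
    move=> rT Pr; apply/eqP; rewrite -(@eqrXn2 _ 2)// ?ltW// -normrX ger0_norm ?sqr_ge0//.
    by apply/eqP; exact: yield_of_plastic_strain.
  have [Ps|Ps] := ltP 0 (P s).
    have sts := stress_constant_after_flow jumps s0 st tT Ps.
    rewrite d_eq//; last by right.
    rewrite sts -mulrBr normrM normk// (ger0_norm (_ : 0 <= P t - P s)) ?subr_ge0//.
    by rewrite mulrBr.
  have {}Ps : P s = 0 by apply/eqP; rewrite eq_le Ps P_ge0.
  rewrite d_eq//; last by left.
  rewrite Ps !mulr0 !subr0 normrM (ger0_norm (P_ge0 t0T)).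
  have [Pt|Pt] := ltP 0 (P t); first by rewrite normk.
  have -> : P t = 0 by apply/eqP; rewrite eq_le Pt P_ge0.
  by rewrite !mulr0.
have V := @variation_upto_monotone R X d p (fun t => k * P t) T dE.
split; first by rewrite V ?ltry// lexx ltW.
move=> t t0T; rewrite V// (balanceE t0T) -EFinM -EFinD; congr EFin; congr (_ + _).
have bk r : 0 <= r <= T -> plastic_balance r = k * (k * P r).
  move=> rT; rewrite /plastic_balance; have [Pr|Pr] := ltP 0 (P r).
    by rewrite yield_of_plastic_strain//; field.
  have -> : P r = 0 by apply/eqP; rewrite eq_le Pr P_ge0.
  by rewrite !mulr0.
have z : 0 <= (0 : R) <= T by rewrite lexx ltW.
by rewrite !bk// mulrBr.
Qed.

End scalar_evolution.

(** * The derivative of the limit displacement *)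

Section green_formula_in_the_limit.
Context {R : realType}.
Local Notation leb := (@lebesgue_measure R).
Local Notation charges := (charge (measurableTypeR R) R).
Variables (L T kappa a0 a1 : R) (w wdot : R -> R -> R).
Variables (eps : nat -> R) (un Tn an : nat -> R -> R -> R).
Variables (u : R -> R -> R) (e : R -> R) (p : R -> charges).
Hypotheses (L0 : 0 < L) (a00 : 0 < a0) (a10 : 0 < a1).
Hypothesis Hw : forall t, 0 <= t <= T -> H1 setT (w t) /\ continuous (w t).
Hypothesis eps_small : forall n, 0 < eps n /\ eps n * a0 < a1.
Hypothesis evol : forall n,
  brittle_damage_evolution L T kappa a0 a1 w wdot (eps n) (un n) (Tn n) (an n).
Hypothesis uL1 : forall t, 0 <= t <= T -> L1 `]0, L[ (u t).
Hypothesis u_cvg : forall t, 0 <= t <= T ->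
  (fun n => L1_dist `]0, L[ (un n t) (u t)) @ \oo --> (0 : R).
Hypothesis e_cvg : forall t, 0 <= t <= T -> forall g, L2 `]0, L[ g ->
  (fun n => \int[leb]_(x in `]0, L[)
     (stress L (an n t) (un n t) / a1 * Tn n t x * g x)) @ \oo -->
  \int[leb]_(x in `]0, L[) (e t * g x).
Hypothesis p_cvg : forall t, 0 <= t <= T ->
  density_wstar_cvg L
    (fun n x => stress L (an n t) (un n t) / a0 * ((1 - Tn n t x) / eps n)) (p t).
Local Notation I := (`]0, L[%classic : set R).

Let mI : measurable I. Proof. exact: measurable_itv. Qed.
Let lebI : leb I = L%:E.
Proof. by rewrite leb_oo ?ltW// subr0. Qed.
Let Ioo : (leb I < +oo)%E. Proof. by rewrite lebI ltry. Qed.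

(** Each term of [green_eps] converges by one of the convergences that define a
    limit evolution; for the left-hand side, convergence in the mean is tested
    with a bounded function. *)
Lemma green_limit t psi : 0 <= t <= T -> C1 psi ->
  \int[leb]_(x in I) (u t x * derive1 psi x) =
  w t L * psi L - w t 0 * psi 0 -
  (\int[leb]_(x in I) (e t * psi x) + charge_int (p t) `[0, L] psi).
Proof.
move=> tT cpsi; have cpsi0 := C1_continuous cpsi.
have L2psi := continuous_L2_I L0 cpsi0.
have cdpsi : continuous (derive1 psi) by case: cpsi.
have [M M0 HM] := continuous_bounded_segment 0 L cdpsi.
have IM x : I x -> `|derive1 psi x| <= M.
  by rewrite /= in_itv/= => /andP[h1 h2]; rewrite HM// !ltW.
have mdpsi : measurable_fun I (derive1 psi).
  by apply: measurable_funS (continuous_measurable_fun cdpsi).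
have iu := uL1 tT.
have iun n : leb.-integrable I (EFin \o un n t).
  have [_ H _ _ _] := evol n; have [[[L2u _] _] _ _ _] := H t tT.
  exact: L2_L1.
have lim1 : (fun n => \int[leb]_(x in I) (un n t x * derive1 psi x)) @ \oo -->
    \int[leb]_(x in I) (u t x * derive1 psi x).
  have lim0 : (fun n => M * L1_dist I (un n t) (u t)) @ \oo --> (0 : R).
    have h := cvgM (cvg_cst M) (u_cvg tT); rewrite mulr0 in h; exact: h.
  apply/cvgrPdist_le => d d0.
  have /cvgrPdist_le /(_ d d0) := lim0; apply: filterS => n.
  rewrite sub0r normrN => h; apply: le_trans (le_trans (ler_norm _) h).
  have i1 : leb.-integrable I (EFin \o (fun x => un n t x * derive1 psi x)).
    exact: (@integrable_mul_bounded _ _ _ leb _ _ M).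
  have i2 : leb.-integrable I (EFin \o (fun x => u t x * derive1 psi x)).
    exact: (@integrable_mul_bounded _ _ _ leb _ _ M).
  have i3 : leb.-integrable I (EFin \o (fun x => `|un n t x - u t x|)).
    have i0 : leb.-integrable I (EFin \o (fun x => un n t x - u t x)).
      exact: integrableB_EFin.
    exact: integrable_norm.
  rewrite distrC -RintegralB// /L1_dist -RintegralZl//.
  apply: Rintegral_bound => //.
  - exact: integrableB_EFin.
  - exact: integrableZ_EFin.
  - by move=> x Ix; rewrite -mulrBl normrM mulrC ler_wpM2r// IM.
have lim3 : (fun n => w t L * psi L - w t 0 * psi 0 -
    (\int[leb]_(x in I) (stress L (an n t) (un n t) / a1 * Tn n t x * psi x) +
     \int[leb]_(x in I) (psi x * (stress L (an n t) (un n t) / a0 *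
       ((1 - Tn n t x) / eps n))))) @ \oo -->
    w t L * psi L - w t 0 * psi 0 -
    (\int[leb]_(x in I) (e t * psi x) + charge_int (p t) `[0, L] psi).
  apply: cvgB; first exact: cvg_cst.
  by apply: cvgD; [exact: e_cvg|apply: p_cvg => //; exact: continuous_subspaceT].
apply: cvgn_unique lim1 _; apply: cvg_trans lim3; apply: near_eq_cvg; apply: nearW => n.
have [en en1] := eps_small n.
by rewrite (green_eps L0 a00 a10 en Hw (evol n) tT cpsi).
Qed.

End green_formula_in_the_limit.

Section derivative_of_the_limit.
Context {R : realType}.
Local Notation leb := (@lebesgue_measure R).
Local Notation charges := (charge (measurableTypeR R) R).
Variables (L e wL w0 : R) (u : R -> R) (p : charges).
Hypotheses (L0 : 0 < L) (uBV : BV L u) (pL : bounded_radon `[0, L] p).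
Local Notation I := (`]0, L[%classic : set R).
Local Notation J := (`[0, L]%classic : set R).
Hypothesis green : forall psi, C1 psi ->
  \int[leb]_(x in I) (u x * derive1 psi x) =
  wL * psi L - w0 * psi 0 -
  (\int[leb]_(x in I) (e * psi x) + charge_int p J psi).

Let mI : measurable I. Proof. exact: measurable_itv. Qed.
Let lebI : leb I = L%:E.
Proof. by rewrite leb_oo ?ltW// subr0. Qed.
Let Ioo : (leb I < +oo)%E. Proof. by rewrite lebI ltry. Qed.

Let mJ : measurable J. Proof. exact: measurable_itv. Qed.

Let mi (i : interval R) : measurable ([set` i] : set R).
Proof. exact: measurable_itv. Qed.

Lemma Du_measure_derivative : measure_derivative L u (Du L u).
Proof.
rewrite /Du; case: pselect => [h|[]]; first by case: cid.
by case: uBV.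
Qed.

Lemma Du_test phi : test_fun I phi ->
  charge_int (Du L u) I phi = \int[leb]_(x in I) (e * phi x) + charge_int p J phi.
Proof.
move=> tphi; have [_ H] := Du_measure_derivative.
have out x : ~ I x -> phi x = 0 by move=> nx; have [] := test_fun_eq0 tphi nx.
have := green (test_fun_C1 tphi); rewrite H// !out ?mulr0 ?subr0 ?sub0r.
- by move=> /oppr_inj.
- by rewrite /= in_itv/= ltxx.
- by rewrite /= in_itv/= ltxx andbF.
Qed.

(** Tests vanishing at the endpoints do not see the boundary values, and bumps
    approximate the interval. *)
Lemma Du_interval a b : 0 <= a -> a < b -> b <= L ->
  fine (Du L u `]a, b[) = e * (b - a) + fine (p `]a, b[).
Proof.
move=> a0 ab bL; pose A := (`]a, b[%classic : set R).
have AI : A `<=` I.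
  move=> x; rewrite /A /= !in_itv/= => /andP[h1 h2].
  by rewrite (le_lt_trans a0 h1) (lt_le_trans h2 bL).
have AJ : A `<=` J.
  by move=> x /AI; rewrite /= !in_itv/= => /andP[h1 h2]; rewrite !ltW.
have [phi [tphi _ phi01 lim]] := bump_seq ab.
have tI n : test_fun I (phi n) by apply: test_funS (tphi n).
have mphi n D : measurable_fun D (phi n).
  by apply: measurable_funS (continuous_measurable_fun (test_fun_continuous (tphi n))).
have phi1 n x : `|phi n x| <= 1.
  by have /andP[h1 h2] := phi01 n x; rewrite ger0_norm.
have mA (D : set R) : measurable_fun D (\1_A : R -> R).
  exact: (@measurable_indic _ R R D _ (mi _)).
have limD : (fun n => charge_int (Du L u) I (phi n)) @ \oo --> charge_int (Du L u) I (\1_A).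
  exact: (charge_int_cvg mI (fun n => mphi n I) (mA I) (fun x _ => lim x)
    (fun n x _ => phi1 n x)).
have limp : (fun n => charge_int p J (phi n)) @ \oo --> charge_int p J (\1_A).
  exact: (charge_int_cvg mJ (fun n => mphi n J) (mA J) (fun x _ => lim x)
    (fun n x _ => phi1 n x)).
have [_ lime] : leb.-integrable I (EFin \o \1_A) /\
    (fun n => \int[leb]_(x in I) phi n x) @ \oo --> \int[leb]_(x in I) (\1_A x : R).
  have i1 : leb.-integrable I (EFin \o (fun=> 1)) by exact: integrable_cst_bounded.
  have ael : {ae leb, forall x, I x -> phi ^~ x @ \oo --> (\1_A x : R)}.
    by apply: aeW => x _; exact: lim.
  exact: (@Rintegral_dominated_cvg _ _ R leb phi (\1_A) (fun=> 1) I mI (fun n => mphi n I)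
    (mA I) ael i1 (fun n x _ => phi1 n x)).
have indE : \int[leb]_(x in I) (\1_A x : R) = b - a.
  rewrite /Rintegral integral_indic//; last exact: measurable_itv.
  by rewrite (setIidl AI); apply: (@etrans _ _ (fine (b - a)%:E)) => //; congr fine; apply: leb_oo; exact: ltW.
rewrite indE in lime.
have mAR : measurable (A : set (measurableTypeR R)) by exact: measurable_itv.
have -> : fine (Du L u `]a, b[) = charge_int (Du L u) I (\1_A).
  by rewrite charge_int_indic// (setIidl AI).
have -> : fine (p `]a, b[) = charge_int p J (\1_A).
  by rewrite charge_int_indic// (setIidl AJ).
apply: cvgn_unique limD _.
have lim2 : (fun n => e * \int[leb]_(x in I) phi n x + charge_int p J (phi n)) @ \oo -->
    e * (b - a) + charge_int p J \1_A.
  by apply: cvgD => //; apply: cvgM => //; exact: cvg_cst.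
apply: cvg_trans lim2; apply: near_eq_cvg; apply: nearW => n.
rewrite Du_test// RintegralZl//.
apply: (@le_integrable_leb _ _ (fun=> 1)) => //.
exact: integrable_cst_bounded.
Qed.

(** Both sides are charges that agree on open intervals. *)
Lemma DuE A : measurable A -> A `<=` I ->
  Du L u A = (\int[leb]_(x in A) e%:E + p A)%E.
Proof.
move=> mA AI.
pose lebI' : {finite_measure set (measurableTypeR R) -> \bar R} :=
  @mfrestr _ (measurableTypeR R) R I leb mI Ioo.
pose lebm := charge_of_finite_measure lebI'.
pose N := cadd (cadd (Du L u) (copp p)) (copp (cscale e lebm)).
have NE B : measurable B -> fine (N B) = fine (Du L u B) - fine (p B) - e * fine (leb (B `&` I)).
  move=> mB; have fl : leb (B `&` I) \is a fin_num.
    rewrite ge0_fin_numE// (le_lt_trans _ Ioo)// le_measure// ?inE//.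
    exact: measurableI.
  have fD : Du L u B \is a fin_num by exact: fin_num_measure.
  have fp : p B \is a fin_num by exact: fin_num_measure.
  have -> : N B = (Du L u B - p B - e%:E * leb (B `&` I))%E by [].
  by rewrite -(fineK fD) -(fineK fp) -(fineK fl).
have N0 a b : a < b -> fine (N (`]a, b[ `&` I)) = 0.
  move=> ab; pose a' := Num.max a 0; pose b' := Num.min b L.
  have E : (`]a, b[ `&` I = `]a', b'[)%classic.
    apply/seteqP; split => x /=; rewrite !in_itv/= gt_max lt_min.
      by move=> [/andP[-> ->] /andP[-> ->]].
    by move=> /andP[/andP[-> ->] /andP[-> ->]].
  rewrite NE; last by apply: measurableI => //; exact: measurable_itv.
  rewrite -setIA setIid E.
  have [a'b'|b'a'] := ltP a' b'; last first.
    by rewrite set_itv_ge ?bnd_simp -?leNgt// !charge0 measure0 mulr0 !subr0.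
  rewrite Du_interval//.
  - by rewrite leb_oo ?ltW//=; ring.
  - by rewrite le_max lexx orbT.
  - by rewrite ge_min lexx orbT.
have N_ge0 : (0 <= N A)%E.
  by apply: (@charge_ge0_of_open _ N I) mA AI => // a b ab; rewrite N0.
have N_le0 : (0 <= copp N A)%E.
  apply: (@charge_ge0_of_open _ (copp N) I) mA AI => // a b ab.
  have mB : measurable (`]a, b[ `&` I : set (measurableTypeR R)).
    by apply: measurableI => //; exact: measurable_itv.
  have fN : N (`]a, b[ `&` I) \is a fin_num by exact: fin_num_measure.
  suff h : 0 <= fine (- N (`]a, b[ `&` I))%E by exact: h.
  by rewrite fineN N0// oppr0.
have NA : N A = 0%E.
  by apply/eqP; rewrite eq_le N_ge0 andbT -oppe_ge0; exact: N_le0.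
have := NE A mA; rewrite NA/= (setIidl AI) => /esym/eqP; rewrite subr_eq0 subr_eq => /eqP E.
have fD : Du L u A \is a fin_num by exact: fin_num_measure.
have fp : p A \is a fin_num by exact: fin_num_measure.
have fl : leb A \is a fin_num.
  by rewrite ge0_fin_numE// (le_lt_trans _ Ioo)// le_measure// ?inE.
have -> : (\int[leb]_(x in A) e%:E = (e * fine (leb A))%:E)%E.
  by rewrite integral_cst// EFinM fineK.
by rewrite -(fineK fD) -(fineK fp) E -EFinD.
Qed.

End derivative_of_the_limit.

(** * The limit displacement almost everywhere *)

Section distribution_function.
Context {R : realType}.
Local Notation leb := (@lebesgue_measure R).
Local Notation fmeasure := {finite_measure set (measurableTypeR R) -> \bar R}.
Variables (m : fmeasure) (phi : R -> R) (c d : R).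
Hypotheses (cphi : continuous phi) (phi0 : forall x, ~ (c <= x <= d) -> phi x = 0).

Let iphi (D : set R) : measurable D -> leb.-integrable D (EFin \o phi).
Proof. by move=> mD; exact: (integrable_compact_support cphi phi0 mD). Qed.

(** Fubini on the set of pairs with [0 <= y <= x]. *)
Lemma integral_mass_upto :
  \int[leb]_x (fine (m `[0, x]%classic) * phi x) =
  \int[m]_(y in `[0, +oo[) (\int[leb]_(x in `[y, +oo[) phi x).
Proof.
pose B := [set z : measurableTypeR R * measurableTypeR R | 0 <= z.2 /\ z.2 <= z.1].
have mB : measurable B.
  have mle (f g : measurableTypeR R * measurableTypeR R -> R) : measurable_fun setT f -> measurable_fun setT g ->
      measurable [set z | f z <= g z].
    move=> mf mg; rewrite -[X in measurable X]setTI.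
    have h := measurable_fun_ler mf mg measurableT (Y := [set true]).
    exact: h.
  apply: measurableI; first exact: (mle (cst 0) snd).
  exact: (mle snd fst).
pose f (z : measurableTypeR R * measurableTypeR R) := (phi z.1 * \1_B z)%:E.
have mf : measurable_fun setT f.
  apply/measurable_EFinP; apply: measurable_funM; last exact: measurable_indic.
  by apply: measurableT_comp => //; exact: continuous_measurable_fun.
have inB (x y : R) : (\1_B (x, y) : R) = \1_(`[0, x]%classic : set R) y.
  rewrite !indicE; congr ((nat_of_bool _)%:R); apply/idP/idP; rewrite !inE /B/= in_itv/=.
    by move=> [-> ->].
  by move=> /andP[].
have mi (i : interval R) : measurable ([set` i] : set (measurableTypeR R)).
  exact: measurable_itv.
have im1 (A : set (measurableTypeR R)) : measurable A ->
    m.-integrable setT (EFin \o (\1_A : R -> R)).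
  move=> mA; apply: (@le_integrableR _ _ _ _ _ (cst 1)) => //.
  - by move=> x _; rewrite indicE; case: (x \in A); rewrite ?normr1 ?normr0.
  - exact: finite_measure_integrable_cst.
have secm (c' x : R) : (\int[m]_y (c' * \1_B (x, y))%:E =
    (fine (m `[0%R, x]%classic) * c')%:E)%E.
  under eq_integral do rewrite inB EFinM.
  rewrite (integralZl _ (im1 _ (mi _)))// integral_indic ?setIT//.
  by rewrite -[X in (_ * X)%E](fineK (fin_num_measure m _ (mi _))) -EFinM mulrC.
have mT0 : (0 <= m setT)%E by exact: measure_ge0.
have imf : (leb \x m)%E.-integrable setT f.
  apply: (@integrable12ltyP _ _ (measurableTypeR R) (measurableTypeR R) R leb m f mf).2.
  apply: (@le_lt_trans _ _ (\int[leb]_x (fine (m setT) * `|phi x|)%:E)%E); last first.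
    have /integrableP[_] : leb.-integrable setT (EFin \o (fun x => fine (m setT) * `|phi x|)).
      by apply: integrableZ_EFin => //; apply: integrable_norm => //; exact: iphi.
    apply: le_lt_trans; apply: ge0_le_integral => //.
    - by move=> x _; rewrite lee_fin mulr_ge0// fine_ge0.
    - apply/measurable_EFinP; apply: measurable_funM => //.
      apply: measurableT_comp => //; exact: continuous_measurable_fun.
    - apply: measurableT_comp => //; apply/measurable_EFinP; apply: measurable_funM => //.
      apply: measurableT_comp => //; exact: continuous_measurable_fun.
    - by move=> x _; rewrite lee_fin ler_norm.
  apply: ge0_le_integral => //.
  - by move=> x _; apply: integral_ge0.
  - apply: (measurable_fun_fubini_tonelli_F (m2 := m) (abse \o f)) => //=.
    exact: measurableT_comp.
  - apply/measurable_EFinP; apply: measurable_funM => //.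
    apply: measurableT_comp => //; exact: continuous_measurable_fun.
  - move=> x _.
    have normE y : (`|f (x, y)| = (`|phi x| * \1_B (x, y))%:E)%E.
      by rewrite /= normrM (ger0_norm (_ : 0 <= \1_B (x, y))).
    under eq_integral do rewrite normE.
    rewrite secm lee_fin ler_wpM2r//; apply: fine_le.
    - exact: (fin_num_measure m _ (mi _)).
    - exact: fin_num_measure.
    - by apply: le_measure; rewrite ?inE//; exact: mi.
have := Fubini imf; rewrite /f/=.
under eq_integral do rewrite secm.
move=> E; rewrite /Rintegral E.
congr fine; rewrite [RHS]integral_mkcond; apply: eq_integral => y _.
rewrite patchE; case: ifPn => [|/negP]; rewrite inE/= in_itv/= andbT => y0.
  rewrite /Rintegral fineK; last by apply: integrable_fin_num => //; exact: iphi.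
  rewrite [RHS]integral_mkcond; apply: eq_integral => x _.
  rewrite patchE indicE; case: ifPn => [|/negP]; rewrite inE/= in_itv/= andbT => yx.
    by rewrite mem_set ?mulr1//; split.
  by rewrite memNset ?mulr0// => -[].
apply: integral0_eq => x _.
by rewrite indicE memNset ?mulr0// => -[].
Qed.

End distribution_function.

Section pointwise_formula.
Context {R : realType}.
Local Notation leb := (@lebesgue_measure R).
Local Notation charges := (charge (measurableTypeR R) R).
Local Notation fmeasure := {finite_measure set (measurableTypeR R) -> \bar R}.
Variables (L e wL w0 : R) (u : R -> R) (p : charges).
Hypotheses (L0 : 0 < L) (uL1 : L1 `]0, L[ u).
Local Notation I := (`]0, L[%classic : set R).
Local Notation J := (`[0, L]%classic : set R).
Hypothesis green : forall psi, C1 psi ->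
  \int[leb]_(x in I) (u x * derive1 psi x) =
  wL * psi L - w0 * psi 0 -
  (\int[leb]_(x in I) (e * psi x) + charge_int p J psi).

Let mI : measurable I. Proof. exact: measurable_itv. Qed.
Let mJ : measurable J. Proof. exact: measurable_itv. Qed.
Let lebI : leb I = L%:E.
Proof. by rewrite leb_oo ?ltW// subr0. Qed.
Let Ioo : (leb I < +oo)%E. Proof. by rewrite lebI ltry. Qed.

Let mi (i : interval R) : measurable ([set` i] : set (measurableTypeR R)).
Proof. exact: measurable_itv. Qed.

(** The distribution function on [`[0, L]], counting an atom at the left
    endpoint. *)
Definition mass_upto (m : set (measurableTypeR R) -> \bar R) (x : R) : R :=
  fine (m `[0, x]%classic).

Lemma measurable_mass_upto (m : fmeasure) (D : set R) : measurable_fun D (mass_upto m).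
Proof.
apply: (@measurable_funS _ _ _ _ setT) => //.
apply: nondecreasing_measurable => // x y xy; apply: fine_le.
- exact: (fin_num_measure m _ (mi _)).
- exact: (fin_num_measure m _ (mi _)).
- apply: le_measure; rewrite ?inE; [exact: mi|exact: mi|].
  by move=> z /=; rewrite !in_itv/= => /andP[-> zx]; rewrite (le_trans zx).
Qed.

Lemma mass_upto_bound (m : fmeasure) x : `|mass_upto m x| <= fine (m setT).
Proof.
rewrite ger0_norm; last by apply: fine_ge0; exact: measure_ge0.
apply: fine_le.
- exact: (fin_num_measure m _ (mi _)).
- exact: fin_num_measure.
- by apply: le_measure; rewrite ?inE; [exact: mi|exact: measurableT|].
Qed.

Lemma charge_mass_upto x :
  mass_upto p x = mass_upto (jordan_pos (hahn p)) x - mass_upto (jordan_neg (hahn p)) x.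
Proof.
rewrite /mass_upto (charge_jordanE p (mi _)) fineB//.
- exact: (fin_num_measure (jordan_pos (hahn p)) _ (mi _)).
- exact: (fin_num_measure (jordan_neg (hahn p)) _ (mi _)).
Qed.

Let mcdf (D : set R) : measurable_fun D (mass_upto p).
Proof.
rewrite (_ : mass_upto p = fun x => mass_upto (jordan_pos (hahn p)) x - mass_upto (jordan_neg (hahn p)) x).
  by apply: measurable_funB; exact: measurable_mass_upto.
by apply/funext => x; exact: charge_mass_upto.
Qed.

Let cdf_p_bound : exists M, forall x, `|mass_upto p x| <= M.
Proof.
exists (fine (jordan_pos (hahn p) setT) + fine (jordan_neg (hahn p) setT)) => x.
by rewrite charge_mass_upto (le_trans (ler_normB _ _))// lerD// mass_upto_bound.
Qed.

(** Fubini for the plastic strain, through its Jordan parts. *)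
Lemma integral_primitive_tail phi : inner_test 0 L phi ->
  \int[leb]_(x in I) (mass_upto p x * phi x) =
  charge_int p J (fun y => \int[leb]_(x in `[y, +oo[) phi x).
Proof.
move=> [tphi [c [d [c0 cd dL out]]]]; have cphi := test_fun_continuous tphi.
pose psi y := \int[leb]_(x in `[y, +oo[) phi x.
have tail y : ~ J y -> (0 <= y) -> psi y = 0.
  move=> nJ y0; have Ly : L < y.
    by rewrite ltNge; apply/negP => yL; apply: nJ; rewrite /= in_itv/= y0.
  rewrite /psi (@eq_Rintegral _ _ _ _ _ (fun=> 0)) ?Rintegral_cst ?mul0r//.
  move=> x; rewrite inE/= in_itv/= andbT => yx; apply: out => /andP[_ xd].
  by move: (lt_trans dL Ly); rewrite ltNge (le_trans yx).
have one (m : fmeasure) : \int[leb]_(x in I) (mass_upto m x * phi x) = \int[m]_(y in J) psi y.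
  rewrite -(@Rintegral_supported _ _ I); last first.
    by move=> x nI; rewrite (test_fun_eq0 tphi nI).1 mulr0.
  apply: etrans (integral_mass_upto m cphi out) _.
  rewrite Rintegral_mkcond [RHS]Rintegral_mkcond; apply: eq_Rintegral => y _.
  rewrite !patchE; case: ifPn => [|/negP]; rewrite inE/= in_itv/= andbT => y0.
    by case: ifPn => // /negP; rewrite inE => nJ; rewrite -/(psi y) tail.
  have nJ : ~ J y by rewrite /= in_itv/= => /andP[].
  by rewrite memNset.
have im (m : fmeasure) : leb.-integrable I (EFin \o (fun x => mass_upto m x * phi x)).
  have iphi : leb.-integrable I (EFin \o phi).
    exact: (integrable_compact_support cphi out mI).
  under [X in EFin \o X]eq_fun do rewrite mulrC.
  apply: (@integrable_mul_bounded _ _ _ leb _ _ (fine (m setT))) => //.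
    exact: measurable_mass_upto.
  by move=> x _; exact: mass_upto_bound.
rewrite /charge_int -!one -RintegralB//.
by apply: eq_Rintegral => x _; rewrite charge_mass_upto mulrBl.
Qed.

(** Use the Green formula for the primitive [psi] of [- phi] vanishing at [L]: the
    plastic term becomes the integral of [phi] against the distribution function
    of [p], and the elastic term the first moment of [phi]. *)
Lemma displacement_formula : {ae leb, forall x, I x -> u x = w0 + e * x + mass_upto p x}.
Proof.
pose f x := u x - (w0 + e * x + mass_upto p x).
have icdf : leb.-integrable I (EFin \o mass_upto p).
  have [M HM] := cdf_p_bound.
  apply: (@le_integrable_leb _ _ (fun=> M)) => //.
  exact: integrable_cst_bounded.
have ix : leb.-integrable I (EFin \o (fun x => w0 + e * x)).
  apply: (@le_integrable_leb _ _ (fun=> `|w0| + `|e| * L)) => //.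
  - by apply: measurable_funD => //; exact: measurable_funM.
  - move=> x; rewrite /= in_itv/= => /andP[x0 xL].
    rewrite (le_trans (ler_normD _ _))// lerD2l normrM ler_wpM2l//.
    by rewrite ger0_norm ltW.
  - exact: integrable_cst_bounded.
have irep : leb.-integrable I (EFin \o (fun x => w0 + e * x + mass_upto p x)).
  exact: integrableD_EFin.
have ifI : leb.-integrable I (EFin \o f) by exact: integrableB_EFin.
suff h : {ae leb, forall x, I x -> f x = 0}.
  by apply: ae_imp h => x h Ix; apply/eqP; rewrite -subr_eq0; apply/eqP; exact: h.
apply: (ae0_of_test ifI) => phi iphi; have [tphi [c [d [c0 cd dL out]]]] := iphi.
have cphi := test_fun_continuous tphi.
have [dF F' F0 F1] := primitive_C1 cphi out cd.
set F := (fun x => _) in dF F' F0 F1.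
have iph (D : set R) : measurable D -> leb.-integrable D (EFin \o phi).
  by move=> mD; exact: (integrable_compact_support cphi out mD).
pose psi y := \int[leb]_(x in `[y, +oo[) phi x.
have psiE y : psi y = \int[leb]_x phi x - F y.
  have -> : \int[leb]_x phi x = F y + \int[leb]_(x in `]y, +oo[) phi x.
    rewrite /F -Rintegral_setU//=.
    - by rewrite -(itv_setU_setT false y).
    - by apply: iph; apply: measurableU => //; exact: measurable_itv.
    - apply/disj_setPS => x []; rewrite /= !in_itv/= andbT => h1 h2.
      by move: h2; rewrite ltNge h1.
  rewrite addrAC subrr add0r Rintegral_itv_obnd_cbnd//; apply: iph; exact: measurable_itv.
have psiF : psi = fun y => \int[leb]_x phi x - F y by apply/funext => y; exact: psiE.
have CF : C1 F by split; [exact: dF|rewrite F'; exact: cphi].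
have [Cpsi dpsi] : C1 psi /\ derive1 psi = (fun y => - phi y).
  have C1c : C1 (fun=> \int[leb]_x phi x).
    split; first by move=> x; exact: derivable_cst.
    by rewrite (_ : derive1 _ = cst 0) ?funeqE//; [move=> x; exact: cvg_cst|move=> x; rewrite derive1_cst].
  have [h1 h2] := C1B C1c CF; rewrite psiF; split => //.
  by rewrite h2; apply/funext => y; rewrite derive1_cst F' sub0r.
have psiL : psi L = 0.
  rewrite /psi (@eq_Rintegral _ _ _ _ _ (fun=> 0)) ?Rintegral_cst ?mul0r//.
  move=> x; rewrite inE/= in_itv/= andbT => Lx; apply: out => /andP[_ xd].
  by move: dL; rewrite ltNge (le_trans Lx).
have psi0 : psi 0 = \int[leb]_(x in I) phi x.
  have F00 : F 0 = 0 by apply: F0; exact: ltW.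
  rewrite psiE F00 subr0; apply: Rintegral_supported => x nI.
  by rewrite (test_fun_eq0 tphi nI).1.
have Cid : C1 (fun x : R => x).
  split; first by move=> x; exact: derivable_id.
  have -> : derive1 (fun x : R => x) = (fun _ : R => 1 : R).
    by apply/funext => x; rewrite derive1_id.
  by move=> x; exact: cvg_cst.
have ipsi : leb.-integrable I (EFin \o psi).
  apply: L2_L1 => //; apply: continuous_L2_I => //; exact: C1_continuous.
have ixphi : leb.-integrable I (EFin \o (fun x => x * phi x)).
  apply: (@integrable_compact_support _ _ c d) => //.
    by move=> x; apply: cvgM; [exact: cvg_id|exact: cphi].
  by move=> x /out ->; rewrite mulr0.
have moment : \int[leb]_(x in I) psi x = \int[leb]_(x in I) (x * phi x).
  have [Cx dx] := C1M Cid Cpsi.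
  have [+ _] := C1_FTC Cx L0; rewrite dx psiL mulr0 mul0r subrr dpsi.
  rewrite (_ : (fun x => _) = (fun x => psi x - x * phi x)); last first.
    by apply/funext => x; rewrite derive1_id mul1r mulrN.
  by rewrite RintegralB// => /eqP; rewrite subr_eq0 => /eqP.
have := green Cpsi; rewrite dpsi psiL psi0 mulr0 sub0r.
rewrite -(integral_primitive_tail iphi) RintegralZl// moment => G.
have ipI := iph I mI.
have icphi : leb.-integrable I (EFin \o (fun x => mass_upto p x * phi x)).
  have [M HM] := cdf_p_bound.
  have h : leb.-integrable I (EFin \o (fun x => phi x * mass_upto p x)).
    apply: (@integrable_mul_bounded _ _ _ leb _ _ M) => //; exact: mcdf.
  by rewrite (_ : (fun x => _) = (fun x => phi x * mass_upto p x))//; apply/funext => x; rewrite mulrC.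
have iuphi : leb.-integrable I (EFin \o (fun x => u x * phi x)).
  have [M HM] := test_fun_bounded tphi.
  apply: (@integrable_mul_bounded _ _ _ leb _ _ M) => //.
    by apply: measurable_funS (continuous_measurable_fun cphi).
  by move=> x _; have [] := HM x.
have i0 : leb.-integrable I (EFin \o (fun x => w0 * phi x)) by exact: integrableZ_EFin.
have i1 : leb.-integrable I (EFin \o (fun x => e * (x * phi x))) by exact: integrableZ_EFin.
have i01 : leb.-integrable I (EFin \o (fun x => w0 * phi x + e * (x * phi x))).
  exact: integrableD_EFin.
have i012 : leb.-integrable I (EFin \o (fun x => w0 * phi x + e * (x * phi x) + mass_upto p x * phi x)).
  exact: integrableD_EFin.
rewrite (_ : (fun x => _) = (fun x => u x * phi x -
    (w0 * phi x + e * (x * phi x) + mass_upto p x * phi x))); last first.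
  by apply/funext => x; rewrite /f; ring.
rewrite RintegralB// RintegralD// RintegralD// !RintegralZl//.
have {}G : - (\int[leb]_(x in I) (u x * phi x)) = - (w0 * \int[leb]_(x in I) phi x) -
    (e * \int[leb]_(x in I) (x * phi x) + \int[leb]_(x in I) (mass_upto p x * phi x)).
  rewrite -G -RintegralN//; apply: eq_Rintegral => x _; by rewrite mulrN.
by move/eqP: G; rewrite -opprD eqr_opp => /eqP ->; rewrite addrA subrr.
Qed.

End pointwise_formula.

(** * Traces of the limit displacement *)

Section shrinking_sets.
Context {R : realType}.
Local Notation fmeasure := {finite_measure set (measurableTypeR R) -> \bar R}.

(** Continuity from above along the sequence of radii [1 / (n + 1)]; monotonicity
    transfers it to all radii. *)
Lemma shrinking_mass (m : fmeasure) (A : R -> set (measurableTypeR R)) :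
  (forall r, measurable (A r)) -> (forall r s, 0 < r -> r <= s -> A r `<=` A s) ->
  \bigcap_n A n.+1%:R^-1 = set0 ->
  (fun r => fine (m (A r))) @ 0^'+ --> (0 : R).
Proof.
move=> mA nd A0.
have cv : (m \o (fun n => A n.+1%:R^-1)) @ \oo --> 0%E.
  rewrite -(measure0 m) -A0; apply: nonincreasing_cvg_mu => //.
  - by rewrite ltey_eq fin_num_measure.
  - by rewrite A0.
  - move=> i j ij; apply/subsetPset; apply: nd; first by rewrite invr_gt0.
    by rewrite lef_pV2 ?posrE ?ltr0n// ler_nat.
have cv' : (fun n => fine (m (A n.+1%:R^-1))) @ \oo --> (0 : R).
  exact: (fine_cvg cv).
apply/cvgrPdist_le => d d0.
have /cvgrPdist_le /(_ d d0) [N _ HN] := cv'.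
have N0 : (0 : R) < N.+1%:R^-1 by rewrite invr_gt0.
near=> r.
have r0 : 0 < r by near: r; exact: nbhs_right_gt.
have rN : r <= N.+1%:R^-1 by near: r; exact: nbhs_right_le.
have := HN N (leqnn N); apply: le_trans; rewrite !sub0r !normrN.
rewrite !ger0_norm ?fine_ge0 ?measure_ge0//; apply: fine_le; try exact: fin_num_measure.
by apply: le_measure; rewrite ?inE//; exact: nd.
Unshelve. all: by end_near. Qed.

End shrinking_sets.

Section inner_trace.
Context {R : realType}.
Local Notation leb := (@lebesgue_measure R).
Variables (L : R) (S : R -> set R) (u v beta : R -> R) (c : R).
Hypotheses (L0 : 0 < L) (mS : forall r, measurable (S r)).
Hypothesis lebS : forall r, 0 < r -> leb (S r) = r%:E.
Hypothesis mv : forall r, measurable_fun (S r) v.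
Hypothesis uv : forall r, 0 < r -> r < L -> {ae leb, forall x, S r x -> u x = v x}.
Hypothesis vc : forall r, 0 < r -> r < L -> forall x, S r x -> `|v x - c| <= beta r.
Hypothesis beta0 : beta @ 0^'+ --> (0 : R).

Let T c' := (fun r => r^-1 * \int[leb]_(x in S r) `|u x - c'|) @ 0^'+ --> (0 : R).

Let meanE c' r : 0 < r -> r < L ->
  \int[leb]_(x in S r) `|u x - c'| = \int[leb]_(x in S r) `|v x - c'|.
Proof.
by move=> r0 rL; apply: Rintegral_ae_congr; apply: ae_imp (uv r0 rL) => x h Sx; rewrite h.
Qed.

Let Soo r : 0 < r -> (leb (S r) < +oo)%E.
Proof. by move=> r0; rewrite lebS// ltry. Qed.

Let iv c' r : 0 < r -> r < L ->
  leb.-integrable (S r) (EFin \o (fun x => `|v x - c'|)).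
Proof.
move=> r0 rL; apply: (@le_integrable_leb _ _ (fun=> beta r + `|c - c'|)) => //.
- by apply: measurableT_comp => //; exact: measurable_funB.
- move=> x Sx; rewrite normr_id.
  have -> : v x - c' = (v x - c) + (c - c') by rewrite addrA subrK.
  by rewrite (le_trans (ler_normD _ _))// lerD2r vc.
- by apply: integrable_cst_bounded => //; exact: Soo.
Qed.

Let mean_bound r : 0 < r -> r < L ->
  r^-1 * \int[leb]_(x in S r) `|v x - c| <= beta r.
Proof.
move=> r0 rL; rewrite ler_pdivrMl//.
have -> : r * beta r = \int[leb]_(x in S r) beta r.
  by rewrite (Rintegral_cst_leb _ (mS r) (lebS r0)) mulrC.
have i1 := iv c r0 rL.
have i2 : leb.-integrable (S r) (EFin \o (fun=> beta r)).
  by apply: integrable_cst_bounded => //; exact: Soo.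
exact: (@le_Rintegral _ _ R leb (S r) (fun x => `|v x - c|) (fun=> beta r) (mS r) i1 i2
  (vc r0 rL)).
Qed.

(** The mean oscillation around [c] tends to zero, and it cannot do so around two
    different values. *)
Lemma inner_trace_eq : xget 0 [set c' | T c'] = c.
Proof.
have near0 : \forall r \near (0 : R)^'+, 0 < r /\ r < L.
  by near=> r; split; near: r; [exact: nbhs_right_gt|exact: nbhs_right_lt].
have Tc : T c.
  apply/cvgrPdist_le => d d0.
  have /cvgrPdist_le /(_ d d0) := beta0; apply: filterS2 near0 => r [r0 rL].
  rewrite !sub0r !normrN => h; apply: le_trans (le_trans (ler_norm _) h).
  rewrite meanE// ger0_norm; first exact: mean_bound.
  by rewrite mulr_ge0 ?invr_ge0 ?(ltW r0)//; apply: Rintegral_ge0.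
apply: xget_unique => // c' Tc'.
apply/eqP; rewrite -subr_eq0 -normr_le0.
have lim : (fun r => r^-1 * (\int[leb]_(x in S r) `|u x - c'|) + beta r) @ 0^'+ --> (0 : R).
  by rewrite -[X in _ --> X]addr0; apply: cvgD.
apply: (@ler_cvg_to R 0^'+ _ R (cst `|c' - c|)) lim _ => //; first exact: cvg_cst.
apply: filterS near0 => r [r0 rL] /=; rewrite meanE//.
rewrite -(ler_pM2l r0) mulrDr mulVKf ?gt_eqF//.
have -> : r * `|c' - c| = \int[leb]_(x in S r) `|c' - c|.
  by rewrite (Rintegral_cst_leb _ (mS r) (lebS r0)) mulrC.
have -> : r * beta r = \int[leb]_(x in S r) beta r.
  by rewrite (Rintegral_cst_leb _ (mS r) (lebS r0)) mulrC.
have ib (k : R) : leb.-integrable (S r) (EFin \o (fun=> k)).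
  by apply: integrable_cst_bounded => //; exact: Soo.
have i2 : leb.-integrable (S r) (EFin \o (fun x => `|v x - c'|)) by exact: iv.
have i3 : leb.-integrable (S r) (EFin \o (fun x => `|v x - c'| + beta r)).
  exact: (@integrableD_EFin _ _ R leb (fun x => `|v x - c'|) (fun=> beta r) _ (mS r) i2 (ib _)).
rewrite -(@RintegralD _ _ R leb (S r) (fun x => `|v x - c'|) (fun=> beta r) (mS r) i2 (ib (beta r))).
apply: (@le_Rintegral _ _ R leb (S r) (fun=> `|c' - c|)
  (fun x => `|v x - c'| + beta r) (mS r) (ib _) i3) => x Sx.
 have -> : c' - c = - (v x - c') + (v x - c) by ring.
by rewrite (le_trans (ler_normD _ _))// normrN lerD2l vc.
Unshelve. all: by end_near. Qed.

End inner_trace.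

Section traces_of_the_displacement.
Context {R : realType}.
Local Notation leb := (@lebesgue_measure R).
Local Notation charges := (charge (measurableTypeR R) R).
Local Notation fmeasure := {finite_measure set (measurableTypeR R) -> \bar R}.
Variables (L e wL w0 : R) (u : R -> R) (p : charges).
Hypotheses (L0 : 0 < L) (uL1 : L1 `]0, L[ u).
Local Notation I := (`]0, L[%classic : set R).
Local Notation J := (`[0, L]%classic : set R).
Hypothesis green : forall psi, C1 psi ->
  \int[leb]_(x in I) (u x * derive1 psi x) =
  wL * psi L - w0 * psi 0 -
  (\int[leb]_(x in I) (e * psi x) + charge_int p J psi).

Let mi (i : interval R) : measurable ([set` i] : set (measurableTypeR R)).
Proof. exact: measurable_itv. Qed.

Let fin_cut (m : fmeasure) (A B C : set (measurableTypeR R)) :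
  measurable A -> measurable B -> A `&` B = set0 -> C = A `|` B ->
  fine (m C) = fine (m A) + fine (m B).
Proof.
move=> mA mB AB ->.
have -> : m (A `|` B) = (m A + m B)%E by exact: measureU.
by rewrite fineD// fin_num_measure.
Qed.

Let fin_mono (m : fmeasure) (A B : set (measurableTypeR R)) :
  measurable A -> measurable B -> A `<=` B -> 0 <= fine (m A) <= fine (m B).
Proof.
move=> mA mB AB; apply/andP; split; first by apply: fine_ge0; exact: measure_ge0.
by apply: fine_le; [exact: fin_num_measure|exact: fin_num_measure|apply: le_measure; rewrite ?inE].
Qed.

Let P : fmeasure := jordan_pos (hahn p).
Let N : fmeasure := jordan_neg (hahn p).

Let pE A : measurable A -> fine (p A) = fine (P A) - fine (N A).
Proof.
move=> mA; rewrite (charge_jordanE p mA) fineB//.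
- exact: (fin_num_measure P _ mA).
- exact: (fin_num_measure N _ mA).
Qed.

Let v x := w0 + e * x + mass_upto p x.

Let mv (D : set R) : measurable_fun D v.
Proof.
apply: measurable_funD.
  by apply: measurable_funD => //; exact: measurable_funM.
rewrite (_ : mass_upto p = fun x => mass_upto (jordan_pos (hahn p)) x - mass_upto (jordan_neg (hahn p)) x).
  by apply: measurable_funB; exact: measurable_mass_upto.
by apply/funext => x; exact: charge_mass_upto.
Qed.

Let uv (D : set R) : D `<=` I -> {ae leb, forall x, D x -> u x = v x}.
Proof.
move=> DI; apply: ae_imp (displacement_formula L0 uL1 green) => x h Dx.
exact/h/DI.
Qed.

Let lin_cvg : (fun r => `|e| * r) @ (0 : R)^'+ --> (0 : R).
Proof.
have h : (fun r => `|e| * r) @ (0 : R)^'+ --> `|e| * 0.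
  apply: cvgM; first exact: cvg_cst.
  exact: cvg_at_right_filter.
by rewrite mulr0 in h.
Qed.

(** Near [0] the displacement differs from [w0] by the atom of [p] at [0], up to
    the variation of [p] on [`]0, r[]. *)
Lemma trace0_eq : trace0 u = w0 + fine (p [set 0]).
Proof.
pose S r := (`]0, r[%classic : set R).
have capS : \bigcap_n (`]0, n.+1%:R^-1[%classic : set (measurableTypeR R)) = set0.
  apply/seteqP; split => // x h.
  have x0 : 0 < x by have := h 0%N Logic.I; rewrite /= in_itv/= => /andP[].
  have [n xn] : exists n : nat, n.+1%:R^-1 < x.
    exists (Num.bound x^-1); rewrite invf_plt ?posrE ?ltr0n//.
    rewrite -natr1 ltr_pwDr//; apply/ltW/archi_boundP; rewrite invr_ge0; exact: ltW.
  by have := h n Logic.I; rewrite /= in_itv/= x0/= ltNge (ltW xn).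
have shrink (m : fmeasure) : (fun r => fine (m `]0, r[%classic)) @ 0^'+ --> (0 : R).
  apply: (@shrinking_mass _ m (fun r => `]0, r[%classic)) => // r s r0 rs x /=.
  by rewrite !in_itv/= => /andP[-> /lt_le_trans ->].
apply: (@inner_trace_eq _ L S u v
  (fun r => `|e| * r + (fine (P `]0, r[%classic) + fine (N `]0, r[%classic)))) => //.
- by move=> r; exact: measurable_itv.
- by move=> r r0; rewrite leb_oo ?subr0// ltW.
- move=> r r0 rL; apply: uv => x; rewrite /S /= !in_itv/= => /andP[-> xr].
  exact: lt_trans rL.
- move=> r r0 rL x; rewrite /S /= in_itv/= => /andP[x0 xr].
  have cut (m : fmeasure) : fine (m `[0, x]%classic) =
      fine (m [set 0]) + fine (m `]0, x]%classic).
    apply: fin_cut; [exact: measurable_set1|exact: mi| |].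
    - by apply/seteqP; split => // y [/= ->]; rewrite in_itv/= ltxx.
    - apply/seteqP; split => y /=; rewrite !in_itv/=.
        by rewrite le_eqVlt => /andP[/predU1P[<- _|y0 yx]]; [left|right; rewrite y0].
      by move=> [->|/andP[y0 ->]]; rewrite ?lexx ?(ltW x0) ?(ltW y0).
  have small (m : fmeasure) : 0 <= fine (m `]0, x]%classic) <= fine (m `]0, r[%classic).
    apply: fin_mono; [exact: mi|exact: mi|] => y /=; rewrite !in_itv/= => /andP[-> yx].
    exact: le_lt_trans xr.
  have -> : v x - (w0 + fine (p [set 0])) =
      e * x + (fine (P `]0, x]%classic) - fine (N `]0, x]%classic)).
    by rewrite /v charge_mass_upto /mass_upto !cut -/P -/N pE//; ring.
  have /andP[P0 Pr] := small P; have /andP[N0 Nr] := small N.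
  rewrite (le_trans (ler_normD _ _))// lerD//.
    by rewrite normrM ler_wpM2l// ger0_norm ltW.
  by rewrite (le_trans (ler_normB _ _))// !ger0_norm// lerD.
- rewrite -[X in _ --> X]addr0; apply: cvgD; first exact: lin_cvg.
  by rewrite -[X in _ --> X]addr0; apply: cvgD; exact: shrink.
Qed.

(** The Green formula with [psi = 1]. *)
Lemma right_boundary_value : wL = w0 + e * L + fine (p J).
Proof.
have [C1c d1] := @C1_cst1 R.
have := green C1c; rewrite d1.
rewrite (_ : \int[leb]_(x in I) _ = 0); last first.
  under eq_Rintegral do rewrite mulr0.
  by rewrite Rintegral_cst ?mul0r//; exact: measurable_itv.
have lebI : leb I = L%:E by rewrite leb_oo ?subr0 ?ltW.
rewrite !mulr1 (Rintegral_cst_leb _ _ lebI); last exact: measurable_itv.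
have -> : charge_int p J (fun=> 1) = fine (p J).
  rewrite -[in RHS](setIid J) -charge_int_indic; [|exact: mi|exact: mi].
  by apply: charge_int_ext => x Jx; rewrite indicE mem_set.
by move=> h; lra.
Qed.

Lemma traceL_eq : traceL L u = wL - fine (p [set L]).
Proof.
pose S r := (`](L - r), L[%classic : set R).
have capS : \bigcap_n (`](L - n.+1%:R^-1), L[%classic : set (measurableTypeR R)) = set0.
  apply/seteqP; split => // x h.
  have x0 : 0 < L - x by have := h 0%N Logic.I; rewrite /= in_itv/= subr_gt0 => /andP[].
  have [n xn] : exists n : nat, n.+1%:R^-1 < L - x.
    exists (Num.bound (L - x)^-1); rewrite invf_plt ?posrE ?ltr0n//.
    rewrite -natr1 ltr_pwDr//; apply/ltW/archi_boundP; rewrite invr_ge0; exact: ltW.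
  have := h n Logic.I; rewrite /= in_itv/= => /andP[h1 _].
  by move: xn; rewrite ltNge => /negP; apply; rewrite lerBlDr -lerBlDl ltW.
have shrink (m : fmeasure) : (fun r => fine (m `](L - r), L[%classic)) @ 0^'+ --> (0 : R).
  apply: (@shrinking_mass _ m (fun r => `](L - r), L[%classic)) => // r s r0 rs x /=.
  rewrite !in_itv/= => /andP[h ->]; rewrite andbT; apply: le_lt_trans h.
  by rewrite lerD2l lerN2.
apply: (@inner_trace_eq _ L S u v
  (fun r => `|e| * r + (fine (P `](L - r), L[%classic) + fine (N `](L - r), L[%classic)))) => //.
- by move=> r; exact: measurable_itv.
- move=> r r0; have rL : L - r <= L by rewrite lerBlDr lerDl ltW.
  by rewrite (leb_oo rL) subKr.
- move=> r r0 rL; apply: uv => x; rewrite /S /= !in_itv/= => /andP[h ->]; rewrite andbT.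
  by apply: lt_trans h; rewrite subr_gt0.
- move=> r r0 rL x; rewrite /S /= in_itv/= => /andP[rx xL].
  have x0 : 0 < x by apply: lt_trans rx; rewrite subr_gt0.
  have cut (m : fmeasure) : fine (m `[0, L]%classic) =
      fine (m `[0, x]%classic) + (fine (m `]x, L[%classic) + fine (m [set L])).
    rewrite -(@fin_cut m _ _ `]x, L]%classic); [|exact: mi|exact: measurable_set1| |].
    - apply: fin_cut; [exact: mi|exact: mi| |].
      + by apply/seteqP; split => // y [/=]; rewrite !in_itv/= => /andP[_ yx]; rewrite ltNge yx.
      + apply/seteqP; split => y /=; rewrite !in_itv/=.
          by move=> /andP[-> yL]; case: (leP y x) => h; [left|right].
        move=> [/andP[-> yx]|/andP[xy ->]]; first by rewrite (le_trans yx)// ltW.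
        by rewrite andbT (le_trans (ltW x0))// ltW.
    - by apply/seteqP; split => // y [/= h yL]; move: h; rewrite yL in_itv/= ltxx andbF.
    - apply/seteqP; split => y /=; rewrite !in_itv/=.
        by move=> /andP[->]; rewrite le_eqVlt => /predU1P[->|->]; [right|left].
      by move=> [/andP[-> /ltW]|->] //; rewrite xL lexx.
  have small (m : fmeasure) : 0 <= fine (m `]x, L[%classic) <= fine (m `](L - r), L[%classic).
    apply: fin_mono; [exact: mi|exact: mi|] => y /=; rewrite !in_itv/= => /andP[xy ->].
    by rewrite (lt_trans rx).
  have -> : v x - (wL - fine (p [set L])) =
      e * (x - L) - (fine (P `]x, L[%classic) - fine (N `]x, L[%classic)).
    rewrite right_boundary_value /v charge_mass_upto /mass_upto -/P -/N (pE (mi _)) !cut pE//; ring.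
  have /andP[P0 Pr] := small P; have /andP[N0 Nr] := small N.
  rewrite (le_trans (ler_normB _ _))// lerD//.
    rewrite normrM ler_wpM2l// distrC ger0_norm ?subr_ge0 ?(ltW xL)//.
    by rewrite lerBlDr -lerBlDl ltW.
  by rewrite (le_trans (ler_normB _ _))// !ger0_norm// lerD.
- rewrite -[X in _ --> X]addr0; apply: cvgD; first exact: lin_cvg.
  by rewrite -[X in _ --> X]addr0; apply: cvgD; exact: shrink.
Qed.

(** The atoms at the endpoints are the gaps between the datum and the traces. *)
Lemma boundary_plastic_strain A : measurable A ->
  p (A `&` [set 0; L]) = ((wL - traceL L u)%:E * dirac L A -
     (w0 - trace0 u)%:E * dirac (0%R : R) A)%E.
Proof.
move=> mA; rewrite trace0_eq traceL_eq subKr opprD addrA subrr add0r !diracE.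
have m1 (x : R) : measurable ([set x] : set (measurableTypeR R)) by exact: measurable_set1.
have pt (x : R) : p (A `&` [set x]) = ((fine (p [set x]))%:E * ((x \in A)%:R)%:E)%E.
  have [xA|xA] := boolP (x \in A).
    rewrite mule1 fineK; last exact: fin_num_measure.
    by congr (p _); apply: setIidr => y /= ->; move: xA; rewrite inE.
  rewrite mule0; apply: etrans (charge0 p); congr (p _).
  by apply/seteqP; split => // y [Ay /= yx]; move/negP: xA; apply; rewrite inE -yx.
have -> : A `&` [set 0; L] = (A `&` [set L]) `|` (A `&` [set 0]) by rewrite -setIUr setUC.
rewrite chargeU; [|exact: measurableI|exact: measurableI|]; last first.
  by apply/seteqP; split => // x [[_ /= xL] [_ /= x0]]; move: L0; rewrite -xL x0 ltxx.
by rewrite !pt EFinN mulNe oppeK.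
Qed.

End traces_of_the_displacement.

Theorem theorem1p2 (R : realType) (L T kappa a0 a1 : R)
  (L_gt0 : 0 < L) (T_gt0 : 0 < T) (kappa_gt0 : 0 < kappa)
  (a0_gt0 : 0 < a0) (a1_gt0 : 0 < a1)
  (w wdot : R -> R -> R)
  (w_AC : AC_H1 T w) (w_wdot : H1_time_derivative T w wdot)
  (ue Thetae ae : R -> R -> R -> R)
  (damage : forall eps : R, 0 < eps -> eps * a0 < a1 ->
    brittle_damage_evolution L T kappa a0 a1 w wdot eps
      (ue eps) (Thetae eps) (ae eps))
  (u : R -> R -> R) (e : R -> R)
  (p : R -> {charge set (measurableTypeR R) -> \bar R})
  (sigma : R -> R)
  (mu : R -> {charge set (measurableTypeR R) -> \bar R})
  (limit : limit_evolution L T kappa a0 a1 ue Thetae ae u e p sigma mu) :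
  perfect_plasticity_evolution L T kappa a0 a1 w wdot u (fun t => cst (e t)) p
  <->
  (forall s t : R, 0 <= s -> s < t -> t <= T ->
    `|boundary_jump L (w t)| < `|boundary_jump L (w s)| ->
    `|boundary_jump L (w t)| <= Num.sqrt (2 * kappa * a0) * (L / a1)).

Proof.
move: limit => [values [_ _ _ sigmaAC _] [eps [eps_small eps_cvg lim]]].
pose un n := ue (eps n); pose Tn n := Thetae (eps n); pose an n := ae (eps n).
have evol n : brittle_damage_evolution L T kappa a0 a1 w wdot (eps n) (un n) (Tn n) (an n).
  by have [h1 h2] := eps_small n; exact: damage.
have u_cvg t : 0 <= t <= T -> (fun n => L1_dist `]0, L[ (un n t) (u t)) @ \oo --> (0 : R).
  by move=> tT; have [[h _] _ _ _ _] := lim t tT; exact: h.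
have mu_cvg t : 0 <= t <= T ->
    density_wstar_cvg L (fun n x => (1 - Tn n t x) / eps n) (mu t).
  by move=> tT; have [_ h _ _ _] := lim t tT; exact: h.
have sigma_cvg t : 0 <= t <= T -> (fun n => stress L (an n t) (un n t)) @ \oo --> sigma t.
  by move=> tT; have [_ _ h _ _] := lim t tT; exact: h.
have e_cvg t : 0 <= t <= T -> forall g, L2 `]0, L[ g ->
    (fun n => \int[@lebesgue_measure R]_(x in `]0, L[)
       (stress L (an n t) (un n t) / a1 * Tn n t x * g x)) @ \oo -->
    \int[@lebesgue_measure R]_(x in `]0, L[) (e t * g x).
  by move=> tT; have [_ _ _ h _] := lim t tT; exact: h.
have p_cvg t : 0 <= t <= T -> density_wstar_cvg L
    (fun n x => stress L (an n t) (un n t) / a0 * ((1 - Tn n t x) / eps n)) (p t).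
  by move=> tT; have [_ _ _ _ h] := lim t tT; exact: h.
have [Hw AC] := w_AC; have [Hwd _ _] := w_wdot.
have [G [iG aeG FTC]] := AC_FTC T_gt0 (jump_AC L_gt0 w_AC) (jump_derivative L_gt0 w_AC w_wdot).
pose k := Num.sqrt (2 * kappa * a0); pose b := L / a1.
pose P t := limit_mass L mu t / a0; pose ell t := boundary_jump L (w t).
have kk : 0 < 2 * kappa * a0 by rewrite !mulr_gt0.
have k0 : 0 < k by rewrite sqrtr_gt0.
have k2 : k ^+ 2 = 2 * kappa * a0 by rewrite sqr_sqrtr// ltW.
have b0 : 0 < b by rewrite divr_gt0.
have compliance t : 0 <= t <= T -> sigma t * (P t + b) = ell t.
  exact: (limit_stress_compliance L_gt0 a0_gt0 a1_gt0 w_AC eps_small eps_cvg evol mu_cvg sigma_cvg).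
have strain t : 0 <= t <= T -> a1 * e t = sigma t.
  exact: (limit_strain L_gt0 a1_gt0 eps_small eps_cvg evol mu_cvg sigma_cvg e_cvg).
have P_ge0 t : 0 <= t <= T -> 0 <= P t.
  by move=> tT; rewrite divr_ge0 ?(ltW a0_gt0)//; exact: (limit_mass_ge0 L_gt0 eps_small evol mu_cvg).
have P_nd s t : 0 <= s -> s <= t -> t <= T -> P s <= P t.
  move=> s0 st tT; rewrite ler_pM2r ?invr_gt0//.
  exact: (limit_mass_nd L_gt0 eps_small evol mu_cvg).
have yield t : 0 <= t <= T -> sigma t ^+ 2 <= k ^+ 2.
  move=> tT; have [_ _ + _] := values t tT; rewrite /yield_set /= in_itv/= -/k -ler_norml.
  by rewrite -(ger0_norm (sqr_ge0 (sigma t))) normrX ler_pXn2r ?nnegrE// ltW.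
have z : 0 <= (0 : R) <= T by rewrite lexx ltW.
have initial : 0 < P 0 -> sigma 0 ^+ 2 = k ^+ 2.
  move=> P0; apply/eqP; rewrite eq_le yield//= k2.
  apply: (limit_initial_yield L_gt0 T_gt0 kappa_gt0 a0_gt0 a1_gt0 eps_small evol mu_cvg sigma_cvg).
  by move: P0; rewrite pmulr_lgt0// invr_gt0.
have balance t : 0 <= t <= T ->
    2^-1 * (sigma t * ell t) + 2^-1 * k ^+ 2 * P t =
    2^-1 * (sigma 0 * ell 0) + 2^-1 * k ^+ 2 * P 0 +
    \int[@lebesgue_measure R]_(r in `[0, t]) (sigma r * G r).
  move=> tT; have kP r : 2^-1 * k ^+ 2 * P r = kappa * limit_mass L mu r.
    by rewrite k2 /P; field; rewrite gt_eqF.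
  rewrite !kP; exact: (limit_energy_balance L_gt0 T_gt0 a0_gt0 a1_gt0 w_AC w_wdot eps_small evol
    mu_cvg sigma_cvg sigmaAC iG aeG tT).
have mJ : measurable (`[0, L]%classic : set (measurableTypeR R)) by exact: measurable_itv.
have := @energy_balance_iff R T k b sigma P ell G T_gt0 k0 b0 compliance P_ge0 P_nd yield initial
  sigmaAC iG FTC balance _ (var_dist `[0, L]) p (fun x y => var_dist_fin x y mJ).
case.
- move=> s t sT tT.
  exact: (var_dist_ge_mass L_gt0 eps_small evol mu_cvg sigma_cvg p_cvg).
- move=> s t s0 st tT flow.
  apply: (var_dist_of_flow L_gt0 a0_gt0 eps_small evol mu_cvg sigma_cvg p_cvg) => //.
  case: flow => [Ps|]; [left|by right].
  by move/eqP: Ps; rewrite mulf_eq0 invr_eq0 (gt_eqF a0_gt0) orbF => /eqP.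
move=> jumps_of_balance balance_of_jumps.
pose I := (`]0, L[%classic : set R).
have mI : measurable I by exact: measurable_itv.
have lebI : lebesgue_measure I = L%:E by rewrite leb_oo ?subr0 ?ltW.
have Ioo : (lebesgue_measure I < +oo)%E by rewrite lebI ltry.
have elasticE t : 0 <= t <= T -> elastic_energy L a1 (cst (e t)) = 2^-1 * (b * sigma t ^+ 2).
  move=> tT; rewrite /elastic_energy; have /= -> := Rintegral_cst_leb (a1 * e t ^+ 2) mI lebI.
  rewrite -(strain t tT) /b.
  by field; rewrite gt_eqF.
have workE t : 0 <= t <= T -> external_work L wdot (fun s x => a1 * cst (e s) x) t =
    \int[@lebesgue_measure R]_(r in `[0, t]) (sigma r * G r).
  move=> t0T; have /andP[t0 tT] := t0T.
  rewrite -(int_jump_rate aeG sigma t0T); apply: eq_Rintegral => s.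
  rewrite inE/= in_itv/= => /andP[s0 st].
  have sT : 0 <= s <= T by rewrite s0 (le_trans st).
  have L2d : L2 I (wderiv setT (wdot s)).
    by have [L2d _] := wderivP (Hwd s sT); exact: L2S L2d.
  by rewrite RintegralZl ?strain//; exact: L2_L1.
split=> [[_ _ _ fin EB]|jumps].
  apply: jumps_of_balance; split=> // t tT.
  by have := EB t tT; rewrite workE// !elasticE.
have [fin EB] := balance_of_jumps jumps; split=> //.
- move=> t tT; have [BVu pL _ _] := values t tT; split=> //.
  exact: (@bounded_L2 _ I _ `|e t|).
- move=> t tT; have [BVu pL _ _] := values t tT.
  have L1u s : 0 <= s <= T -> L1 `]0, L[ (u s).
    by move=> sT; have [[]] := values s sT.
  have green psi := @green_limit R L T kappa a0 a1 w wdot eps un Tn an u e p L_gt0 a0_gt0 a1_gt0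
    Hw eps_small evol L1u u_cvg e_cvg p_cvg t psi tT.
  split=> A mA; first exact: (boundary_plastic_strain L_gt0 (L1u t tT) green mA).
  by move=> AI; exact: (DuE L_gt0 BVu green mA AI).
- move=> t tT; split=> [phi H10phi|].
    have [H1phi _] := H10phi; have wphi := wderivP H1phi.
    rewrite -[LHS]/(\int[@lebesgue_measure R]_(x in I) ((a1 * e t) * wderiv I phi x)).
    rewrite RintegralZl//; last by apply: L2_L1 => //; have [] := wphi.
    by rewrite (H10_int_derivative L_gt0 H10phi wphi) mulr0.
  by apply: aeW => x _; rewrite /= strain//; have [_ _ + _] := values t tT.
- by move=> t tT; rewrite workE// !elasticE//; exact: EB.
Qed.
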